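(* Let $f$ be a nonconstant entire function. If there are two different nonzero complex numbers $a$ and $b$ such that $f$ and $f'$ share the value $a$ allowing ramification and share the value $b$ allowing ramification, then $f$ is a transcendental function (i.e. not a polynomial) of order at most one.
   Context: Definition. For an entire function $f$ and a nonzero complex number $c$, $f$ and $f'$ share the value $c$ allowing ramification if for all $z\in\mathbb{C}$: $f(z)=c$ implies $f'(z)\in\{c,0\}$, and $f'(z)=c$ implies $f(z)=c$. The order of a nonconstant entire function $f$ is the usual growth order $\limsup_{r\to\infty}\frac{\log\log \max_{|z|=r}|f(z)|}{\log r}$. *)

(* Defs.v *)
From Stdlib Require Import Reals.
From Coquelicot Require Import Coquelicot.

Open Scope R_scope.

Definition entire (f : C -> C) : Prop :=
  forall z : C, @ex_derive C_AbsRing C_NormedModule f z.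

Definition nonconstant (f : C -> C) : Prop :=
  ~ exists c : C, forall z : C, f z = c.

Definition is_polynomial (f : C -> C) : Prop :=
  exists (n : nat) (a : nat -> C),
    forall z : C, f z = sum_n (fun k => (a k * z ^ k)%C) n.

Definition transcendental (f : C -> C) : Prop := ~ is_polynomial f.

(* For entire [f], Coquelicot's [C_derive f] is the complex derivative
   ([C_derive_correct]). *)
Definition share_allowing_ramification (f : C -> C) (c : C) : Prop :=
  forall z : C,
    (f z = c -> C_derive f z = c \/ C_derive f z = 0%C) /\
    (C_derive f z = c -> f z = c).

(* For [r >= 0] and [f] continuous, the circle is compact and nonempty, so the
   least upper bound is finite and is the maximum. *)
Definition max_modulus (f : C -> C) (r : R) : R :=
  real (Lub_Rbar (fun y => exists z : C, Cmod z = r /\ y = Cmod (f z))).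

(* Coquelicot's [LimSup_seq] covers only sequences. *)
Definition LimSup_p_infty (g : R -> R) : Rbar :=
  Rbar_glb (fun s : Rbar =>
    exists r0 : R, s = Lub_Rbar (fun y => exists r : R, r0 < r /\ y = g r)).

(* Stdlib's [ln] is 0 on nonpositive reals; for [f] nonconstant entire the
   maximum modulus tends to infinity, so this does not affect the limsup. *)
Definition growth_order (f : C -> C) : Rbar :=
  LimSup_p_infty (fun r => ln (ln (max_modulus f r)) / ln r).

(* Main.v *)
Require Import Defs.
From Stdlib Require Import Reals Lra Lia Arith Classical ClassicalEpsilon.
From Coquelicot Require Import Coquelicot.
From mathcomp Require all_boot all_order all_algebra ring zify Rstruct complex.

(** The order is at most one, because an entire [g] with [|g'| <= K] wherever
    [|g| <= 1] grows at most exponentially.  Let [|g z| > 1] and let [p] be the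
    point of the closed set [|g| <= 1] nearest to [z].  On the disc about [z]
    through [p] the function [ln |g|] is positive and harmonic, so by Harnack's
    inequality it goes to 0 at [p] with slope at least [ln |g z| / (2 |p - z|)];
    this slope is at most [K], whence [ln |g z| <= 2 K |p - z|] ([touching_disc],
    [growth_lemma]).  So it is enough to bound [f'] on the set [|f| <= 1], which is
    [derivative_bounded_where_small].

    Suppose that [f'] is unbounded there.  Near points [w] of that set at which [f'] is
    large, choosing points of the set at which
    [(1 - |z - w|) |f' z|] is almost maximal ([rescaling_point]) gives rescaled
    functions [G n z = f (z_n + rho_n z)], with [rho_n] tending to 0, such that
    [|G n 0| <= 1], [|(G n)' 0| = 1], and [|(G n)'| <= 4] wherever [|G n| <= 1] on
    discs whose radii tend to infinity.  By the growth lemma these functions are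
    locally uniformly bounded; that is what bounded spherical derivatives achieve
    in Zalcman's lemma.  Hence they have a limit [g] of exponential type with
    [|g' 0| = 1] ([montel]).  The sharing of values now forbids such a limit.
    - If [g'] has a zero, then by Hurwitz's theorem [(G n)' - rho_n a] has zeros
      close to it; there [f' = a], so [f = a], and [g] has the value [a] at the zero.
      The same holds for [b], but [a <> b].  So [g'] has no zeros.
    - If [g] takes the value [a], then [G n] takes it nearby, where [f'] is 0 or [a]
      and [(G n)'] is at most [rho_n |a|]; in the limit [g'] has a zero.  So [g] omits
      [a], and likewise [b].
    A zero-free [g'] of exponential type is [k exp (alpha z)], so [g] is affine or an
    exponential plus a constant, and omits at most one value
    ([picard_exponential_type]).

    A polynomial [p] of degree [n >= 3] cannot share two values: the multiplicities
    of the roots of [p' - t] show that [p' - t] divides [p'' (p - t)] for [t = a] and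
    [t = b], and reducing this modulo [p' - t] with the Euclidean division of [p] by
    [p'] gives a contradiction of degrees ([no_sharing_ge3]).  Degrees 1 and 2 are
    settled by explicit points.

    The complex analysis starts from complex differentiability at every point of an
    open disc.  Goursat's theorem for triangles is pulled back along [exp], which turns concentric circles into vertical segments; this yields
    the mean value property, even when one point of the disc is exceptional, and from
    there Cauchy's formula and Taylor expansions. *)

(** * Complex differentiability *)

Definition cderive (f : C -> C) (z l : C) : Prop :=
  @is_derive C_AbsRing C_NormedModule f z l.

Lemma cderive_eps (f : C -> C) (z l : C) :
  cderive f z l <->
  forall eps : R, 0 < eps -> exists d : R, 0 < d /\
    forall w : C, Cmod (w - z) < d ->
      Cmod (f w - f z - l * (w - z)) <= eps * Cmod (w - z).
Proof.
  split.
  - intros [_ H] eps Heps.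
    destruct (H z (fun P HP => HP) (mkposreal eps Heps)) as [d Hd].
    exists d; split; [apply cond_pos|].
    intros w Hw. specialize (Hd w Hw).
    change (Cmod ((f w - f z) - (w - z) * l) <= eps * Cmod (w - z)) in Hd.
    replace (f w - f z - l * (w - z))%C with ((f w - f z) - (w - z) * l)%C by ring.
    exact Hd.
  - intros H. split; [apply is_linear_scal_l|].
    intros x Hx.
    assert (Ex : z = x) by
      (apply (@is_filter_lim_locally_unique C_AbsRing (AbsRing_NormedModule C_AbsRing)); exact Hx).
    subst x.
    intros eps. destruct (H eps (cond_pos eps)) as [d [Hd0 Hd]].
    exists (mkposreal d Hd0). intros w Hw.
    change (Cmod ((f w - f z) - (w - z) * l) <= eps * Cmod (w - z)).
    replace ((f w - f z) - (w - z) * l)%C with (f w - f z - l * (w - z))%C by ring.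
    apply Hd; exact Hw.
Qed.

(** Continuity at a point in terms of the modulus: the uniform structure that
    [C] has as a pair of reals is given by another, equivalent, metric. *)
Definition ccont (f : C -> C) (z : C) : Prop :=
  forall eps : R, 0 < eps -> exists d : R, 0 < d /\
    forall w : C, Cmod (w - z) < d -> Cmod (f w - f z) < eps.

Lemma Cmod_sub_sym (x y : C) : Cmod (x - y) = Cmod (y - x).
Proof. rewrite <- Cmod_opp. f_equal; ring. Qed.

Lemma Cmod_sub_tri (x y z : C) : Cmod (x - z) <= Cmod (x - y) + Cmod (y - z).
Proof. replace (x - z)%C with ((x - y) + (y - z))%C by ring. apply Cmod_triangle. Qed.

Lemma Cmod_le_add_sub (x y : C) : Cmod x <= Cmod y + Cmod (x - y).
Proof. replace x with (y + (x - y))%C at 1 by ring. apply Cmod_triangle. Qed.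

Lemma Cmod_minus_le (x y : C) : Cmod (x - y) <= Cmod x + Cmod y.
Proof. rewrite <- (Cmod_opp y). apply Cmod_triangle. Qed.

Lemma Cmod_sub_eq_0 (x y : C) : Cmod (x - y) = 0 -> x = y.
Proof. intros H. apply Cmod_eq_0 in H. apply Ceq_minus; exact H. Qed.

Lemma ccont_const (c z : C) : ccont (fun _ => c) z.
Proof.
  intros eps He; exists 1; split; [lra|]. intros w _.
  replace (c - c)%C with (RtoC 0) by ring. rewrite Cmod_0; lra.
Qed.

Lemma ccont_id (z : C) : ccont (fun w => w) z.
Proof. intros eps He; exists eps; auto. Qed.

Lemma ccont_plus (f g : C -> C) (z : C) :
  ccont f z -> ccont g z -> ccont (fun w => f w + g w)%C z.
Proof.
  intros Hf Hg eps He.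
  destruct (Hf (eps/2) ltac:(lra)) as [d1 [Hd1 H1]].
  destruct (Hg (eps/2) ltac:(lra)) as [d2 [Hd2 H2]].
  exists (Rmin d1 d2); split; [apply Rmin_pos; auto|].
  intros w Hw.
  specialize (H1 w (Rlt_le_trans _ _ _ Hw (Rmin_l _ _))).
  specialize (H2 w (Rlt_le_trans _ _ _ Hw (Rmin_r _ _))).
  replace (f w + g w - (f z + g z))%C with ((f w - f z) + (g w - g z))%C by ring.
  eapply Rle_lt_trans; [apply Cmod_triangle|lra].
Qed.

Lemma ccont_mult (f g : C -> C) (z : C) :
  ccont f z -> ccont g z -> ccont (fun w => f w * g w)%C z.
Proof.
  intros Hf Hg eps He.
  pose proof (Cmod_ge_0 (f z)) as Pf. pose proof (Cmod_ge_0 (g z)) as Pg.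
  set (A := Cmod (f z) + Cmod (g z) + 1).
  assert (HA : 0 < A) by (unfold A; lra).
  assert (Hq : 0 < Rmin 1 (eps / (2 * A))).
  { apply Rmin_pos; [lra|]. apply Rdiv_lt_0_compat; lra. }
  destruct (Hf _ Hq) as [d1 [Hd1 H1]].
  destruct (Hg _ Hq) as [d2 [Hd2 H2]].
  exists (Rmin d1 d2); split; [apply Rmin_pos; auto|].
  intros w Hw.
  specialize (H1 w (Rlt_le_trans _ _ _ Hw (Rmin_l _ _))).
  specialize (H2 w (Rlt_le_trans _ _ _ Hw (Rmin_r _ _))).
  set (e := Rmin 1 (eps / (2*A))) in *.
  assert (Hq1 : e <= 1) by apply Rmin_l.
  assert (Hq2 : e * (2 * A) <= eps).
  { apply Rle_trans with (eps / (2*A) * (2*A)).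
    - apply Rmult_le_compat_r; [lra|apply Rmin_r].
    - right; field; lra. }
  replace (f w * g w - f z * g z)%C
    with ((f w - f z) * (g w - g z) + (f w - f z) * g z + f z * (g w - g z))%C by ring.
  eapply Rle_lt_trans; [apply Cmod_triangle|].
  eapply Rle_lt_trans; [apply Rplus_le_compat_r, Cmod_triangle|].
  rewrite !Cmod_mult.
  pose proof (Cmod_ge_0 (f w - f z)). pose proof (Cmod_ge_0 (g w - g z)).
  set (u := Cmod (f w - f z)) in *. set (v := Cmod (g w - g z)) in *.
  unfold A in *. nra.
Qed.

Lemma ccont_comp (f g : C -> C) (z : C) :
  ccont g z -> ccont f (g z) -> ccont (fun w => f (g w)) z.
Proof.
  intros Hg Hf eps He. destruct (Hf eps He) as [d [Hd H]].
  destruct (Hg d Hd) as [d' [Hd' H']]. exists d'; split; auto.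
Qed.

Lemma ccont_inv (z : C) : z <> 0%C -> ccont Cinv z.
Proof.
  intros Hz eps He. pose proof (proj1 (Cmod_gt_0 z) Hz) as Pz.
  set (m := Cmod z) in *.
  exists (Rmin (m/2) (eps * (m * m) / 2)); split.
  { apply Rmin_pos; [lra|]. apply Rdiv_lt_0_compat; [|lra]. 
    apply Rmult_lt_0_compat; nra. }
  intros w Hw.
  assert (H1 := Rlt_le_trans _ _ _ Hw (Rmin_l _ _)).
  assert (H2 := Rlt_le_trans _ _ _ Hw (Rmin_r _ _)).
  assert (Hm : m / 2 < Cmod w).
  { pose proof (Cmod_le_add_sub z w) as H. rewrite Cmod_sub_sym in H. fold m in H. lra. }
  assert (Hw0 : w <> 0%C) by (apply Cmod_gt_0; lra).
  replace (/ w - / z)%C with ((z - w) / (w * z))%C by (field; auto).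
  rewrite Cmod_div by (apply Cmult_neq_0; auto).
  rewrite Cmod_mult, Cmod_sub_sym. fold m.
  apply (Rmult_lt_reg_r (Cmod w * m)); [nra|].
  unfold Rdiv. rewrite Rmult_assoc, Rinv_l by nra.
  assert (0 < eps * m * (Cmod w - m / 2))
    by (apply Rmult_lt_0_compat; [apply Rmult_lt_0_compat|]; lra).
  nra.
Qed.

Lemma ccont_ext_loc (f g : C -> C) (z : C) (d : R) :
  0 < d -> (forall w, Cmod (w - z) < d -> f w = g w) -> ccont f z -> ccont g z.
Proof.
  intros Hd E Hf eps He. destruct (Hf eps He) as [d' [Hd' H]].
  exists (Rmin d d'); split; [apply Rmin_pos; auto|]. intros w Hw.
  rewrite <- !E.
  - apply H. eapply Rlt_le_trans; [exact Hw|apply Rmin_r].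
  - replace (z - z)%C with (RtoC 0) by ring. rewrite Cmod_0; auto.
  - eapply Rlt_le_trans; [exact Hw|apply Rmin_l].
Qed.

(** Caratheodory's form of differentiability.  It turns the product, chain and
    inverse rules into algebra with continuous functions. *)
Lemma cderive_slope (f : C -> C) (z l : C) :
  cderive f z l <->
  exists phi : C -> C, ccont phi z /\ phi z = l /\
    forall w, f w = (f z + phi w * (w - z))%C.
Proof.
  rewrite cderive_eps. split.
  - intros H.
    exists (fun w => if Ceq_dec w z then l else ((f w - f z) / (w - z))%C).
    split; [|split].
    + intros eps He. destruct (H (eps/2) ltac:(lra)) as [d [Hd Hw]].
      exists d; split; auto. intros w W.
      destruct (Ceq_dec z z) as [_|N]; [|contradiction].
      destruct (Ceq_dec w z) as [->|N].
      * replace (l - l)%C with (RtoC 0) by ring. rewrite Cmod_0; auto.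
      * assert (N' : (w - z)%C <> 0%C) by (apply Cminus_eq_contra; auto).
        replace ((f w - f z) / (w - z) - l)%C
          with ((f w - f z - l * (w - z)) / (w - z))%C by (field; auto).
        rewrite Cmod_div by auto. specialize (Hw w W).
        pose proof (proj1 (Cmod_gt_0 _) N').
        apply Rle_lt_trans with (eps/2); [|lra].
        apply Rle_div_l; auto.
    + destruct (Ceq_dec z z); [auto|contradiction].
    + intros w. destruct (Ceq_dec w z) as [->|N]; [ring|].
      assert ((w - z)%C <> 0%C) by (apply Cminus_eq_contra; auto). field; auto.
  - intros [phi [Hc [<- E]]] eps He.
    destruct (Hc eps He) as [d [Hd H]]. exists d; split; auto.
    intros w Hw. rewrite (E w).
    replace (f z + phi w * (w - z) - f z - phi z * (w - z))%C
      with ((phi w - phi z) * (w - z))%C by ring.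
    rewrite Cmod_mult. apply Rmult_le_compat_r; [apply Cmod_ge_0|].
    apply Rlt_le, H; auto.
Qed.

Lemma cderive_ccont (f : C -> C) (z l : C) : cderive f z l -> ccont f z.
Proof.
  intros H. apply cderive_slope in H. destruct H as [phi [Hc [_ E]]].
  apply (ccont_ext_loc (fun w => f z + phi w * (w + (- z)))%C f z 1); [lra| |].
  - intros w _. rewrite (E w). reflexivity.
  - apply ccont_plus; [apply ccont_const|]. apply ccont_mult; auto.
    apply ccont_plus; [apply ccont_id|apply ccont_const].
Qed.

Lemma cderive_const (c z : C) : cderive (fun _ => c) z 0%C.
Proof. apply (@is_derive_const C_AbsRing C_NormedModule). Qed.

Lemma cderive_id (z : C) : cderive (fun w => w) z 1%C.
Proof.
  apply cderive_slope. exists (fun _ => RtoC 1). split; [apply ccont_const|].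
  split; auto. intros w; ring.
Qed.

Lemma cderive_plus (f g : C -> C) (z lf lg : C) :
  cderive f z lf -> cderive g z lg -> cderive (fun w => f w + g w)%C z (lf + lg)%C.
Proof. apply (@is_derive_plus C_AbsRing C_NormedModule). Qed.

Lemma cderive_opp (f : C -> C) (z lf : C) :
  cderive f z lf -> cderive (fun w => - f w)%C z (- lf)%C.
Proof. apply (@is_derive_opp C_AbsRing C_NormedModule). Qed.

Lemma cderive_minus (f g : C -> C) (z lf lg : C) :
  cderive f z lf -> cderive g z lg -> cderive (fun w => f w - g w)%C z (lf - lg)%C.
Proof. apply (@is_derive_minus C_AbsRing C_NormedModule). Qed.

Lemma cderive_mult (f g : C -> C) (z lf lg : C) :
  cderive f z lf -> cderive g z lg ->
  cderive (fun w => f w * g w)%C z (lf * g z + f z * lg)%C.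
Proof.
  intros Hf Hg. pose proof (cderive_ccont _ _ _ Hg) as Cg.
  apply cderive_slope in Hf, Hg. apply cderive_slope.
  destruct Hf as [p [Cp [<- Ep]]], Hg as [q [Cq [<- Eq]]].
  exists (fun w => p w * g w + f z * q w)%C. split; [|split; auto].
  - apply ccont_plus; apply ccont_mult; auto; apply ccont_const.
  - intros w. rewrite (Ep w), (Eq w). ring.
Qed.

Lemma cderive_comp (f g : C -> C) (z lf lg : C) :
  cderive f (g z) lf -> cderive g z lg -> cderive (fun w => f (g w)) z (lf * lg)%C.
Proof.
  intros Hf Hg. pose proof (cderive_ccont _ _ _ Hg) as Cg.
  apply cderive_slope in Hf, Hg. apply cderive_slope.
  destruct Hf as [p [Cp [<- Ep]]], Hg as [q [Cq [<- Eq]]].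
  exists (fun w => p (g w) * q w)%C. split; [|split; auto].
  - apply ccont_mult; auto. apply (ccont_comp p g); auto.
  - intros w. rewrite (Ep (g w)), (Eq w). ring.
Qed.

Lemma cderive_inv (z : C) : z <> 0%C -> cderive Cinv z (- / (z * z))%C.
Proof.
  intros Hz. apply cderive_slope.
  exists (fun w => if Ceq_dec w 0 then (/ z / z)%C else (- / (w * z))%C).
  split; [|split].
  - apply (ccont_ext_loc (fun w => - / z * / w)%C _ z (Cmod z)).
    + apply Cmod_gt_0; auto.
    + intros w Hw. destruct (Ceq_dec w 0) as [->|N].
      * exfalso. rewrite Cmod_sub_sym in Hw.
        replace (z - 0)%C with z in Hw by ring. lra.
      * field; auto.
    + apply ccont_mult; [apply ccont_const|apply ccont_inv; auto].
  - destruct (Ceq_dec z 0); [contradiction|]. field; auto.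
  - intros w. destruct (Ceq_dec w 0) as [->|N].
    + replace (/ 0)%C with (RtoC 0).
      * field; auto.
      * unfold Cinv, RtoC; simpl. f_equal; unfold Rdiv; ring.
    + field; auto.
Qed.

Lemma cderive_ext_loc (f g : C -> C) (z l : C) (d : R) :
  0 < d -> (forall w, Cmod (w - z) < d -> f w = g w) -> cderive f z l -> cderive g z l.
Proof.
  intros Hd E. rewrite !cderive_eps. intros H eps He.
  destruct (H eps He) as [d' [Hd' H']]. exists (Rmin d d').
  split; [apply Rmin_pos; auto|]. intros w Hw. rewrite <- !E.
  - apply H'. eapply Rlt_le_trans; [exact Hw|apply Rmin_r].
  - replace (z - z)%C with (RtoC 0) by ring. rewrite Cmod_0; auto.
  - eapply Rlt_le_trans; [exact Hw|apply Rmin_l].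
Qed.

Lemma cderive_ext (f g : C -> C) (z l : C) :
  (forall w, f w = g w) -> cderive f z l -> cderive g z l.
Proof. intros E. apply (cderive_ext_loc f g z l 1); [lra|auto]. Qed.

Lemma cderive_eq (f : C -> C) (z l l' : C) : l = l' -> cderive f z l -> cderive f z l'.
Proof. intros ->; auto. Qed.

Lemma cderive_pow (n : nat) (z : C) :
  cderive (fun w => w ^ n)%C z (INR n * z ^ pred n)%C.
Proof.
  induction n as [|n IH].
  - apply (cderive_eq _ _ 0%C); [simpl; ring|]. apply (cderive_const 1%C).
  - apply (cderive_eq _ _ (1 * z ^ n + z * (INR n * z ^ pred n))%C).
    + destruct n; [simpl; ring|]. rewrite (S_INR (S n)), RtoC_plus.
      simpl pred. rewrite !Cpow_S. ring.
    + apply (cderive_mult (fun w => w) (fun w => w ^ n)%C); [apply cderive_id|exact IH].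
Qed.

Lemma cderive_unique (f : C -> C) (z l l' : C) : cderive f z l -> cderive f z l' -> l = l'.
Proof. intros H H'. rewrite <- (is_C_derive_unique _ _ _ H). apply is_C_derive_unique; auto. Qed.

(** * Integrals along segments *)

Lemma Cmod_prod_norm (x : C) : @norm _ C_R_NormedModule x = Cmod x.
Proof. symmetry. apply Cmod_norm. Qed.

Lemma cderive_line (f : C -> C) (p v l : C) (t : R) :
  cderive f (p + t * v)%C l ->
  @is_derive R_AbsRing C_R_NormedModule (fun s : R => f (p + s * v)%C) t (l * v)%C.
Proof.
  rewrite cderive_eps. intros H. split; [apply is_linear_scal_l|].
  intros x Hx.
  assert (Ex : t = x) by
    (apply (@is_filter_lim_locally_unique R_AbsRing (AbsRing_NormedModule R_AbsRing)); exact Hx).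
  subst x. intros eps.
  pose proof (Cmod_ge_0 v) as Pv.
  assert (He : 0 < eps / (Cmod v + 1)) by (apply Rdiv_lt_0_compat; [apply cond_pos|lra]).
  destruct (H _ He) as [d [Hd0 Hd]].
  assert (Hd1 : 0 < d / (Cmod v + 1)) by (apply Rdiv_lt_0_compat; lra).
  exists (mkposreal _ Hd1). intros s Hs. change (Rabs (s - t) < d / (Cmod v + 1)) in Hs.
  rewrite Cmod_prod_norm. change (@norm R_AbsRing R_NormedModule) with Rabs.
  change (@minus _ s t) with (s - t).
  assert (E : (p + s * v - (p + t * v))%C = ((s - t)%R * v)%C)
    by (rewrite RtoC_minus; ring).
  specialize (Hd (p + s * v)%C). rewrite E in Hd.
  rewrite Cmod_mult, Cmod_R in Hd.
  assert (H1 : Rabs (s - t) * (Cmod v + 1) < d) by (apply Rlt_div_r; auto; lra).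
  pose proof (Rabs_pos (s - t)) as Ps.
  assert (H2 : Rabs (s - t) * Cmod v < d) by nra.
  specialize (Hd H2).
  match goal with |- Cmod ?X <= _ =>
    replace X with (f (p + s * v) - f (p + t * v) - l * ((s - t)%R * v))%C end.
  2:{ change (scal (s - t)%R (l * v)%C) with (@scal R_Ring C_R_ModuleSpace (s - t)%R (l * v)%C).
      rewrite scal_R_Cmult.
      change (f (p + s * v) - f (p + t * v) - l * ((s - t)%R * v) =
       (f (p + s * v) - f (p + t * v)) - ((s - t)%R * (l * v)))%C. ring. }
  eapply Rle_trans; [exact Hd|].
  change (eps / (Cmod v + 1) * (Rabs (s - t) * Cmod v) <= eps * Rabs (s - t)).
  apply Rle_trans with (eps / (Cmod v + 1) * (Rabs (s - t) * (Cmod v + 1))).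
  - apply Rmult_le_compat_l; [lra|]. nra.
  - right; field; lra.
Qed.

Lemma ccont_line (f : C -> C) (p v : C) (t : R) :
  ccont f (p + t * v)%C ->
  @continuous R_UniformSpace C_UniformSpace (fun s : R => f (p + s * v)%C) t.
Proof.
  intros H. apply filterlim_locally. intros eps.
  destruct (H eps (cond_pos eps)) as [d [Hd0 Hd]].
  pose proof (Cmod_ge_0 v) as Pv.
  assert (Hd1 : 0 < d / (Cmod v + 1)) by (apply Rdiv_lt_0_compat; lra).
  exists (mkposreal _ Hd1). intros s Hs. change (Rabs (s - t) < d / (Cmod v + 1)) in Hs.
  apply C_NormedModule_mixin_compat1.
  apply (Hd (p + s * v)%C).
  replace (p + s * v - (p + t * v))%C with ((s - t)%R * v)%C
    by (rewrite RtoC_minus; ring).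
  rewrite Cmod_mult, Cmod_R.
  assert (H1 : Rabs (s - t) * (Cmod v + 1) < d) by (apply Rlt_div_r; auto; lra).
  pose proof (Rabs_pos (s - t)) as Ps. nra.
Qed.

(* Equalities between complex numbers may come typed in a normed module
   structure on [C]; [ring] and [field] recognise them only at type [C]. *)
Ltac to_C := match goal with |- ?a = ?b => change (@eq C a b) end.

(** All integrals are over [[0, 1]]: segments and circles are parametrised by it. *)
Definition Cint (phi : R -> C) : C := @RInt C_R_CompleteNormedModule phi 0 1.

Definition Cintegrable (phi : R -> C) : Prop := @ex_RInt C_R_NormedModule phi 0 1.

Definition is_Cint (phi : R -> C) (l : C) : Prop := @is_RInt C_R_NormedModule phi 0 1 l.

Lemma is_Cint_unique phi l : is_Cint phi l -> Cint phi = l.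
Proof. apply (@is_RInt_unique C_R_CompleteNormedModule). Qed.

Lemma Cint_correct phi : Cintegrable phi -> is_Cint phi (Cint phi).
Proof. apply (@RInt_correct C_R_CompleteNormedModule). Qed.

Lemma is_Cint_plus f g lf lg :
  is_Cint f lf -> is_Cint g lg -> is_Cint (fun t => f t + g t)%C (lf + lg)%C.
Proof. apply (@is_RInt_plus C_R_NormedModule). Qed.

Lemma is_Cint_minus f g lf lg :
  is_Cint f lf -> is_Cint g lg -> is_Cint (fun t => f t - g t)%C (lf - lg)%C.
Proof. apply (@is_RInt_minus C_R_NormedModule). Qed.

Lemma is_Cint_scal (c : C) f lf : is_Cint f lf -> is_Cint (fun t => c * f t)%C (c * lf)%C.
Proof.
  intros H.
  pose proof (@is_RInt_fct_extend_fst R_NormedModule R_NormedModule f 0 1 lf H) as H1.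
  pose proof (@is_RInt_fct_extend_snd R_NormedModule R_NormedModule f 0 1 lf H) as H2.
  apply (@is_RInt_fct_extend_pair R_NormedModule R_NormedModule).
  - apply (@is_RInt_minus R_NormedModule (fun t => fst c * fst (f t)) (fun t => snd c * snd (f t)));
      apply (@is_RInt_scal R_NormedModule); auto.
  - apply (@is_RInt_plus R_NormedModule (fun t => fst c * snd (f t)) (fun t => snd c * fst (f t)));
      apply (@is_RInt_scal R_NormedModule); auto.
Qed.

Lemma is_Cint_const (c : C) : is_Cint (fun _ => c) c.
Proof.
  pose proof (@is_RInt_const C_R_NormedModule 0 1 c) as H.
  rewrite scal_R_Cmult in H.
  replace (RtoC (1 - 0) * c)%C with c in H; [exact H|].
  replace (1 - 0) with 1 by ring. ring.
Qed.

Lemma is_Cint_ext f g l : (forall t, 0 <= t <= 1 -> f t = g t) -> is_Cint f l -> is_Cint g l.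
Proof.
  intros E. apply (@is_RInt_ext C_R_NormedModule).
  intros x. rewrite Rmin_left, Rmax_right by lra. intros; apply E; lra.
Qed.

Lemma Cint_ext f g : (forall t, 0 <= t <= 1 -> f t = g t) -> Cint f = Cint g.
Proof.
  intros E. apply (@RInt_ext C_R_CompleteNormedModule).
  intros x. rewrite Rmin_left, Rmax_right by lra. intros; apply E; lra.
Qed.

Lemma is_Cint_bound f l M :
  (forall t, 0 <= t <= 1 -> Cmod (f t) <= M) -> is_Cint f l -> Cmod l <= M.
Proof.
  intros B H. rewrite <- Cmod_prod_norm.
  replace M with ((1 - 0) * M) by ring.
  apply (@norm_RInt_le_const C_R_NormedModule f 0 1); [lra| |exact H].
  intros; rewrite Cmod_prod_norm; auto.
Qed.

Lemma Cintegrable_continuous (f : R -> C) :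
  (forall t, 0 <= t <= 1 -> @continuous R_UniformSpace C_UniformSpace f t) -> Cintegrable f.
Proof.
  intros H. apply (@ex_RInt_continuous C_R_CompleteNormedModule).
  intros z. rewrite Rmin_left, Rmax_right by lra. apply H.
Qed.

Definition pt (p q : C) (t : R) : C := (p + t * (q - p))%C.

Lemma pt_0 p q : pt p q 0 = p.
Proof. unfold pt. ring. Qed.

Lemma pt_1 p q : pt p q 1 = q.
Proof. unfold pt. ring. Qed.

Definition seg (f : C -> C) (p q : C) : C := ((q - p) * Cint (fun t => f (pt p q t)))%C.

Definition seg_cont (f : C -> C) (p q : C) : Prop :=
  forall t, 0 <= t <= 1 -> ccont f (pt p q t).

Lemma seg_integrable f p q : seg_cont f p q -> Cintegrable (fun t => f (pt p q t)).
Proof.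
  intros H. apply Cintegrable_continuous. intros t Ht.
  apply (ccont_line f p (q - p)%C t). apply H; auto.
Qed.

Lemma seg_correct f p q : seg_cont f p q -> is_Cint (fun t => f (pt p q t)) (Cint (fun t => f (pt p q t))).
Proof. intros; apply Cint_correct, seg_integrable; auto. Qed.

Lemma seg_bound f p q M :
  seg_cont f p q -> (forall t, 0 <= t <= 1 -> Cmod (f (pt p q t)) <= M) ->
  Cmod (seg f p q) <= M * Cmod (q - p).
Proof.
  intros Hc HM. unfold seg. rewrite Cmod_mult, Rmult_comm.
  apply Rmult_le_compat_r; [apply Cmod_ge_0|].
  eapply is_Cint_bound; [|apply seg_correct; auto]. exact HM.
Qed.

Lemma seg_rev f p q : seg_cont f p q -> seg f q p = (- seg f p q)%C.
Proof.
  intros H. unfold seg.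
  assert (E : is_Cint (fun t => f (pt q p t)) (Cint (fun t => f (pt p q t)))).
  { pose proof (seg_correct f p q H) as Hi. apply (@is_RInt_swap C_R_NormedModule) in Hi.
    assert (E1 : 1 = -1 * 0 + 1) by ring. assert (E0 : 0 = -1 * 1 + 1) by ring.
    assert (Hj : @is_RInt C_R_NormedModule (fun t => f (pt p q t)) (-1 * 0 + 1) (-1 * 1 + 1)
      (opp (Cint (fun t => f (pt p q t))))) by (rewrite <- E0, <- E1; exact Hi).
    clear Hi; rename Hj into Hi.
    apply (@is_RInt_comp_lin C_R_NormedModule) in Hi.
    apply (@is_RInt_opp C_R_NormedModule) in Hi.
    assert (Hk : is_Cint (fun t => - (@scal _ C_R_ModuleSpace (-1) (f (pt p q (-1 * t + 1)))))%C
      (- - Cint (fun t => f (pt p q t)))%C) by exact Hi.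
    replace (- - Cint (fun t => f (pt p q t)))%C with (Cint (fun t => f (pt p q t))) in Hk by ring.
    revert Hk. apply is_Cint_ext.
    intros t _. rewrite scal_R_Cmult.
    replace (pt p q (-1 * t + 1)) with (pt q p t).
    - replace (RtoC (-1)) with (- (1))%C; [ring|]. rewrite <- RtoC_opp; f_equal; ring.
    - unfold pt. replace (-1 * t + 1) with (1 - t) by ring. rewrite RtoC_minus. ring. }
  rewrite (is_Cint_unique _ _ E). ring.
Qed.

Definition mid (p q : C) : C := ((p + q) / 2)%C.

Lemma RtoC_2_neq : (RtoC 2) <> 0%C.
Proof. intros H. apply RtoC_inj in H. lra. Qed.

Lemma pt_mid_l p q t : pt p (mid p q) t = pt p q (t / 2).
Proof. unfold pt, mid. rewrite RtoC_div by lra. field; apply RtoC_2_neq. Qed.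

Lemma pt_mid_r p q t : pt (mid p q) q t = pt p q ((t + 1) / 2).
Proof. unfold pt, mid. rewrite RtoC_div, RtoC_plus by lra. field; apply RtoC_2_neq. Qed.

Lemma seg_cont_mid_l f p q : seg_cont f p q -> seg_cont f p (mid p q).
Proof. intros H t Ht. rewrite pt_mid_l. apply H. lra. Qed.

Lemma seg_cont_mid_r f p q : seg_cont f p q -> seg_cont f (mid p q) q.
Proof. intros H t Ht. rewrite pt_mid_r. apply H. lra. Qed.

Lemma seg_mid f p q :
  seg_cont f p q -> seg f p q = (seg f p (mid p q) + seg f (mid p q) q)%C.
Proof.
  intros H. unfold seg.
  set (psi := fun t => f (pt p q t)).
  set (A := Cint (fun t => f (pt p (mid p q) t))).
  set (B := Cint (fun t => f (pt (mid p q) q t))).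
  assert (HA : @is_RInt C_R_NormedModule psi 0 (1/2) (/ 2 * A)%C).
  { pose proof (seg_correct _ _ _ (seg_cont_mid_l _ _ _ H)) as HA.
    apply (is_Cint_scal (/2)%C) in HA.
    fold A in HA.
    assert (E0 : 0 = 2 * 0 + 0) by ring. assert (E1 : 1 = 2 * (1/2) + 0) by field.
    assert (HA' : @is_RInt C_R_NormedModule (fun t => / 2 * f (pt p (mid p q) t))%C
       (2 * 0 + 0) (2 * (1/2) + 0) (/ 2 * A)%C) by (rewrite <- E0, <- E1; exact HA).
    clear HA; rename HA' into HA.
    apply (@is_RInt_comp_lin C_R_NormedModule) in HA.
    revert HA. apply (@is_RInt_ext C_R_NormedModule).
    intros t _. rewrite scal_R_Cmult. unfold psi. rewrite pt_mid_l.
    replace ((2 * t + 0) / 2) with t by field. to_C. field; apply RtoC_2_neq. }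
  assert (HB : @is_RInt C_R_NormedModule psi (1/2) 1 (/ 2 * B)%C).
  { pose proof (seg_correct _ _ _ (seg_cont_mid_r _ _ _ H)) as HB.
    apply (is_Cint_scal (/2)%C) in HB.
    fold B in HB.
    assert (E0 : 0 = 2 * (1/2) + (-1)) by field. assert (E1 : 1 = 2 * 1 + (-1)) by ring.
    assert (HB' : @is_RInt C_R_NormedModule (fun t => / 2 * f (pt (mid p q) q t))%C
       (2 * (1/2) + (-1)) (2 * 1 + (-1)) (/ 2 * B)%C) by (rewrite <- E0, <- E1; exact HB).
    clear HB; rename HB' into HB.
    apply (@is_RInt_comp_lin C_R_NormedModule) in HB.
    revert HB. apply (@is_RInt_ext C_R_NormedModule).
    intros t _. rewrite scal_R_Cmult. unfold psi. rewrite pt_mid_r.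
    replace ((2 * t + -1 + 1) / 2) with t by field. to_C. field; apply RtoC_2_neq. }
  pose proof (@is_RInt_Chasles C_R_NormedModule _ _ _ _ _ _ HA HB) as HC.
  apply is_Cint_unique in HC. rewrite HC.
  change (plus (/ 2 * A)%C (/ 2 * B)%C) with (/ 2 * A + / 2 * B)%C.
  unfold mid. field; apply RtoC_2_neq.
Qed.

Lemma seg_primitive (F f : C -> C) p q :
  (forall t, 0 <= t <= 1 -> cderive F (pt p q t) (f (pt p q t))) ->
  seg_cont f p q -> seg f p q = (F q - F p)%C.
Proof.
  intros HF Hc. unfold seg.
  assert (H : is_Cint (fun t => f (pt p q t) * (q - p))%C (F q - F p)%C).
  { replace (F q - F p)%C with (F (pt p q 1) - F (pt p q 0))%C
      by (rewrite pt_0, pt_1; reflexivity).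
    apply (@is_RInt_derive C_R_CompleteNormedModule (fun t => F (pt p q t))).
    - intros t. rewrite Rmin_left, Rmax_right by lra. intros Ht.
      apply (cderive_line F p (q - p)%C). apply HF; auto.
    - intros t. rewrite Rmin_left, Rmax_right by lra. intros Ht.
      apply (ccont_line (fun w => f w * (q - p))%C p (q - p)%C).
      apply ccont_mult; [apply Hc; auto|apply ccont_const]. }
  pose proof (is_Cint_scal (q - p)%C _ _ (seg_correct _ _ _ Hc)) as H'.
  apply is_Cint_unique in H. apply is_Cint_unique in H'.
  rewrite <- H, <- H'. apply Cint_ext. intros t _. ring.
Qed.

Lemma seg_minus f g p q :
  seg_cont f p q -> seg_cont g p q ->
  seg (fun w => f w - g w)%C p q = (seg f p q - seg g p q)%C.
Proof.
  intros Hf Hg. unfold seg.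
  pose proof (is_Cint_minus _ _ _ _ (seg_correct _ _ _ Hf) (seg_correct _ _ _ Hg)) as H.
  apply is_Cint_unique in H. cbv beta in H. rewrite H. ring.
Qed.

Lemma Cmod_le_Re_Im (z : C) : Cmod z <= Rabs (Re z) + Rabs (Im z).
Proof.
  destruct z as [x y]. change (Cmod (x, y) <= Rabs x + Rabs y).
  replace ((x, y) : C) with (RtoC x + RtoC y * Ci)%C.
  - eapply Rle_trans; [apply Cmod_triangle|].
    rewrite Cmod_mult, Cmod_Ci, !Cmod_R, Rmult_1_r. apply Rle_refl.
  - unfold RtoC, Ci, Cplus, Cmult; simpl. f_equal; ring.
Qed.

Lemma im_le_Cmod (z : C) : Rabs (Im z) <= Cmod z.
Proof. eapply Rle_trans; [apply Rmax_r|apply Rmax_Cmod]. Qed.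

(** [x n - 2 D / 2 ^ n] increases and [x n + 2 D / 2 ^ n] decreases, so the limit is
    the supremum of the former. *)
Lemma geometric_cauchy_R (x : nat -> R) (D : R) :
  (forall n, Rabs (x (S n) - x n) <= D / 2 ^ n) ->
  exists l, forall n, Rabs (x n - l) <= 2 * D / 2 ^ n.
Proof.
  intros H.
  assert (P2 : forall n, 0 < 2 ^ n) by (intros; apply pow_lt; lra).
  set (r := fun n => 2 * D / 2 ^ n).
  assert (Er : forall n, r n = r (S n) + D / 2 ^ n).
  { intros n. unfold r. simpl. field. specialize (P2 n); lra. }
  assert (HD : 0 <= D).
  { specialize (H O). simpl in H. pose proof (Rabs_pos (x 1%nat - x O)). lra. }
  assert (Hr : forall n, 0 <= r n).
  { intros n. unfold r. apply Rdiv_le_0_compat; auto. lra. }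
  assert (Hlow : forall n k, x n - r n <= x (n + k)%nat - r (n + k)%nat).
  { intros n; induction k as [|k IH]; [rewrite Nat.add_0_r; lra|].
    rewrite Nat.add_succ_r. specialize (H (n + k)%nat). specialize (Er (n + k)%nat).
    apply Rabs_le_between in H. lra. }
  assert (Hup : forall n k, x (n + k)%nat + r (n + k)%nat <= x n + r n).
  { intros n; induction k as [|k IH]; [rewrite Nat.add_0_r; lra|].
    rewrite Nat.add_succ_r. specialize (H (n + k)%nat). specialize (Er (n + k)%nat).
    apply Rabs_le_between in H. lra. }
  assert (Hmn : forall m n, x m - r m <= x n + r n).
  { intros m n. specialize (Hlow m n). specialize (Hup n m).
    rewrite (Nat.add_comm n m) in Hup. specialize (Hr (m + n)%nat). lra. }
  destruct (completeness (fun y => exists n, y = x n - r n)) as [l [Hl1 Hl2]].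
  - exists (x O + r O). intros y [n ->]. apply Hmn.
  - exists (x O - r O), O; auto.
  - exists l. intros n. apply Rabs_le_between. fold (r n). split.
    + assert (l <= x n + r n) by (apply Hl2; intros y [m ->]; apply Hmn). lra.
    + assert (x n - r n <= l) by (apply Hl1; exists n; auto). lra.
Qed.

Lemma geometric_cauchy_C (a : nat -> C) (D : R) :
  (forall n, Cmod (a (S n) - a n) <= D / 2 ^ n) ->
  exists p, forall n, Cmod (a n - p) <= 4 * D / 2 ^ n.
Proof.
  intros H.
  destruct (geometric_cauchy_R (fun n => Re (a n)) D) as [x Hx].
  { intros n. eapply Rle_trans; [|apply (H n)].
    replace (Re (a (S n)) - Re (a n)) with (Re (a (S n) - a n)) by reflexivity.
    apply re_le_Cmod. }
  destruct (geometric_cauchy_R (fun n => Im (a n)) D) as [y Hy].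
  { intros n. eapply Rle_trans; [|apply (H n)].
    replace (Im (a (S n)) - Im (a n)) with (Im (a (S n) - a n)) by reflexivity.
    apply im_le_Cmod. }
  exists (x, y). intros n.
  eapply Rle_trans; [apply Cmod_le_Re_Im|].
  specialize (Hx n). specialize (Hy n).
  replace (Re (a n - (x, y))) with (Re (a n) - x) by reflexivity.
  replace (Im (a n - (x, y))) with (Im (a n) - y) by reflexivity.
  replace (4 * D / 2 ^ n) with (2 * D / 2 ^ n + 2 * D / 2 ^ n)
    by (field; apply pow_nonzero; lra). lra.
Qed.

Lemma exists_pow2_lt (A e : R) : 0 < e -> exists n : nat, A / 2 ^ n < e.
Proof.
  intros He. destruct (Rle_dec A 0) as [HA|HA].
  - exists O. simpl. lra.
  - assert (H : Rabs (/2) < 1) by (rewrite Rabs_pos_eq; lra).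
    destruct (pow_lt_1_zero _ H (e / A)) as [N HN].
    + apply Rdiv_lt_0_compat; lra.
    + exists N. specialize (HN N (le_n _)). rewrite Rabs_pos_eq in HN.
      * rewrite pow_inv in HN. apply (Rmult_lt_compat_l A) in HN; [|lra].
        replace (A * (e / A)) with e in HN by (field; lra). exact HN.
      * apply pow_le; lra.
Qed.

(** * Goursat's theorem *)

Definition in_strip (m1 m2 : R) (w : C) : Prop := m1 <= Re w <= m2.

Lemma Re_pt p q t : Re (pt p q t) = Re p + t * (Re q - Re p).
Proof. destruct p, q. simpl. ring. Qed.

Lemma in_strip_pt m1 m2 p q t :
  0 <= t <= 1 -> in_strip m1 m2 p -> in_strip m1 m2 q -> in_strip m1 m2 (pt p q t).
Proof. unfold in_strip. rewrite Re_pt. intros; split; nra. Qed.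

Lemma in_strip_closed m1 m2 p :
  (forall eps, 0 < eps -> exists q, in_strip m1 m2 q /\ Cmod (q - p) < eps) -> in_strip m1 m2 p.
Proof.
  intros H.
  assert (Hd : forall q, Rabs (Re q - Re p) <= Cmod (q - p)).
  { intros q. replace (Re q - Re p) with (Re (q - p)) by reflexivity. apply re_le_Cmod. }
  split; apply Rnot_lt_le; intros Hlt.
  - destruct (H (m1 - Re p)) as [q [[Q1 Q2] Hq]]; [lra|].
    specialize (Hd q). apply Rabs_le_between in Hd. lra.
  - destruct (H (Re p - m2)) as [q [[Q1 Q2] Hq]]; [lra|].
    specialize (Hd q). apply Rabs_le_between in Hd. lra.
Qed.

Definition triangle : Type := (C * C * C)%type.

Definition vertices_in (P : C -> Prop) (T : triangle) : Prop :=
  let '(a, b, c) := T in P a /\ P b /\ P c.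

Definition boundary (f : C -> C) (T : triangle) : C :=
  let '(a, b, c) := T in (seg f a b + seg f b c + seg f c a)%C.

Definition perimeter (T : triangle) : R :=
  let '(a, b, c) := T in Cmod (b - a) + Cmod (c - b) + Cmod (a - c).

Definition base (T : triangle) : C := let '(a, _, _) := T in a.

(** Joining the midpoints of the sides cuts a triangle into four; 3 and above name
    the central one.  All four are oriented like the triangle. *)
Definition quarter (i : nat) (T : triangle) : triangle :=
  let '(a, b, c) := T in
  match i with
  | 0 => (a, mid a b, mid c a)
  | 1 => (mid a b, b, mid b c)
  | 2 => (mid c a, mid b c, c)
  | _ => (mid a b, mid b c, mid c a)
  end%nat.

Lemma Cmod_half (z : C) : Cmod (z / 2) = Cmod z / 2.
Proof. rewrite Cmod_div by apply RtoC_2_neq. rewrite Cmod_R, Rabs_pos_eq; lra. Qed.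

Ltac half_side x y :=
  match goal with |- context [Cmod (?u - ?v)] =>
    replace (u - v)%C with ((x - y) / 2)%C by (unfold mid; field; apply RtoC_2_neq)
  end; rewrite Cmod_half.

Lemma perimeter_quarter i T : perimeter (quarter i T) = perimeter T / 2.
Proof.
  destruct T as [[a b] c].
  assert (E1 : Cmod (mid a b - a) = Cmod (b - a) / 2) by (half_side b a; auto).
  assert (E2 : Cmod (b - mid a b) = Cmod (b - a) / 2) by (half_side b a; auto).
  assert (E3 : Cmod (mid b c - b) = Cmod (c - b) / 2) by (half_side c b; auto).
  assert (E4 : Cmod (c - mid b c) = Cmod (c - b) / 2) by (half_side c b; auto).
  assert (E5 : Cmod (mid c a - c) = Cmod (a - c) / 2) by (half_side a c; auto).
  assert (E6 : Cmod (a - mid c a) = Cmod (a - c) / 2) by (half_side a c; auto).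
  assert (E7 : Cmod (mid c a - mid a b) = Cmod (c - b) / 2) by (half_side c b; auto).
  assert (E8 : Cmod (mid b c - mid c a) = Cmod (b - a) / 2) by (half_side b a; auto).
  assert (E9 : Cmod (mid a b - mid b c) = Cmod (a - c) / 2) by (half_side a c; auto).
  assert (E10 : Cmod (mid b c - mid a b) = Cmod (a - c) / 2)
    by (rewrite Cmod_sub_sym; exact E9).
  assert (E11 : Cmod (mid c a - mid b c) = Cmod (b - a) / 2)
    by (rewrite Cmod_sub_sym; exact E8).
  assert (E12 : Cmod (mid a b - mid c a) = Cmod (c - b) / 2)
    by (rewrite Cmod_sub_sym; exact E7).
  destruct i as [|[|[|i]]]; cbn [quarter perimeter base]; lra.
Qed.

(** The domain is any closed convex set, with convexity and closedness in the form
    in which they are used; strips and discs are the instances needed. *)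
Section Goursat.

Context (f : C -> C) (dom : C -> Prop).
Hypothesis dom_pt : forall p q t, 0 <= t <= 1 -> dom p -> dom q -> dom (pt p q t).
Hypothesis dom_closed : forall p,
  (forall eps, 0 < eps -> exists q, dom q /\ Cmod (q - p) < eps) -> dom p.
Hypothesis f_diff : forall w, dom w -> exists l, cderive f w l.

Lemma dom_mid p q : dom p -> dom q -> dom (mid p q).
Proof.
  intros Hp Hq. replace (mid p q) with (pt p q (/ 2)).
  - apply dom_pt; auto; lra.
  - unfold pt, mid. rewrite RtoC_inv by lra. field; apply RtoC_2_neq.
Qed.

Lemma convex_seg_cont p q : dom p -> dom q -> seg_cont f p q.
Proof.
  intros Hp Hq t Ht. destruct (f_diff (pt p q t)) as [l Hl].
  - apply dom_pt; auto.
  - eapply cderive_ccont; eauto.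
Qed.

Lemma quarter_in i T : vertices_in dom T -> vertices_in dom (quarter i T).
Proof.
  destruct T as [[a b] c]. intros (Ha & Hb & Hc).
  destruct i as [|[|[|i]]]; cbn [quarter vertices_in];
    refine (conj _ (conj _ _)); auto; apply dom_mid; auto.
Qed.

Lemma boundary_quarters T : vertices_in dom T ->
  boundary f T = (boundary f (quarter 0 T) + boundary f (quarter 1 T)
    + boundary f (quarter 2 T) + boundary f (quarter 3 T))%C.
Proof.
  destruct T as [[a b] c]. intros (Ha & Hb & Hc). simpl.
  assert (Hab : dom (mid a b)) by (apply dom_mid; auto).
  assert (Hbc : dom (mid b c)) by (apply dom_mid; auto).
  assert (Hca : dom (mid c a)) by (apply dom_mid; auto).
  rewrite (seg_mid f a b), (seg_mid f b c), (seg_mid f c a) by (apply convex_seg_cont; auto).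
  rewrite (seg_rev f (mid a b) (mid b c)), (seg_rev f (mid b c) (mid c a)),
    (seg_rev f (mid c a) (mid a b)) by (apply convex_seg_cont; auto).
  ring.
Qed.

Lemma exists_big_quarter T : vertices_in dom T ->
  exists i, Cmod (boundary f T) / 4 <= Cmod (boundary f (quarter i T)).
Proof.
  intros HT. apply NNPP. intros N.
  assert (H : forall i, Cmod (boundary f (quarter i T)) < Cmod (boundary f T) / 4).
  { intros i. apply Rnot_le_lt. intros H. apply N. exists i; auto. }
  pose proof (boundary_quarters T HT) as E.
  pose proof (H 0%nat). pose proof (H 1%nat). pose proof (H 2%nat). pose proof (H 3%nat).
  assert (Cmod (boundary f T) <= Cmod (boundary f (quarter 0 T)) + Cmod (boundary f (quarter 1 T))
    + Cmod (boundary f (quarter 2 T)) + Cmod (boundary f (quarter 3 T))).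
  { rewrite E at 1. eapply Rle_trans; [apply Cmod_triangle|].
    apply Rplus_le_compat_r. eapply Rle_trans; [apply Cmod_triangle|].
    apply Rplus_le_compat_r. apply Cmod_triangle. }
  lra.
Qed.

Definition big_quarter (T : triangle) : triangle :=
  quarter (epsilon (inhabits O)
    (fun i => Cmod (boundary f T) / 4 <= Cmod (boundary f (quarter i T)))) T.

Lemma big_quarter_spec T : vertices_in dom T ->
  Cmod (boundary f T) / 4 <= Cmod (boundary f (big_quarter T)).
Proof. intros HT. unfold big_quarter. apply epsilon_spec. apply exists_big_quarter; auto. Qed.

Lemma base_quarter i T : Cmod (base (quarter i T) - base T) <= perimeter T.
Proof.
  destruct T as [[a b] c].
  pose proof (Cmod_ge_0 (b - a)). pose proof (Cmod_ge_0 (c - b)).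
  pose proof (Cmod_ge_0 (a - c)).
  assert (Cmod (a - a) = 0) by (replace (a - a)%C with (RtoC 0) by ring; apply Cmod_0).
  assert (Cmod (mid a b - a) = Cmod (b - a) / 2) by (half_side b a; auto).
  assert (Cmod (mid c a - a) = Cmod (c - a) / 2) by (half_side c a; auto).
  pose proof (Cmod_sub_sym c a).
  destruct i as [|[|[|i]]]; cbn [quarter perimeter base]; lra.
Qed.

Lemma affine_boundary (A B p : C) T :
  boundary (fun w => A + B * (w - p))%C T = 0%C.
Proof.
  destruct T as [[a b] c]. unfold boundary.
  assert (Hs : forall x y, seg (fun w => A + B * (w - p))%C x y
     = ((A * y + B / 2 * ((y - p) * (y - p))) - (A * x + B / 2 * ((x - p) * (x - p))))%C).
  { intros x y.
    apply (seg_primitive (fun w => A * w + B / 2 * ((w - p) * (w - p)))%C).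
    - intros t _. set (w := pt x y t).
      apply (cderive_eq _ _ ((0 * w + A * 1) +
        (0 * ((w - p) * (w - p)) + B / 2 * ((1 - 0) * (w - p) + (w - p) * (1 - 0))))%C).
      + field; apply RtoC_2_neq.
      + apply cderive_plus.
        * apply (cderive_mult (fun _ => A) (fun w => w));
            [apply cderive_const|apply cderive_id].
        * apply (cderive_mult (fun _ => B / 2)%C (fun w => (w - p) * (w - p))%C);
            [apply cderive_const|].
          apply (cderive_mult (fun w => w - p)%C (fun w => w - p)%C);
          apply (cderive_minus (fun w => w) (fun _ => p));
          (apply cderive_const || apply cderive_id).
    - intros t _. apply ccont_plus; [apply ccont_const|].
      apply ccont_mult; [apply ccont_const|].
      apply ccont_plus; [apply ccont_id|apply ccont_const]. }
  rewrite !Hs. ring.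
Qed.

Lemma boundary_minus g T :
  vertices_in dom T -> (forall w, ccont g w) ->
  boundary (fun w => f w - g w)%C T = (boundary f T - boundary g T)%C.
Proof.
  destruct T as [[a b] c]. intros (Ha & Hb & Hc) Hg. simpl.
  rewrite !seg_minus; try (apply convex_seg_cont; auto); try (intros t _; apply Hg).
  ring.
Qed.

Lemma pt_dist p q t : 0 <= t <= 1 -> Cmod (pt p q t - p) <= Cmod (q - p).
Proof.
  intros Ht. replace (pt p q t - p)%C with (t * (q - p))%C by (unfold pt; ring).
  rewrite Cmod_mult, Cmod_R, Rabs_pos_eq by lra.
  pose proof (Cmod_ge_0 (q - p)). nra.
Qed.

(** Bisection: a quarter carrying at least a fourth of the boundary integral is
    chosen again and again, and the triangles shrink to a point [p].  There [f] is
    affine up to an error small compared with the size [h] of the triangle; affine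
    functions integrate to 0, so the integral is [o(h^2)], whereas it is at least
    the original one divided by [4 ^ n], of order [h ^ 2]. *)
Theorem goursat T : vertices_in dom T -> boundary f T = 0%C.
Proof.
  intros HT.
  set (Tn := fix Tn n := match n with O => T | S n => big_quarter (Tn n) end).
  assert (HIn : forall n, vertices_in dom (Tn n)).
  { induction n; simpl; auto. unfold big_quarter. apply quarter_in; auto. }
  set (P := perimeter T).
  assert (HP : forall n, perimeter (Tn n) = P / 2 ^ n).
  { induction n; simpl; [unfold P; field|]. unfold big_quarter.
    rewrite perimeter_quarter, IHn. field. apply pow_nonzero; lra. }
  assert (HB : forall n, Cmod (boundary f T) <= 4 ^ n * Cmod (boundary f (Tn n))).
  { induction n; simpl; [lra|].
    pose proof (big_quarter_spec (Tn n) (HIn n)).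
    assert (0 < 4 ^ n) by (apply pow_lt; lra). nra. }
  destruct (geometric_cauchy_C (fun n => base (Tn n)) P) as [p Hp].
  { intros n. rewrite <- HP. apply base_quarter. }
  assert (Hps : dom p).
  { apply dom_closed. intros eps He.
    destruct (exists_pow2_lt (4 * P) eps He) as [n Hn].
    exists (base (Tn n)). split; [|eapply Rle_lt_trans; [apply Hp|exact Hn]].
    specialize (HIn n). destruct (Tn n) as [[a b] c]. apply HIn. }
  destruct (f_diff p Hps) as [l Hl].
  pose proof (proj1 (cderive_eps f p l) Hl) as Hl'.
  assert (HP0 : 0 <= P).
  { unfold P. destruct T as [[a b] c]. simpl.
    pose proof (Cmod_ge_0 (b - a)). pose proof (Cmod_ge_0 (c - b)).
    pose proof (Cmod_ge_0 (a - c)). lra. }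
  apply Cmod_eq_0. apply Rle_antisym; [|apply Cmod_ge_0].
  apply le_epsilon. intros eps Heps.
  assert (Hq : 0 < eps / (6 * P * P + 1)) by (apply Rdiv_lt_0_compat; nra).
  destruct (Hl' _ Hq) as [d [Hd Hdd]].
  destruct (exists_pow2_lt (6 * P) d Hd) as [n Hn].
  set (e := eps / (6 * P * P + 1)) in *.
  set (h := P / 2 ^ n).
  assert (P2 : 0 < 2 ^ n) by (apply pow_lt; lra).
  assert (Hh : 0 <= h) by (apply Rdiv_le_0_compat; auto).
  assert (H6h : 6 * P / 2 ^ n = 6 * h) by (unfold h; field; lra).
  assert (H4h : 4 * P / 2 ^ n = 4 * h) by (unfold h; field; lra).
  rewrite H6h in Hn. specialize (Hp n). simpl in Hp. rewrite H4h in Hp.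
  set (g := fun w => (f p + l * (w - p))%C).
  assert (Hg : forall w, ccont g w).
  { intros w. apply ccont_plus; [apply ccont_const|].
    apply ccont_mult; [apply ccont_const|].
    apply ccont_plus; [apply ccont_id|apply ccont_const]. }
  (* boundary points are within [2 h] of the base, and the base within [4 h] of [p] *)
  assert (Hsmall : forall w, Cmod (w - base (Tn n)) <= 2 * h -> Cmod (f w - g w) <= e * (6 * h)).
  { intros w Hw.
    pose proof (Cmod_sub_tri w (base (Tn n)) p) as Ht.
    replace (f w - g w)%C with (f w - f p - l * (w - p))%C by (unfold g; ring).
    eapply Rle_trans; [apply Hdd; lra|].
    apply Rmult_le_compat_l; lra. }
  assert (Hbd : Cmod (boundary f (Tn n)) <= e * (6 * h) * h).
  { replace (boundary f (Tn n)) with (boundary (fun w => f w - g w)%C (Tn n)).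
    2:{ rewrite boundary_minus by auto. unfold g. rewrite affine_boundary. ring. }
    specialize (HIn n). specialize (HP n).
    fold h in HP.
    destruct (Tn n) as [[a b] c]. simpl in *. destruct HIn as (Ha & Hb & Hc).
    pose proof (Cmod_ge_0 (b - a)). pose proof (Cmod_ge_0 (c - b)).
    pose proof (Cmod_ge_0 (a - c)).
    assert (Hsc : forall x y, dom x -> dom y -> seg_cont (fun w => f w - g w)%C x y).
    { intros x y Hx Hy t Ht. apply ccont_plus; [apply (convex_seg_cont x y); auto|].
      apply (ccont_ext_loc (fun w => (RtoC (-1)) * g w)%C _ _ 1); [lra| |].
      - intros w _. replace (RtoC (-1)) with (- RtoC 1)%C by (rewrite <- RtoC_opp; f_equal; ring).
        ring.
      - apply ccont_mult; [apply ccont_const|apply Hg]. }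
    assert (B1 := seg_bound (fun w => f w - g w)%C a b (e * (6 * h)) (Hsc _ _ Ha Hb)).
    assert (B2 := seg_bound (fun w => f w - g w)%C b c (e * (6 * h)) (Hsc _ _ Hb Hc)).
    assert (B3 := seg_bound (fun w => f w - g w)%C c a (e * (6 * h)) (Hsc _ _ Hc Ha)).
    replace (e * (6 * h) * h)
      with (e * (6 * h) * (Cmod (b - a) + Cmod (c - b) + Cmod (a - c)))
      by (rewrite HP; reflexivity).
    eapply Rle_trans; [apply Cmod_triangle|].
    eapply Rle_trans; [apply Rplus_le_compat_r, Cmod_triangle|].
    rewrite !Rmult_plus_distr_l.
    apply Rplus_le_compat; [apply Rplus_le_compat|].
    - apply B1. intros t Ht. apply Hsmall. pose proof (pt_dist a b t Ht). lra.
    - apply B2. intros t Ht. apply Hsmall. pose proof (pt_dist b c t Ht).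
      pose proof (Cmod_sub_tri (pt b c t) b a). lra.
    - apply B3. intros t Ht. apply Hsmall. pose proof (pt_dist c a t Ht).
      pose proof (Cmod_sub_tri (pt c a t) c a). rewrite (Cmod_sub_sym c a) in H3. lra. }
  specialize (HB n). rewrite Rplus_0_l.
  assert (E4 : 4 ^ n = 2 ^ n * 2 ^ n) by (rewrite <- Rpow_mult_distr; f_equal; ring).
  assert (Eh : h * 2 ^ n = P) by (unfold h; field; lra).
  assert (P4 : 0 < 4 ^ n) by (apply pow_lt; lra).
  apply Rle_trans with (4 ^ n * (e * (6 * h) * h)).
  - eapply Rle_trans; [exact HB|]. apply Rmult_le_compat_l; lra.
  - replace (4 ^ n * (e * (6 * h) * h)) with (e * (6 * (h * 2 ^ n) * (h * 2 ^ n)))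
      by (rewrite E4; ring).
    rewrite Eh. apply Rle_trans with (e * (6 * P * P + 1)); [|right; unfold e; field; nra].
    apply Rmult_le_compat_l; lra.
Qed.

End Goursat.

(** * The exponential and circular means *)

Lemma C_ext (z w : C) : Re z = Re w -> Im z = Im w -> z = w.
Proof. destruct z, w; simpl; intros -> ->; auto. Qed.

Definition Cexp (z : C) : C := (exp (Re z) * cos (Im z), exp (Re z) * sin (Im z)).

Lemma Cexp_plus z w : Cexp (z + w) = (Cexp z * Cexp w)%C.
Proof.
  apply C_ext; unfold Cexp, Re, Im; simpl; rewrite exp_plus, ?cos_plus, ?sin_plus; ring.
Qed.

Lemma Cexp_0 : Cexp 0 = 1%C.
Proof. apply C_ext; unfold Cexp, Re, Im; simpl; rewrite exp_0, ?cos_0, ?sin_0; ring. Qed.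

Lemma Cmod_Cexp z : Cmod (Cexp z) = exp (Re z).
Proof.
  unfold Cmod, Cexp. simpl fst; simpl snd.
  replace ((exp (Re z) * cos (Im z)) ^ 2 + (exp (Re z) * sin (Im z)) ^ 2)
    with (exp (Re z) ^ 2 * (Rsqr (sin (Im z)) + Rsqr (cos (Im z)))) by (unfold Rsqr; ring).
  rewrite sin2_cos2, Rmult_1_r. apply sqrt_pow2. left; apply exp_pos.
Qed.

Lemma Cexp_neq_0 z : Cexp z <> 0%C.
Proof. apply Cmod_gt_0. rewrite Cmod_Cexp. apply exp_pos. Qed.

Lemma Cexp_opp z : Cexp (- z) = (/ Cexp z)%C.
Proof.
  assert (H : (Cexp z * Cexp (- z) = 1)%C).
  { rewrite <- Cexp_plus. replace (z + - z)%C with (RtoC 0) by ring. apply Cexp_0. }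
  pose proof (Cexp_neq_0 z).
  replace (/ Cexp z)%C with (/ Cexp z * (Cexp z * Cexp (- z)))%C
    by (rewrite H; ring). field; auto.
Qed.

Lemma deriv_eps_R (f : R -> R) (l : R) :
  derivable_pt_lim f 0 l ->
  forall eps, 0 < eps -> exists d, 0 < d /\
    forall h, Rabs h < d -> Rabs (f h - f 0 - l * h) <= eps * Rabs h.
Proof.
  intros H eps He. destruct (H eps He) as [d Hd]. exists d. split; [apply cond_pos|].
  intros h Hh. destruct (Req_dec h 0) as [->|N].
  - rewrite Rmult_0_r, Rabs_R0, Rmult_0_r.
    replace (f 0 - f 0 - 0) with 0 by ring. rewrite Rabs_R0; lra.
  - specialize (Hd h N Hh). rewrite Rplus_0_l in Hd.
    replace (f h - f 0 - l * h) with (((f h - f 0) / h - l) * h) by (field; auto).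
    rewrite Rabs_mult. apply Rmult_le_compat_r; [apply Rabs_pos|lra].
Qed.

(** The functional equation carries this over to every other point. *)
Lemma cderive_Cexp_0 : cderive Cexp 0 1.
Proof.
  apply cderive_eps. intros eps He. set (e := Rmin 1 (eps / 10)).
  assert (He0 : 0 < e) by (apply Rmin_pos; lra).
  assert (He1 : e <= 1) by apply Rmin_l. assert (He2 : e <= eps / 10) by apply Rmin_r.
  assert (D1 : derivable_pt_lim exp 0 1)
    by (pose proof (derivable_pt_lim_exp 0) as E; rewrite exp_0 in E; exact E).
  destruct (deriv_eps_R exp 1 D1 e He0) as [d1 [Hd1 H1]].
  destruct (deriv_eps_R cos (- sin 0) (derivable_pt_lim_cos 0) e He0) as [d2 [Hd2 H2]].
  destruct (deriv_eps_R sin (cos 0) (derivable_pt_lim_sin 0) e He0) as [d3 [Hd3 H3]].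
  exists (Rmin (Rmin d1 e) (Rmin d2 d3)). split.
  { apply Rmin_pos; apply Rmin_pos; auto. }
  intros w Hw. 
  assert (E0 : (w - 0)%C = w) by ring. rewrite E0 in *.
  pose proof (re_le_Cmod w) as Hx. pose proof (im_le_Cmod w) as Hy.
  apply Rmin_Rgt_l in Hw. destruct Hw as [Wa Wb].
  apply Rmin_Rgt_l in Wa. apply Rmin_Rgt_l in Wb. destruct Wa as [W1 W2], Wb as [W3 W4].
  set (m := Cmod w) in *.
  specialize (H1 (Re w) ltac:(lra)). specialize (H2 (Im w) ltac:(lra)).
  specialize (H3 (Im w) ltac:(lra)).
  rewrite exp_0 in H1. rewrite cos_0, sin_0 in *.
  set (x := Re w) in *. set (y := Im w) in *.
  pose proof (Rabs_pos x). pose proof (Rabs_pos y).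
  assert (B1 : Rabs (exp x - 1 - x) <= e * m).
  { replace (exp x - 1 - x) with (exp x - 1 - 1 * x) by ring. nra. }
  assert (B2 : Rabs (cos y - 1) <= e * m).
  { replace (cos y - 1) with (cos y - 1 - - 0 * y) by ring. nra. }
  assert (B3 : Rabs (sin y - y) <= e * m).
  { replace (sin y - y) with (sin y - 0 - 1 * y) by ring. nra. }
  assert (B4 : Rabs (exp x - 1) <= 2 * m).
  { replace (exp x - 1) with ((exp x - 1 - x) + x) by ring.
    eapply Rle_trans; [apply Rabs_triang|]. nra. }
  assert (B5 : Rabs (exp x) <= 3).
  { replace (exp x) with ((exp x - 1) + 1) by ring.
    eapply Rle_trans; [apply Rabs_triang|]. rewrite Rabs_R1. lra. }
  assert (Hm : 0 <= m) by apply Cmod_ge_0.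
  eapply Rle_trans; [apply Cmod_le_Re_Im|].
  replace (Re (Cexp w - Cexp 0 - 1 * w)) with ((exp x - 1 - x) + exp x * (cos y - 1)).
  2:{ rewrite Cexp_0. unfold Cexp, x, y, Re, Im. simpl. ring. }
  replace (Im (Cexp w - Cexp 0 - 1 * w)) with (exp x * (sin y - y) + (exp x - 1) * y).
  2:{ rewrite Cexp_0. unfold Cexp, x, y, Re, Im. simpl. ring. }
  eapply Rle_trans; [apply Rplus_le_compat; apply Rabs_triang|].
  rewrite !Rabs_mult.
  assert (Rabs (exp x) * Rabs (cos y - 1) <= 3 * (e * m))
    by (apply Rmult_le_compat; auto; apply Rabs_pos).
  assert (Rabs (exp x) * Rabs (sin y - y) <= 3 * (e * m))
    by (apply Rmult_le_compat; auto; apply Rabs_pos).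
  assert (Rabs (exp x - 1) * Rabs y <= (2 * m) * e)
    by (apply Rmult_le_compat; auto; try apply Rabs_pos; lra).
  assert (e * m <= eps / 10 * m) by (apply Rmult_le_compat_r; auto).
  nra.
Qed.

Lemma cderive_Cexp z : cderive Cexp z (Cexp z).
Proof.
  apply (cderive_ext (fun w => Cexp z * Cexp (w - z))%C).
  { intros w. rewrite <- Cexp_plus. f_equal. ring. }
  apply (cderive_eq _ _ (0 * Cexp (z - z) + Cexp z * (1 * (1 - 0)))%C); [ring|].
  apply (cderive_mult (fun _ => Cexp z) (fun w => Cexp (w - z))); [apply cderive_const|].
  apply (cderive_comp Cexp (fun w => w - z)%C).
  - replace (z - z)%C with (RtoC 0) by ring. apply cderive_Cexp_0.
  - apply cderive_minus; [apply cderive_id|apply cderive_const].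
Qed.

Lemma exp_le x y : x <= y -> exp x <= exp y.
Proof. intros [H| ->]; [left; apply exp_increasing; auto|right; auto]. Qed.

Definition circ (r t : R) : C := (r * cos (2 * PI * t), r * sin (2 * PI * t)).

Lemma Cmod_circ r t : 0 <= r -> Cmod (circ r t) = r.
Proof.
  intros Hr. unfold Cmod, circ. simpl fst; simpl snd.
  set (a := 2 * PI * t).
  replace ((r * cos a) ^ 2 + (r * sin a) ^ 2) with (r ^ 2 * (Rsqr (sin a) + Rsqr (cos a)))
    by (unfold Rsqr; ring).
  rewrite sin2_cos2, Rmult_1_r. apply sqrt_pow2; auto.
Qed.

Lemma circ_0 t : circ 0 t = 0%C.
Proof. unfold circ, RtoC. f_equal; ring. Qed.

Lemma Cexp_circ (s t : R) : Cexp (pt s (s + 2 * PI * Ci)%C t) = circ (exp s) t.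
Proof.
  unfold Cexp, circ, pt, Re, Im. simpl. f_equal; f_equal; f_equal; ring.
Qed.

Definition cmean (f : C -> C) (r : R) : C := Cint (fun t => f (circ r t)).

(** Pulled back along [Cexp], the annulus becomes a strip and the two circles its
    vertical sides; the horizontal sides of a rectangle of height [2 PI] cancel by
    periodicity, so Goursat's theorem makes the integrals over the vertical sides
    equal. *)
Lemma cmean_annulus (f : C -> C) (r1 r2 : R) :
  0 < r1 -> r1 <= r2 ->
  (forall z, r1 <= Cmod z <= r2 -> exists l, cderive f z l) ->
  cmean f r1 = cmean f r2.
Proof.
  intros H1 H12 Hf.
  set (s1 := ln r1). set (s2 := ln r2).
  assert (E1 : exp s1 = r1) by (apply exp_ln; lra).
  assert (E2 : exp s2 = r2) by (apply exp_ln; lra).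
  assert (Hs : s1 <= s2) by (apply ln_le; auto).
  set (H := fun w => f (Cexp w)).
  assert (HH : forall w, in_strip s1 s2 w -> exists l, cderive H w l).
  { intros w [W1 W2]. destruct (Hf (Cexp w)) as [l Hl].
    - rewrite Cmod_Cexp. rewrite <- E1, <- E2.
      split; apply exp_le; auto.
    - exists (l * Cexp w)%C. apply (cderive_comp f Cexp); auto. apply cderive_Cexp. }
  set (T := (2 * PI * Ci)%C).
  set (A := RtoC s1). set (B := RtoC s2).
  assert (IA : in_strip s1 s2 A) by (unfold in_strip, A; simpl; lra).
  assert (IB : in_strip s1 s2 B) by (unfold in_strip, B; simpl; lra).
  assert (IC : in_strip s1 s2 (B + T)%C) by (unfold in_strip, B, T; simpl; lra).
  assert (ID : in_strip s1 s2 (A + T)%C) by (unfold in_strip, A, T; simpl; lra).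
  pose proof (goursat H _ (in_strip_pt s1 s2) (in_strip_closed s1 s2) HH (A, B, (B + T)%C) (conj IA (conj IB IC))) as G1.
  pose proof (goursat H _ (in_strip_pt s1 s2) (in_strip_closed s1 s2) HH (A, (B + T)%C, (A + T)%C) (conj IA (conj IC ID))) as G2.
  simpl in G1, G2.
  assert (Hc : forall p q, in_strip s1 s2 p -> in_strip s1 s2 q -> seg_cont H p q)
    by (apply (convex_seg_cont H _ (in_strip_pt s1 s2) HH)).
  assert (V : forall s : R, seg H s (s + T)%C = (T * cmean f (exp s))%C).
  { intros s. unfold seg. f_equal; [ring|].
    unfold cmean, H. apply Cint_ext. intros t _. unfold T. rewrite Cexp_circ. reflexivity. }
  assert (Per : seg H (A + T)%C (B + T)%C = seg H A B).
  { unfold seg. f_equal; [ring|]. apply Cint_ext. intros t _. unfold H. f_equal.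
    replace (pt (A + T) (B + T) t) with (pt A B t + T)%C by (unfold pt; ring).
    rewrite Cexp_plus. replace (Cexp T) with (RtoC 1); [ring|].
    apply C_ext; unfold T, Cexp, Re, Im; simpl;
      replace ((2 * PI - 0 * 0) * 0 - (2 * 0 + 0 * PI) * 1) with 0 by ring;
      replace ((2 * PI - 0 * 0) * 1 + (2 * 0 + 0 * PI) * 0) with (2 * PI) by ring;
      rewrite exp_0, ?cos_2PI, ?sin_2PI; ring. }
  rewrite (seg_rev H A (B + T)%C) in G1 by auto.
  rewrite (seg_rev H (A + T)%C (B + T)%C), Per in G2 by auto.
  rewrite (seg_rev H A (A + T)%C) in G2 by auto.
  unfold A, B in *. rewrite !V in *. rewrite E1, E2 in *.
  assert (G : (T * (cmean f r2 - cmean f r1) = 0)%C).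
  { transitivity ((seg H s1 s2 + T * cmean f r2 + - seg H s1 (s2 + T)%C)
      + (seg H s1 (s2 + T)%C + - seg H s1 s2 + - (T * cmean f r1)))%C; [ring|].
    rewrite G1, G2; ring. }
  assert (HT : T <> 0%C).
  { unfold T. apply Cmult_neq_0; [apply Cmult_neq_0|apply Ci_nz].
    - apply RtoC_2_neq.
    - intros E. apply RtoC_inj in E. pose proof PI_RGT_0. lra. }
  symmetry. apply Ceq_minus.
  replace (cmean f r2 - cmean f r1)%C with (/ T * (T * (cmean f r2 - cmean f r1)))%C
    by (field; auto).
  rewrite G; ring.
Qed.

Lemma circ_lipschitz r s t t0 :
  0 <= s -> Cmod (circ r t - circ s t0) <= 2 * Rabs (r - s) + s * (4 * PI * Rabs (t - t0)).
Proof.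
  intros Hs. pose proof PI_RGT_0 as HP.
  assert (Hc : forall g g' : R -> R, (forall x, derivable_pt_lim g x (g' x)) ->
     (forall x, Rabs (g' x) <= 1) -> (forall x, Rabs (g x) <= 1) ->
     Rabs (r * g (2 * PI * t) - s * g (2 * PI * t0)) <= Rabs (r - s) + s * (2 * PI * Rabs (t - t0))).
  { intros g g' Hg Hg' Hb.
    destruct (MVT_abs g g' (2 * PI * t0) (2 * PI * t)) as [c [Hc _]]; [intros; apply Hg|].
    replace (2 * PI * t - 2 * PI * t0) with (2 * PI * (t - t0)) in Hc by ring.
    rewrite Rabs_mult, (Rabs_pos_eq (2 * PI)) in Hc by lra.
    replace (r * g (2 * PI * t) - s * g (2 * PI * t0)) with
      ((r - s) * g (2 * PI * t) + s * (g (2 * PI * t) - g (2 * PI * t0))) by ring.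
    eapply Rle_trans; [apply Rabs_triang|]. rewrite !Rabs_mult, (Rabs_pos_eq s) by auto.
    specialize (Hb (2 * PI * t)). specialize (Hg' c).
    pose proof (Rabs_pos (r - s)). pose proof (Rabs_pos (t - t0)).
    apply Rplus_le_compat.
    - nra.
    - apply Rmult_le_compat_l; auto. rewrite Hc.
      assert (0 <= 2 * PI * Rabs (t - t0)) by nra. nra. }
  assert (C1 : Rabs (r * cos (2 * PI * t) - s * cos (2 * PI * t0))
     <= Rabs (r - s) + s * (2 * PI * Rabs (t - t0))).
  { apply (Hc cos (fun x => - sin x)).
    - apply derivable_pt_lim_cos.
    - intros x. rewrite Rabs_Ropp. apply Rabs_le, SIN_bound.
    - intros x. apply Rabs_le, COS_bound. }
  assert (C2 : Rabs (r * sin (2 * PI * t) - s * sin (2 * PI * t0))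
     <= Rabs (r - s) + s * (2 * PI * Rabs (t - t0))).
  { apply (Hc sin cos).
    - apply derivable_pt_lim_sin.
    - intros x. apply Rabs_le, COS_bound.
    - intros x. apply Rabs_le, SIN_bound. }
  eapply Rle_trans; [apply Cmod_le_Re_Im|].
  change (Rabs (r * cos (2 * PI * t) - s * cos (2 * PI * t0)) +
    Rabs (r * sin (2 * PI * t) - s * sin (2 * PI * t0)) <=
    2 * Rabs (r - s) + s * (4 * PI * Rabs (t - t0))).
  lra.
Qed.

Lemma circ_integrable (f : C -> C) r :
  0 <= r -> (forall z, Cmod z = r -> ccont f z) -> Cintegrable (fun t => f (circ r t)).
Proof.
  intros Hr Hf. apply Cintegrable_continuous. intros t _.
  apply filterlim_locally. intros eps.
  destruct (Hf (circ r t) (Cmod_circ r t Hr) eps (cond_pos eps)) as [d [Hd0 Hd]].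
  pose proof PI_RGT_0 as HP.
  assert (Hd1 : 0 < d / (4 * r * PI + 1)) by (apply Rdiv_lt_0_compat; nra).
  exists (mkposreal _ Hd1). intros s Hs. change (Rabs (s - t) < d / (4 * r * PI + 1)) in Hs.
  apply C_NormedModule_mixin_compat1. apply Hd.
  eapply Rle_lt_trans; [apply circ_lipschitz; auto|].
  replace (r - r) with 0 by ring. rewrite Rabs_R0.
  apply Rlt_div_r in Hs; [|nra]. pose proof (Rabs_pos (s - t)). nra.
Qed.

Lemma cmean_correct (f : C -> C) r :
  0 <= r -> (forall z, Cmod z = r -> ccont f z) ->
  is_Cint (fun t => f (circ r t)) (cmean f r).
Proof. intros; apply Cint_correct, circ_integrable; auto. Qed.

Lemma cmean_0 (f : C -> C) : cmean f 0 = f 0%C.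
Proof.
  unfold cmean. apply is_Cint_unique.
  apply (is_Cint_ext (fun _ => f 0%C)); [intros; rewrite circ_0; auto|apply is_Cint_const].
Qed.

(** The path of integration moves by a small amount uniformly in the parameter, so
    this is uniform continuity of [f] near the compact circle of radius [s]. *)
Lemma cmean_continuous (f : C -> C) (R0 s : R) :
  0 <= s < R0 -> (forall z, Cmod z < R0 -> ccont f z) ->
  forall eps, 0 < eps -> exists d, 0 < d /\
    forall r, 0 <= r < R0 -> Rabs (r - s) < d -> Cmod (cmean f r - cmean f s) <= eps.
Proof.
  intros Hs Hf eps He. pose proof PI_RGT_0 as HP.
  assert (Hsel : forall t, exists d : posreal,
    forall t' r, Rabs (t' - t) < d -> Rabs (r - s) < d ->
      Cmod (f (circ r t') - f (circ s t)) < eps / 2).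
  { intros t. destruct (Hf (circ s t)) with (eps / 2) as [d [Hd0 Hd]]; [|lra|].
    - rewrite Cmod_circ; lra.
    - assert (Hd1 : 0 < d / (4 * s * PI + 2)) by (apply Rdiv_lt_0_compat; nra).
      exists (mkposreal _ Hd1). simpl. intros t' r Ht' Hr. apply Hd.
      eapply Rle_lt_trans; [apply circ_lipschitz; lra|].
      apply Rlt_div_r in Ht'; [|nra]. apply Rlt_div_r in Hr; [|nra].
      set (u := Rabs (t' - t)) in *. set (v := Rabs (r - s)) in *.
      assert (Hu : 0 <= u) by apply Rabs_pos. assert (Hv : 0 <= v) by apply Rabs_pos.
      set (k := 4 * s * PI) in *. assert (Hk : 0 <= k) by (unfold k; nra).
      replace (s * (4 * PI * u)) with (k * u) by (unfold k; ring).
      destruct (Rle_dec u v); nra. }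
  apply choice in Hsel. destruct Hsel as [delta Hdel].
  destruct (compactness_value_1d 0 1 delta) as [d Hd].
  exists d. split; [apply cond_pos|]. intros r Hr Hrs.
  assert (Ir : is_Cint (fun t => f (circ r t)) (cmean f r)).
  { apply cmean_correct; [lra|]. intros z Hz. apply Hf. lra. }
  assert (Is : is_Cint (fun t => f (circ s t)) (cmean f s)).
  { apply cmean_correct; [lra|]. intros z Hz. apply Hf. lra. }
  pose proof (is_Cint_minus _ _ _ _ Ir Is) as Id.
  apply (is_Cint_bound _ _ eps) in Id; auto.
  intros t Ht. apply Rnot_lt_le. intros Hlt. apply (Hd t Ht).
  intros [t0 [Ht0 [Htt Hdd]]].
  pose proof (Hdel t0 t r Htt ltac:(lra)) as B1.
  pose proof (Hdel t0 t s Htt) as B2.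
  replace (s - s) with 0 in B2 by ring. rewrite Rabs_R0 in B2.
  specialize (B2 (cond_pos _)).
  pose proof (Cmod_sub_tri (f (circ r t)) (f (circ s t0)) (f (circ s t))) as B3.
  rewrite (Cmod_sub_sym (f (circ s t0))) in B3. lra.
Qed.

(** The circular mean is constant in the radius on each side of the exceptional
    radius [Cmod z0] and continuous everywhere, hence constant up to radius 0.  The
    exceptional point is what gives Cauchy's formula below. *)
Lemma mean_value (f : C -> C) (R0 : R) (z0 : C) :
  (forall z, Cmod z < R0 -> ccont f z) ->
  (forall z, Cmod z < R0 -> z <> z0 -> exists l, cderive f z l) ->
  forall r, 0 <= r < R0 -> cmean f r = f 0%C.
Proof.
  intros Hc Hd.
  set (s := Cmod z0). assert (Hs0 : 0 <= s) by apply Cmod_ge_0.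
  assert (Hann : forall r1 r2, 0 < r1 -> r1 <= r2 -> r2 < R0 ->
     (r2 < s \/ s < r1) -> cmean f r1 = cmean f r2).
  { intros r1 r2 H1 H2 H3 H4. apply cmean_annulus; auto.
    intros z Hz. apply Hd; [lra|]. intros ->. fold s in Hz. lra. }
  (* a value taken at radii arbitrarily close to [x] is taken at [x] *)
  assert (Hlim : forall x c, 0 <= x < R0 ->
     (forall d, 0 < d -> exists r, 0 <= r < R0 /\ Rabs (r - x) < d /\ cmean f r = c) ->
     cmean f x = c).
  { intros x c Hx H. apply Cmod_sub_eq_0. apply Rle_antisym; [|apply Cmod_ge_0].
    apply le_epsilon. intros eps He. rewrite Rplus_0_l.
    destruct (cmean_continuous f R0 x Hx Hc eps He) as [d [Hd0 Hdd]].
    destruct (H d Hd0) as [r [Hr [Hrx <-]]]. rewrite Cmod_sub_sym. auto. }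
  assert (Hin : forall r, 0 < r < s -> r < R0 -> cmean f r = f 0%C).
  { intros r Hr HrR. rewrite <- cmean_0. symmetry. apply Hlim; [lra|].
    intros d Hd0. exists (Rmin r (d / 2)).
    assert (0 < Rmin r (d / 2)) by (apply Rmin_pos; lra).
    pose proof (Rmin_l r (d / 2)). pose proof (Rmin_r r (d / 2)).
    split; [lra|]. split; [rewrite Rminus_0_r, Rabs_pos_eq; lra|].
    apply Hann; lra. }
  assert (Hon : s < R0 -> cmean f s = f 0%C).
  { intros HsR. destruct (Req_dec s 0) as [->|Ns]; [apply cmean_0|].
    apply Hlim; [lra|]. intros d Hd0. exists (Rmax (s / 2) (s - d / 2)).
    assert (Rmax (s / 2) (s - d / 2) < s) by (apply Rmax_lub_lt; lra).
    pose proof (Rmax_l (s / 2) (s - d / 2)). pose proof (Rmax_r (s / 2) (s - d / 2)).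
    split; [lra|]. split; [apply Rabs_lt_between; lra|]. apply Hin; lra. }
  intros r Hr. destruct (Req_dec r 0) as [->|Nr]; [apply cmean_0|].
  destruct (Rtotal_order r s) as [L|[->|G]]; [apply Hin; lra|apply Hon; lra|].
  rewrite <- Hon by lra. symmetry. apply Hlim; [lra|].
  intros d Hd0. exists (Rmin r (s + d / 2)).
  assert (s < Rmin r (s + d / 2)) by (apply Rmin_glb_lt; lra).
  pose proof (Rmin_l r (s + d / 2)). pose proof (Rmin_r r (s + d / 2)).
  split; [lra|]. split; [apply Rabs_lt_between; lra|].
  apply Hann; lra.
Qed.

(** * Cauchy's formula and Taylor expansions *)

(** The radius may be [p_infty], so that statements about discs cover entire
    functions too. *)
Definition hol (f : C -> C) (R0 : Rbar) : Prop :=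
  forall z, Rbar_lt (Cmod z) R0 -> exists l, cderive f z l.

Lemma Rbar_between (x : R) (R0 : Rbar) :
  Rbar_lt x R0 -> exists r, x < r /\ Rbar_lt r R0.
Proof.
  destruct R0 as [y| |]; simpl; intros H; try contradiction.
  - exists ((x + y) / 2). lra.
  - exists (x + 1). split; [lra|auto].
Qed.

Lemma hol_le f (R1 R2 : Rbar) : Rbar_le R1 R2 -> hol f R2 -> hol f R1.
Proof. intros H Hf z Hz. apply Hf. eapply Rbar_lt_le_trans; eauto. Qed.

Lemma hol_ccont f R0 z : hol f R0 -> Rbar_lt (Cmod z) R0 -> ccont f z.
Proof. intros H Hz. destruct (H z Hz) as [l Hl]. eapply cderive_ccont; eauto. Qed.

(** The mean does not depend on the radius, and the kernel tends to 1 as the radius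
    grows. *)
Lemma cmean_kernel (z : C) (r : R) :
  Cmod z < r -> cmean (fun w => w / (w - z))%C r = 1%C.
Proof.
  intros Hz. pose proof (Cmod_ge_0 z) as Pz.
  assert (Hne : forall w, r <= Cmod w -> (w - z)%C <> 0%C).
  { intros w Hw E. apply Ceq_minus in E. subst w. lra. }
  assert (Hdiff : forall w, r <= Cmod w -> exists l, cderive (fun w => w / (w - z))%C w l).
  { intros w Hw. eexists. unfold Cdiv. apply cderive_mult; [apply cderive_id|].
    apply (cderive_comp Cinv (fun w => w - z)%C).
    - apply cderive_inv; auto.
    - apply cderive_minus; [apply cderive_id|apply cderive_const]. }
  apply Cmod_sub_eq_0. apply Rle_antisym; [|apply Cmod_ge_0].
  apply le_epsilon. intros eps He. rewrite Rplus_0_l.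
  set (s := Rmax r (Cmod z + Cmod z / eps)).
  assert (Hs1 : r <= s) by apply Rmax_l.
  assert (Hs2 : Cmod z + Cmod z / eps <= s) by apply Rmax_r.
  rewrite (cmean_annulus _ r s); [|lra|auto|].
  2:{ intros w [Hw _]. apply Hdiff; auto. }
  assert (Is := cmean_correct (fun w => w / (w - z))%C s ltac:(lra)).
  specialize (Is ltac:(intros w Hw; destruct (Hdiff w ltac:(lra)) as [l Hl];
     eapply cderive_ccont; eauto)).
  pose proof (is_Cint_minus _ _ _ _ Is (is_Cint_const 1)) as Id.
  apply (is_Cint_bound _ _ eps) in Id; auto.
  intros t _. set (w := circ s t).
  assert (Hw : Cmod w = s) by (apply Cmod_circ; lra).
  pose proof (Hne w ltac:(lra)) as Hn.
  replace (w / (w - z) - 1)%C with (z / (w - z))%C by (field; auto).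
  rewrite Cmod_div by auto.
  assert (Hwz : s - Cmod z <= Cmod (w - z)).
  { pose proof (Cmod_le_add_sub w z). lra. }
  assert (Hpos : 0 < Cmod (w - z)) by lra.
  apply Rle_div_l; auto.
  assert (eps * (Cmod z / eps) = Cmod z) by (field; lra).
  assert (Cmod z / eps <= Cmod (w - z)) by lra.
  nra.
Qed.

(** The mean value property for [w * phi w], where [phi] is the difference quotient
    of [f] at [z]: it is holomorphic except at [z], where it is continuous, and it
    vanishes at 0. *)
Lemma cauchy_formula (f : C -> C) (R0 r : R) (z : C) :
  hol f R0 -> Cmod z < r < R0 ->
  is_Cint (fun t => f (circ r t) * (circ r t / (circ r t - z)))%C (f z).
Proof.
  intros Hf Hr. pose proof (Cmod_ge_0 z) as Pz.
  destruct (Hf z ltac:(simpl; lra)) as [l Hl].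
  apply cderive_slope in Hl. destruct Hl as [phi [Hphi [_ E]]].
  set (g := fun w => (w * phi w)%C).
  assert (Hd : forall w, Cmod w < R0 -> w <> z -> exists l, cderive g w l).
  { intros w Hw N. destruct (Hf w Hw) as [l' Hl'].
    assert (Nwz : (w - z)%C <> 0%C) by (apply Cminus_eq_contra; auto).
    assert (Hq : exists l, cderive (fun u => u * ((f u - f z) * / (u - z)))%C w l).
    { eexists. apply cderive_mult; [apply cderive_id|].
      apply cderive_mult.
      - apply cderive_minus; [exact Hl'|apply cderive_const].
      - apply (cderive_comp Cinv (fun u => u - z)%C).
        + apply cderive_inv; auto.
        + apply cderive_minus; [apply cderive_id|apply cderive_const]. }
    destruct Hq as [q Hq]. exists q. revert Hq.
    apply (cderive_ext_loc _ _ _ _ (Cmod (w - z))); [apply Cmod_gt_0; auto|].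
    intros u Hu. unfold g. rewrite (E u).
    assert ((u - z)%C <> 0%C).
    { intros Eu. apply Ceq_minus in Eu. subst u. rewrite Cmod_sub_sym in Hu. lra. }
    field; auto. }
  assert (Hc : forall w, Cmod w < R0 -> ccont g w).
  { intros w Hw. destruct (Ceq_dec w z) as [->|N].
    - apply ccont_mult; [apply ccont_id|auto].
    - destruct (Hd w Hw N) as [l' Hl']. eapply cderive_ccont; eauto. }
  pose proof (mean_value g R0 z Hc Hd r ltac:(lra)) as Hm.
  assert (Ig := cmean_correct g r ltac:(lra)).
  specialize (Ig ltac:(intros w Hw; apply Hc; lra)). rewrite Hm in Ig.
  assert (Ik := cmean_correct (fun w => w / (w - z))%C r ltac:(lra)).
  assert (Hne : forall w, Cmod w = r -> (w - z)%C <> 0%C).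
  { intros w Hw E'. apply Ceq_minus in E'. subst w. lra. }
  specialize (Ik ltac:(intros w Hw; apply ccont_mult; [apply ccont_id|];
     apply (ccont_comp Cinv (fun w => w - z)%C);
     [apply ccont_plus; [apply ccont_id|apply ccont_const]|apply ccont_inv, Hne, Hw])).
  rewrite cmean_kernel in Ik by lra.
  pose proof (is_Cint_plus _ _ _ _ Ig (is_Cint_scal (f z) _ _ Ik)) as H.
  replace (g 0 + f z * 1)%C with (f z) in H by (unfold g; ring).
  revert H. apply is_Cint_ext. intros t _. unfold g.
  assert (Hw := Cmod_circ r t ltac:(lra)). set (w := circ r t) in *.
  rewrite (E w). field. apply Hne; auto.
Qed.

Definition Csum (a : nat -> C) (n : nat) : C := @sum_n C_AbelianMonoid a n.

Lemma Csum_0 a : Csum a 0 = a 0%nat.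
Proof. apply sum_O. Qed.

Lemma Csum_S a n : Csum a (S n) = (Csum a n + a (S n))%C.
Proof. apply (@sum_Sn C_AbelianMonoid). Qed.

Lemma is_Cint_sum (F : nat -> R -> C) (L : nat -> C) n :
  (forall k, is_Cint (F k) (L k)) -> is_Cint (fun t => Csum (fun k => F k t) n) (Csum L n).
Proof.
  intros H. induction n as [|n IH].
  - rewrite Csum_0. apply (is_Cint_ext (F 0%nat)); auto. intros; rewrite Csum_0; auto.
  - rewrite Csum_S. apply (is_Cint_ext (fun t => Csum (fun k => F k t) n + F (S n) t)%C).
    + intros; rewrite Csum_S; auto.
    + apply is_Cint_plus; auto.
Qed.

(** The [k]-th Taylor coefficient at 0, computed on the circle of radius [r]. *)
Definition tcoef (f : C -> C) (r : R) (k : nat) : C := cmean (fun w => f w / w ^ k)%C r.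

Lemma tcoef_correct f R0 r k : hol f R0 -> 0 < r -> Rbar_lt r R0 ->
  is_Cint (fun t => f (circ r t) / circ r t ^ k)%C (tcoef f r k).
Proof.
  intros Hf Hr HR. apply (cmean_correct (fun w => f w / w ^ k)%C); [lra|].
  intros z Hz. apply ccont_mult; [eapply hol_ccont; eauto; rewrite Hz; auto|].
  apply (ccont_comp Cinv (fun w => w ^ k)%C).
  - eapply cderive_ccont, cderive_pow.
  - apply ccont_inv, Cpow_nz, Cmod_gt_0. lra.
Qed.

Lemma tcoef_indep f R0 r s k : hol f R0 -> 0 < r -> r <= s -> Rbar_lt s R0 ->
  tcoef f r k = tcoef f s k.
Proof.
  intros Hf Hr Hrs HR. apply cmean_annulus; auto.
  intros z [Hz1 Hz2].
  destruct (Hf z) as [l Hl].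
  { eapply Rbar_le_lt_trans; [|exact HR]. simpl; auto. }
  eexists. unfold Cdiv. apply cderive_mult; [exact Hl|].
  apply (cderive_comp Cinv (fun w => w ^ k)%C); [|apply cderive_pow].
  apply cderive_inv, Cpow_nz, Cmod_gt_0. lra.
Qed.

Lemma kernel_expansion (F w z : C) (n : nat) :
  w <> 0%C -> (w - z)%C <> 0%C ->
  (F * (w / (w - z)) =
   Csum (fun k => z ^ k * (F / w ^ k)) n + F * (z / w) ^ S n * (w / (w - z)))%C.
Proof.
  intros Hw Hz. induction n as [|n IH].
  - rewrite Csum_0. simpl. field; auto.
  - rewrite Csum_S, IH.
    replace ((z / w) ^ S (S n))%C with ((z / w) ^ S n * (z / w))%C
      by (rewrite (Cpow_S _ (S n)); ring).
    replace (z ^ S n * (F / w ^ S n))%C with (F * (z / w) ^ S n)%C.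
    + field; auto.
    + unfold Cdiv. rewrite Cpow_mult_l, Cpow_inv by auto. ring.
Qed.

(** The geometric expansion of the Cauchy kernel, integrated with its remainder. *)
Lemma taylor_tcoef (f : C -> C) (R0 : Rbar) (r M : R) (z : C) (n : nat) :
  hol f R0 -> 0 < r -> Rbar_lt r R0 -> (forall w, Cmod w = r -> Cmod (f w) <= M) ->
  Cmod z < r ->
  Cmod (f z - Csum (fun k => tcoef f r k * z ^ k)%C n)
    <= M * (Cmod z / r) ^ S n / (1 - Cmod z / r).
Proof.
  intros Hf Hr HR HM Hz.
  destruct (Rbar_between r R0 HR) as [r' [Hr' HR']].
  assert (Hf' : hol f r') by (apply (hol_le _ _ R0); auto; apply Rbar_lt_le; auto).
  pose proof (cauchy_formula f r' r z Hf' ltac:(lra)) as I1.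
  assert (I2 : is_Cint (fun t => Csum (fun k => z ^ k * (f (circ r t) / circ r t ^ k))%C n)
                (Csum (fun k => z ^ k * tcoef f r k)%C n)).
  { apply (is_Cint_sum (fun k t => z ^ k * (f (circ r t) / circ r t ^ k))%C).
    intros k. apply is_Cint_scal. eapply tcoef_correct; eauto. }
  pose proof (is_Cint_minus _ _ _ _ I1 I2) as I.
  replace (Csum (fun k => tcoef f r k * z ^ k)%C n) with (Csum (fun k => z ^ k * tcoef f r k)%C n).
  2:{ apply (@sum_n_ext C_AbelianMonoid). intros; apply Cmult_comm. }
  apply (is_Cint_bound _ _ (M * (Cmod z / r) ^ S n / (1 - Cmod z / r))) in I; auto.
  intros t _.
  assert (Hw := Cmod_circ r t ltac:(lra)). set (w := circ r t) in *.
  assert (Hw0 : w <> 0%C) by (apply Cmod_gt_0; lra).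
  assert (Hwz : (w - z)%C <> 0%C).
  { intros E. apply Ceq_minus in E. subst z. lra. }
  rewrite (kernel_expansion _ w z n Hw0 Hwz).
  match goal with |- Cmod (?A + ?B - ?A) <= _ => replace (A + B - A)%C with B by ring end.
  rewrite !Cmod_mult, Cmod_pow, !Cmod_div, Hw by auto.
  assert (Hge : r - Cmod z <= Cmod (w - z)).
  { pose proof (Cmod_le_add_sub w z). lra. }
  pose proof (Cmod_ge_0 z) as Pz.
  assert (Hq : 0 <= (Cmod z / r) ^ S n) by (apply pow_le, Rdiv_le_0_compat; lra).
  specialize (HM w Hw). pose proof (Cmod_ge_0 (f w)).
  replace (M * (Cmod z / r) ^ S n / (1 - Cmod z / r))
    with (M * (Cmod z / r) ^ S n * (r / (r - Cmod z))) by (field; lra).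
  apply Rmult_le_compat.
  - apply Rmult_le_pos; auto.
  - apply Rdiv_le_0_compat; lra.
  - apply Rmult_le_compat_r; auto.
  - apply Rmult_le_compat_l; [lra|]. apply Rinv_le_contravar; lra.
Qed.

Lemma tcoef_bound f R0 r M k :
  hol f R0 -> 0 < r -> Rbar_lt r R0 -> (forall w, Cmod w = r -> Cmod (f w) <= M) ->
  Cmod (tcoef f r k) <= M / r ^ k.
Proof.
  intros Hf Hr HR HM. pose proof (tcoef_correct f R0 r k Hf Hr HR) as I.
  apply (is_Cint_bound _ _ (M / r ^ k)) in I; auto.
  intros t _. assert (Hw := Cmod_circ r t ltac:(lra)). set (w := circ r t) in *.
  assert (Hw0 : w <> 0%C) by (apply Cmod_gt_0; lra).
  rewrite Cmod_div by (apply Cpow_nz; auto). rewrite Cmod_pow, Hw.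
  apply Rmult_le_compat_r; [left; apply Rinv_0_lt_compat, pow_lt; lra|]. apply HM; auto.
Qed.

Definition bounded_on (f : C -> C) (r M : R) : Prop := forall w, Cmod w = r -> Cmod (f w) <= M.

(** What is used of a Taylor expansion at 0: its first two coefficients, Cauchy's
    bounds, and an explicit remainder on every smaller disc. *)
Definition taylor_at_0 (f : C -> C) (R0 : Rbar) (c : nat -> C) : Prop :=
  c 0%nat = f 0%C /\ cderive f 0 (c 1%nat) /\
    forall r M, 0 < r -> Rbar_lt r R0 -> bounded_on f r M ->
      (forall k, Cmod (c k) <= M / r ^ k) /\
      (forall z n, Cmod z < r ->
        Cmod (f z - Csum (fun k => c k * z ^ k)%C n) <= M * (Cmod z / r) ^ S n / (1 - Cmod z / r)).

Lemma cderive_of_quadratic (f : C -> C) (z l : C) (K d : R) :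
  0 < d -> (forall h, Cmod h < d -> Cmod (f (z + h)%C - f z - l * h) <= K * (Cmod h * Cmod h)) ->
  cderive f z l.
Proof.
  intros Hd H. apply cderive_eps. intros eps He.
  pose proof (Rabs_pos K) as PK. pose proof (Rle_abs K) as HK.
  assert (He1 : 0 < eps / (Rabs K + 1)) by (apply Rdiv_lt_0_compat; lra).
  exists (Rmin d (eps / (Rabs K + 1))). split; [apply Rmin_pos; auto|].
  intros w Hw. apply Rmin_Rgt_l in Hw. destruct Hw as [W1 W2].
  specialize (H (w - z)%C W1). replace (z + (w - z))%C with w in H by ring.
  pose proof (Cmod_ge_0 (w - z)) as Pm. set (m := Cmod (w - z)) in *.
  eapply Rle_trans; [exact H|].
  assert (W3 : m * (Rabs K + 1) < eps) by (apply Rlt_div_r in W2; lra).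
  replace (K * (m * m)) with ((K * m) * m) by ring.
  apply Rmult_le_compat_r; auto. nra.
Qed.

Theorem taylor_tcoef_0 (f : C -> C) (R0 : Rbar) (r0 : R) :
  0 < r0 -> Rbar_lt r0 R0 -> hol f R0 -> taylor_at_0 f R0 (tcoef f r0).
Proof.
  intros Hr0 HR1 Hf.
  assert (HR0 : Rbar_lt 0 R0) by (eapply Rbar_lt_trans; [|exact HR1]; exact Hr0).
  assert (Hind : forall r k, 0 < r -> Rbar_lt r R0 -> tcoef f r0 k = tcoef f r k).
  { intros r k Hr HR. destruct (Rle_dec r r0).
    - symmetry. apply (tcoef_indep f R0); auto.
    - apply (tcoef_indep f R0); auto. lra. }
  assert (H3 : forall r M, 0 < r -> Rbar_lt r R0 -> bounded_on f r M ->
      (forall k, Cmod (tcoef f r0 k) <= M / r ^ k) /\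
      (forall z n, Cmod z < r ->
        Cmod (f z - Csum (fun k => tcoef f r0 k * z ^ k)%C n) <= M * (Cmod z / r) ^ S n / (1 - Cmod z / r))).
  { intros r M Hr HR HM. split.
    - intros k. rewrite (Hind r k Hr HR). eapply tcoef_bound; eauto.
    - intros z n Hz. replace (Csum _ n) with (Csum (fun k => tcoef f r k * z ^ k)%C n).
      + eapply taylor_tcoef; eauto.
      + apply (@sum_n_ext C_AbelianMonoid). intros k. rewrite (Hind r k Hr HR). auto. }
  (* near 0, continuity bounds [f], and the remainder then gives the derivative *)
  destruct (hol_ccont f R0 0%C Hf) with (eps := 1) as [d [Hd0 Hd]]; [rewrite Cmod_0; auto|lra|].
  set (r := Rmin r0 (d / 2)). set (M := Cmod (f 0%C) + 1).
  assert (Hr : 0 < r) by (apply Rmin_pos; lra).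
  assert (HrR : Rbar_lt r R0).
  { eapply Rbar_le_lt_trans; [|exact HR1]. simpl. apply Rmin_l. }
  assert (Hrd : r < d) by (pose proof (Rmin_r r0 (d / 2)); unfold r; lra).
  assert (HM : forall w, Cmod w <= r -> Cmod (f w) <= M).
  { intros w Hw. specialize (Hd w). replace (w - 0)%C with w in Hd by ring.
    pose proof (Cmod_le_add_sub (f w) (f 0%C)). specialize (Hd ltac:(lra)). unfold M; lra. }
  destruct (H3 r M Hr HrR) as [_ HT]; [intros w Hw; apply HM; lra|].
  assert (E0 : tcoef f r0 0 = f 0%C).
  { specialize (HT 0%C 0%nat). rewrite Cmod_0 in HT. specialize (HT Hr).
    rewrite Csum_0 in HT. symmetry. apply Cmod_sub_eq_0. apply Rle_antisym; [|apply Cmod_ge_0].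
    eapply Rle_trans; [|eapply Rle_trans; [exact HT|]].
    - right. f_equal. simpl. ring.
    - right. field. lra. }
  split; [exact E0|split; [|exact H3]].
  assert (HM0 : 0 <= M) by (unfold M; pose proof (Cmod_ge_0 (f 0%C)); lra).
  apply (cderive_of_quadratic f 0 _ (2 * M / (r * r)) (r / 2)); [lra|].
  intros w W1.
  specialize (HT w 1%nat ltac:(lra)). rewrite Csum_S, Csum_0, E0 in HT.
  replace (f (0 + w)%C - f 0%C - tcoef f r0 1 * w)%C
    with (f w - (f 0%C * w ^ 0 + tcoef f r0 1 * w ^ 1))%C
    by (rewrite Cplus_0_l; simpl; ring).
  eapply Rle_trans; [exact HT|].
  pose proof (Cmod_ge_0 w) as Pw. set (m := Cmod w) in *.
  assert (Hmr : m / r < 1 / 2) by (apply Rlt_div_l; lra).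
  apply Rle_div_l; [lra|].
  replace (M * (m / r) ^ 2) with (2 * M / (r * r) * (m * m) * (1/2)) by (field; lra).
  apply Rmult_le_compat_l; [|lra].
  apply Rmult_le_pos; [apply Rdiv_le_0_compat; nra|nra].
Qed.

Theorem taylor (f : C -> C) (R0 : Rbar) :
  Rbar_lt 0 R0 -> hol f R0 -> exists c : nat -> C, taylor_at_0 f R0 c.
Proof.
  intros HR0 Hf. destruct (Rbar_between 0 R0 HR0) as [r0 [Hr0 HR1]].
  exists (tcoef f r0). apply taylor_tcoef_0; auto.
Qed.

(** * Cauchy's estimates and the maximum principle *)

Definition shift (f : C -> C) (z : C) : C -> C := fun w => f (z + w)%C.

Lemma cderive_shift f z w l : cderive f (z + w) l -> cderive (shift f z) w l.
Proof.
  intros H. apply (cderive_eq _ _ (l * (0 + 1))%C); [ring|].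
  apply (cderive_comp f (fun w => z + w)%C); auto.
  apply cderive_plus; [apply cderive_const|apply cderive_id].
Qed.

Lemma cderive_unshift f z l : cderive (shift f z) 0 l -> cderive f z l.
Proof.
  intros H.
  apply (cderive_ext (fun w => shift f z (w - z))).
  { intros w. unfold shift. f_equal. ring. }
  apply (cderive_eq _ _ (l * (1 - 0))%C); [ring|].
  apply (cderive_comp (shift f z) (fun w => w - z)%C).
  - replace (z - z)%C with (RtoC 0) by ring. exact H.
  - apply cderive_minus; [apply cderive_id|apply cderive_const].
Qed.

Lemma hol_shift f R0 z (r : R) : hol f R0 -> Rbar_le (Cmod z + r) R0 -> hol (shift f z) r.
Proof.
  intros Hf Hr w Hw. simpl in Hw. destruct (Hf (z + w)%C) as [l Hl].
  - eapply Rbar_lt_le_trans; [|exact Hr]. simpl. pose proof (Cmod_triangle z w). lra.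
  - exists l. apply cderive_shift; auto.
Qed.

Lemma cderive_is_tcoef f z l r (R0 : Rbar) :
  hol (shift f z) R0 -> 0 < r -> Rbar_lt r R0 -> cderive f z l -> l = tcoef (shift f z) r 1.
Proof.
  intros Hh Hr HR Hl. destruct (taylor_tcoef_0 _ R0 r Hr HR Hh) as (_ & H & _).
  apply cderive_unshift in H. eapply cderive_unique; eauto.
Qed.

Lemma cauchy_estimate f z l r M (R0 : Rbar) :
  hol (shift f z) R0 -> 0 < r -> Rbar_lt r R0 -> bounded_on (shift f z) r M ->
  cderive f z l -> Cmod l <= M / r.
Proof.
  intros Hh Hr HR HM Hl. rewrite (cderive_is_tcoef f z l r R0 Hh Hr HR Hl).
  replace (M / r) with (M / r ^ 1) by (f_equal; ring).
  eapply tcoef_bound; eauto.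
Qed.

Lemma bounded_on_ge_0 f r M : 0 <= r -> bounded_on f r M -> 0 <= M.
Proof.
  intros Hr H. eapply Rle_trans; [apply Cmod_ge_0|]. apply (H (circ r 0)).
  apply Cmod_circ; auto.
Qed.

Lemma second_order f z l r M h (R0 : Rbar) :
  hol (shift f z) R0 -> 0 < r -> Rbar_lt r R0 -> bounded_on (shift f z) r M ->
  cderive f z l -> Cmod h <= r / 2 ->
  Cmod (f (z + h)%C - f z - l * h) <= 2 * M / (r * r) * (Cmod h * Cmod h).
Proof.
  intros Hh Hr HR HM Hl Hhr. pose proof (bounded_on_ge_0 _ _ _ (Rlt_le _ _ Hr) HM) as HM0.
  destruct (taylor_tcoef_0 _ R0 r Hr HR Hh) as (E0 & E1 & HT).
  destruct (HT r M Hr HR HM) as [_ HT'].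
  specialize (HT' h 1%nat ltac:(lra)). rewrite Csum_S, Csum_0, E0 in HT'.
  assert (E2 : tcoef (shift f z) r 1 = l) by (symmetry; apply (cderive_is_tcoef f z l r R0); auto).
  rewrite E2 in HT'. unfold shift in HT'.
  replace (f (z + h)%C - f z - l * h)%C
    with (f (z + h)%C - (f (z + 0)%C * h ^ 0 + l * h ^ 1))%C
    by (rewrite Cplus_0_r; simpl; ring).
  eapply Rle_trans; [exact HT'|].
  pose proof (Cmod_ge_0 h) as Pw. set (m := Cmod h) in *.
  assert (Hmr : m / r <= 1 / 2) by (apply Rle_div_l; lra).
  apply Rle_div_l; [lra|].
  replace (M * (m / r) ^ 2) with (2 * M / (r * r) * (m * m) * (1/2)) by (field; lra).
  apply Rmult_le_compat_l; [|lra].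
  apply Rmult_le_pos; [apply Rdiv_le_0_compat; nra|nra].
Qed.

Lemma hol_mult f g R0 : hol f R0 -> hol g R0 -> hol (fun z => f z * g z)%C R0.
Proof.
  intros Hf Hg z Hz. destruct (Hf z Hz) as [l Hl], (Hg z Hz) as [m Hm].
  eexists. apply cderive_mult; eauto.
Qed.

Lemma hol_const c R0 : hol (fun _ => c) R0.
Proof. intros z _. exists 0%C. apply cderive_const. Qed.

Lemma hol_minus f g R0 : hol f R0 -> hol g R0 -> hol (fun z => f z - g z)%C R0.
Proof.
  intros Hf Hg z Hz. destruct (Hf z Hz) as [l Hl], (Hg z Hz) as [m Hm].
  eexists. apply cderive_minus; eauto.
Qed.

Lemma hol_plus f g R0 : hol f R0 -> hol g R0 -> hol (fun z => f z + g z)%C R0.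
Proof.
  intros Hf Hg z Hz. destruct (Hf z Hz) as [l Hl], (Hg z Hz) as [m Hm].
  eexists. apply cderive_plus; eauto.
Qed.

Lemma hol_pow f R0 n : hol f R0 -> hol (fun z => f z ^ n)%C R0.
Proof.
  intros Hf. induction n as [|n IH]; [apply (hol_const 1%C)|].
  apply (hol_mult f (fun z => f z ^ n)%C); auto.
Qed.

Lemma hol_inv f R0 :
  hol f R0 -> (forall z, Rbar_lt (Cmod z) R0 -> f z <> 0%C) -> hol (fun z => / f z)%C R0.
Proof.
  intros Hf Hn z Hz. destruct (Hf z Hz) as [l Hl].
  eexists. apply (cderive_comp Cinv f); [apply cderive_inv; auto|exact Hl].
Qed.

Lemma pow_bounded_le_1 (x K : R) : 0 <= x -> (forall n, x ^ n <= K) -> x <= 1.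
Proof.
  intros Hx H. apply Rnot_lt_le. intros Hlt.
  destruct (Pow_x_infinity x) with (b := K + 1) as [N HN]; [rewrite Rabs_pos_eq; lra|].
  specialize (HN N (le_n _)). rewrite Rabs_pos_eq in HN by (apply pow_le; auto).
  specialize (H N). lra.
Qed.

(** Landau's trick: Cauchy's formula loses the factor [r / (r - Cmod z)]; applied to
    [f ^ n] it loses only the [n]-th root of that factor. *)
Lemma max_modulus_disc f (R0 : Rbar) r M z :
  hol f R0 -> 0 < r -> Rbar_lt r R0 -> bounded_on f r M -> Cmod z <= r -> Cmod (f z) <= M.
Proof.
  intros Hf Hr HR HM [Hz|Hz]; [|apply HM; auto].
  pose proof (bounded_on_ge_0 _ _ _ (Rlt_le _ _ Hr) HM) as HM0.
  pose proof (Cmod_ge_0 z) as Pz.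
  assert (Hc : forall n, Cmod (f z) ^ n <= M ^ n * (r / (r - Cmod z))).
  { intros n. destruct (Rbar_between r R0 HR) as [r' [Hr' HR']].
    pose proof (cauchy_formula (fun z => f z ^ n)%C r' r z) as I.
    specialize (I (hol_pow _ _ _ (hol_le _ _ _ (Rbar_lt_le _ _ HR') Hf)) ltac:(lra)).
    rewrite <- Cmod_pow. revert I. apply is_Cint_bound. intros t _.
    pose proof (Cmod_circ r t ltac:(lra)) as Hw. set (w := circ r t) in *.
    assert (Hwz : (w - z)%C <> 0%C).
    { intros E. apply Ceq_minus in E. subst z. lra. }
    rewrite Cmod_mult, Cmod_pow, Cmod_div, Hw by auto.
    assert (r - Cmod z <= Cmod (w - z)) by (pose proof (Cmod_le_add_sub w z); lra).
    apply Rmult_le_compat.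
    - apply pow_le, Cmod_ge_0.
    - apply Rdiv_le_0_compat; lra.
    - apply pow_incr. split; [apply Cmod_ge_0|]. apply HM; auto.
    - apply Rmult_le_compat_l; [lra|]. apply Rinv_le_contravar; lra. }
  apply le_epsilon. intros eps He.
  assert (H1 : Cmod (f z) / (M + eps) <= 1).
  { pose proof (Cmod_ge_0 (f z)).
    apply (pow_bounded_le_1 _ (r / (r - Cmod z))); [apply Rdiv_le_0_compat; lra|].
    intros n. specialize (Hc n). unfold Rdiv at 1. rewrite Rpow_mult_distr, pow_inv.
    assert (0 < (M + eps) ^ n) by (apply pow_lt; lra).
    apply Rle_div_l; auto. eapply Rle_trans; [exact Hc|].
    rewrite Rmult_comm. apply Rmult_le_compat_l; [apply Rdiv_le_0_compat; lra|].
    apply pow_incr; lra. }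
  apply Rle_div_l in H1; lra.
Qed.

Lemma unit_circle_angle x y : x * x + y * y = 1 ->
  exists a, 0 <= a <= 2 * PI /\ cos a = x /\ sin a = y.
Proof.
  intros H. assert (Hx : -1 <= x <= 1) by nra.
  pose proof (acos_bound x) as Ha.
  assert (Hs : sin (acos x) = Rabs y).
  { rewrite sin_acos by auto. replace (1 - x²) with (y²) by (unfold Rsqr; lra). apply sqrt_Rsqr_abs. }
  pose proof (cos_acos x Hx) as Hc.
  destruct (Rle_dec 0 y) as [Hy|Hy].
  - exists (acos x). rewrite Hc, Hs, Rabs_pos_eq by auto. repeat split; auto; lra.
  - exists (- acos x + 2 * PI). split; [lra|].
    rewrite cos_plus, sin_plus, cos_neg, sin_neg, cos_2PI, sin_2PI, Hc, Hs.
    rewrite Rabs_left by lra. split; ring.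
Qed.

Lemma circ_polar w : exists t, 0 <= t <= 1 /\ w = circ (Cmod w) t.
Proof.
  pose proof PI_RGT_0 as HP. destruct (Ceq_dec w 0) as [->|N].
  - exists 0. rewrite Cmod_0, circ_0. split; [lra|auto].
  - pose proof (proj1 (Cmod_gt_0 w) N) as Hr.
    destruct (unit_circle_angle (Re w / Cmod w) (Im w / Cmod w)) as [a [Ha [Hc Hs]]].
    { pose proof (Cmod2_alt w). field_simplify; [|lra]. rewrite <- H. field; lra. }
    exists (a / (2 * PI)). split.
    + split; [apply Rdiv_le_0_compat; lra|apply Rle_div_l; lra].
    + unfold circ. replace (2 * PI * (a / (2 * PI))) with a by (field; lra).
      rewrite Hc, Hs. apply C_ext; simpl; field; lra.
Qed.

Lemma continuous_circle_bounded f r :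
  0 <= r -> (forall z, Cmod z = r -> ccont f z) -> exists M, bounded_on f r M.
Proof.
  intros Hr Hf. pose proof PI_RGT_0 as HP.
  destruct (continuity_ab_maj (fun t => Cmod (f (circ r t))) 0 1) as [t0 [Ht0 _]]; [lra| |].
  - intros t _. intros eps He.
    destruct (Hf (circ r t) (Cmod_circ r t Hr) eps He) as [d [Hd0 Hd]].
    assert (Hd1 : 0 < d / (4 * r * PI + 1)) by (apply Rdiv_lt_0_compat; nra).
    exists (d / (4 * r * PI + 1)). split; auto. intros s [_ Hs].
    change (Rabs (s - t) < d / (4 * r * PI + 1)) in Hs.
    change (Rabs (Cmod (f (circ r s)) - Cmod (f (circ r t))) < eps).
    eapply Rle_lt_trans with (Cmod (f (circ r s) - f (circ r t))).
    { apply Rabs_le_between. pose proof (Cmod_le_add_sub (f (circ r s)) (f (circ r t))).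
      pose proof (Cmod_le_add_sub (f (circ r t)) (f (circ r s))) as H'.
      rewrite Cmod_sub_sym in H'. lra. }
    apply Hd. eapply Rle_lt_trans; [apply circ_lipschitz; auto|].
    replace (r - r) with 0 by ring. rewrite Rabs_R0.
    apply Rlt_div_r in Hs; [|nra]. pose proof (Rabs_pos (s - t)). nra.
  - exists (Cmod (f (circ r t0))). intros w Hw.
    destruct (circ_polar w) as [t [Ht E]]. rewrite E, Hw. apply Ht0; auto.
Qed.

Lemma hol_bounded f (R0 : Rbar) r :
  hol f R0 -> 0 < r -> Rbar_lt r R0 -> exists M, 0 <= M /\ forall z, Cmod z <= r -> Cmod (f z) <= M.
Proof.
  intros Hf Hr HR. destruct (continuous_circle_bounded f r) as [M HM].
  - lra.
  - intros z Hz. eapply hol_ccont; eauto. rewrite Hz; auto.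
  - exists M. split; [eapply bounded_on_ge_0; [|exact HM]; lra|].
    intros z Hz. eapply max_modulus_disc; eauto.
Qed.

(** * Locally uniform limits, derivatives, primitives, logarithms *)

Lemma ccont_of_approx (F : C -> C) (z : C) (d : R) :
  0 < d ->
  (forall eps, 0 < eps -> exists g, ccont g z /\
     forall w, Cmod (w - z) < d -> Cmod (g w - F w) <= eps) -> ccont F z.
Proof.
  intros Hd H eps He. destruct (H (eps / 4)) as [g [Hg Hgf]]; [lra|].
  destruct (Hg (eps / 4)) as [d' [Hd' Hgc]]; [lra|].
  exists (Rmin d d'). split; [apply Rmin_pos; auto|].
  intros w Hw. apply Rmin_Rgt_l in Hw. destruct Hw as [W1 W2].
  pose proof (Hgf w W1) as B1. specialize (Hgc w W2).
  assert (B2 : Cmod (g z - F z) <= eps / 4).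
  { apply Hgf. replace (z - z)%C with (RtoC 0) by ring. rewrite Cmod_0; auto. }
  rewrite Cmod_sub_sym in B1.
  pose proof (Cmod_sub_tri (F w) (g w) (F z)). pose proof (Cmod_sub_tri (g w) (g z) (F z)). lra.
Qed.

(** Weierstrass: the first Taylor coefficient at [z] is an integral that makes sense
    for the continuous function [F] and is close to the derivatives of the
    approximations, whose second order remainders are bounded uniformly. *)
Theorem hol_of_approx (F : C -> C) (R0 : Rbar) :
  (forall r eps, 0 < r -> Rbar_lt r R0 -> 0 < eps ->
     exists g, hol g r /\ forall z, Cmod z < r -> Cmod (g z - F z) <= eps) ->
  hol F R0.
Proof.
  intros H z Hz. pose proof (Cmod_ge_0 z) as Pz.
  destruct (Rbar_between _ _ Hz) as [r [Hr HR]].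
  assert (Hg : forall eps, 0 < eps ->
    exists g, hol g r /\ forall z, Cmod z < r -> Cmod (g z - F z) <= eps).
  { intros eps He. apply H; auto. lra. }
  set (rho := (r - Cmod z) / 2). assert (Hrho : 0 < rho) by (unfold rho; lra).
  assert (Hin : forall h, Cmod h <= rho -> Cmod (z + h) < r).
  { intros h Hh. pose proof (Cmod_triangle z h). unfold rho in *; lra. }
  assert (HFc : forall w, Cmod w < r -> ccont F w).
  { intros w Hw. apply (ccont_of_approx F w (r - Cmod w)); [lra|].
    intros eps He. destruct (Hg eps He) as [g [Hgh Hgf]]. exists g. split.
    - eapply hol_ccont; eauto.
    - intros u Hu. apply Hgf. pose proof (Cmod_le_add_sub u w). lra. }
  destruct (Hg 1 ltac:(lra)) as [g1 [Hg1 Hg1f]].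
  assert (Hsh : forall g, hol g r -> hol (shift g z) (2 * rho)).
  { intros g Hgh. apply (hol_shift _ r); auto. simpl. unfold rho. lra. }
  assert (Hr2 : Rbar_lt rho (2 * rho)) by (simpl; lra).
  destruct (hol_bounded (shift g1 z) (2 * rho) rho (Hsh _ Hg1) Hrho Hr2) as [M1 [HM1 HM1b]].
  set (l := cmean (fun w => shift F z w / w ^ 1)%C rho).
  assert (Il : is_Cint (fun t => shift F z (circ rho t) / circ rho t ^ 1)%C l).
  { apply (cmean_correct (fun w => shift F z w / w ^ 1)%C); [lra|]. intros w Hw.
    apply ccont_mult.
    - apply (ccont_comp F (fun w => z + w)%C).
      + apply ccont_plus; [apply ccont_const|apply ccont_id].
      + apply HFc, Hin; lra.
    - apply (ccont_comp Cinv (fun w => w ^ 1)%C).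
      + eapply cderive_ccont, cderive_pow.
      + apply ccont_inv, Cpow_nz, Cmod_gt_0. lra. }
  exists l.
  apply (cderive_of_quadratic F z l (2 * (M1 + 2) / (rho * rho)) (rho / 2)); [lra|].
  intros h Hh. apply le_epsilon. intros eps He.
  set (K := 2 + Cmod h / rho).
  assert (HK : 0 < K).
  { unfold K. assert (0 <= Cmod h / rho) by (apply Rdiv_le_0_compat; [apply Cmod_ge_0|auto]). lra. }
  set (e := Rmin 1 (eps / K)).
  assert (He0 : 0 < e) by (apply Rmin_pos; [lra|apply Rdiv_lt_0_compat; auto]).
  assert (He1 : e <= 1) by apply Rmin_l.
  assert (HeK : e * K <= eps).
  { apply Rle_trans with (eps / K * K); [|right; field; lra].
    apply Rmult_le_compat_r; [lra|apply Rmin_r]. }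
  destruct (Hg e He0) as [g [Hgh Hgf]].
  destruct (Hgh z) as [m Hm]; [simpl; lra|].
  assert (HgM : bounded_on (shift g z) rho (M1 + 2)).
  { intros w Hw. unfold shift. pose proof (Hin w ltac:(lra)) as Hw'.
    specialize (Hgf _ Hw'). specialize (Hg1f _ Hw'). specialize (HM1b w ltac:(lra)).
    unfold shift in HM1b. rewrite Cmod_sub_sym in Hg1f.
    pose proof (Cmod_le_add_sub (g (z + w)%C) (F (z + w)%C)).
    pose proof (Cmod_le_add_sub (F (z + w)%C) (g1 (z + w)%C)). lra. }
  pose proof (second_order g z m rho (M1 + 2) h (2 * rho) (Hsh _ Hgh) Hrho Hr2 HgM Hm ltac:(lra)) as B1.
  assert (B2 : Cmod (m - l) <= e / rho).
  { rewrite (cderive_is_tcoef g z m rho (2 * rho) (Hsh _ Hgh) Hrho Hr2 Hm).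
    pose proof (tcoef_correct (shift g z) (2 * rho) rho 1 (Hsh _ Hgh) Hrho Hr2) as Im.
    pose proof (is_Cint_minus _ _ _ _ Im Il) as Id. revert Id.
    apply is_Cint_bound. intros t _.
    pose proof (Cmod_circ rho t ltac:(lra)) as Hw. set (w := circ rho t) in *.
    assert (Hw0 : w <> 0%C) by (apply Cmod_gt_0; lra).
    replace (shift g z w / w ^ 1 - shift F z w / w ^ 1)%C
      with ((g (z + w) - F (z + w)) / w)%C by (unfold shift; simpl; field; auto).
    rewrite Cmod_div, Hw by auto. apply Rmult_le_compat_r.
    - left; apply Rinv_0_lt_compat; auto.
    - apply Hgf, Hin. lra. }
  pose proof (Hgf _ (Hin h ltac:(lra))) as B3. pose proof (Hgf z ltac:(lra)) as B4.
  rewrite Cmod_sub_sym in B3.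
  replace (F (z + h)%C - F z - l * h)%C with
    ((F (z + h) - g (z + h)) + (g (z + h) - g z - m * h) + (g z - F z) + (m - l) * h)%C by ring.
  eapply Rle_trans; [apply Cmod_triangle|].
  eapply Rle_trans; [apply Rplus_le_compat_r, Cmod_triangle|].
  eapply Rle_trans; [apply Rplus_le_compat_r, Rplus_le_compat_r, Cmod_triangle|].
  rewrite Cmod_mult.
  assert (Cmod (m - l) * Cmod h <= e * (Cmod h / rho)).
  { replace (e * (Cmod h / rho)) with (e / rho * Cmod h) by (field; lra).
    apply Rmult_le_compat_r; [apply Cmod_ge_0|auto]. }
  unfold K in HeK. nra.
Qed.

(** The derivative is a locally uniform limit of difference quotients. *)
Theorem hol_derive (f f' : C -> C) (R0 : Rbar) :
  (forall z, Rbar_lt (Cmod z) R0 -> cderive f z (f' z)) -> hol f' R0.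
Proof.
  intros Hf.
  assert (Hh : hol f R0) by (intros z Hz; exists (f' z); auto).
  apply hol_of_approx. intros r eps Hr HR He.
  destruct (Rbar_between r R0 HR) as [r1 [Hr1 HR1]].
  destruct (hol_bounded f R0 r1 Hh ltac:(lra) HR1) as [M [HM0 HM]].
  set (rho := (r1 - r) / 2). assert (Hrho : 0 < rho) by (unfold rho; lra).
  set (K := 2 * M / (rho * rho)).
  assert (HK : 0 <= K) by (apply Rdiv_le_0_compat; nra).
  set (t := Rmin (rho / 2) (eps / (K + 1))).
  assert (Ht0 : 0 < t) by (apply Rmin_pos; [lra|apply Rdiv_lt_0_compat; lra]).
  assert (Ht1 : t <= rho / 2) by apply Rmin_l.
  assert (Ht2 : K * t <= eps).
  { assert (t * (K + 1) <= eps).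
    { apply Rle_trans with (eps / (K + 1) * (K + 1)); [|right; field; lra].
      apply Rmult_le_compat_r; [lra|apply Rmin_r]. }
    nra. }
  assert (Ct : Cmod t = t) by (rewrite Cmod_R; apply Rabs_pos_eq; lra).
  assert (Nt : RtoC t <> 0%C) by (apply Cmod_gt_0; lra).
  exists (fun z => (f (t + z)%C - f z) * / t)%C. split.
  - apply hol_mult; [|apply hol_const]. apply hol_minus.
    + intros z Hz. simpl in Hz. destruct (Hh (t + z)%C) as [l Hl].
      * eapply Rbar_lt_trans; [|exact HR1]. simpl.
        pose proof (Cmod_triangle t z). unfold rho in *; lra.
      * exists l. apply (cderive_shift f t); auto.
    + apply (hol_le _ _ R0); auto. apply Rbar_lt_le; auto.
  - intros z Hz. pose proof (Cmod_ge_0 z) as Pz.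
    assert (HzR : Rbar_lt (Cmod z) R0) by (eapply Rbar_lt_trans; [|exact HR]; exact Hz).
    assert (Hsh : hol (shift f z) (2 * rho)).
    { apply (hol_shift _ R0); auto. eapply Rbar_le_trans; [|apply Rbar_lt_le, HR1].
      simpl. unfold rho. lra. }
    assert (HMb : bounded_on (shift f z) rho M).
    { intros w Hw. apply HM. pose proof (Cmod_triangle z w). unfold rho in *; lra. }
    pose proof (second_order f z (f' z) rho M t (2 * rho) Hsh Hrho) as B.
    specialize (B ltac:(simpl; lra) HMb (Hf z HzR) ltac:(lra)). fold K in B. rewrite Ct in B.
    replace ((f (t + z)%C - f z) * / t - f' z)%C
      with ((f (z + t)%C - f z - f' z * t) / t)%C
      by (rewrite (Cplus_comm t z); field; auto).
    rewrite Cmod_div, Ct by auto. apply Rle_div_l; auto.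
    eapply Rle_trans; [exact B|]. nra.
Qed.

Lemma disc_pt (r : R) p q t :
  0 <= t <= 1 -> Cmod p <= r -> Cmod q <= r -> Cmod (pt p q t) <= r.
Proof.
  intros Ht Hp Hq. replace (pt p q t) with ((1 - t)%R * p + t * q)%C
    by (unfold pt; rewrite RtoC_minus; ring).
  eapply Rle_trans; [apply Cmod_triangle|].
  rewrite !Cmod_mult, !Cmod_R, !Rabs_pos_eq by lra. nra.
Qed.

Lemma disc_closed (r : R) p :
  (forall eps, 0 < eps -> exists q, Cmod q <= r /\ Cmod (q - p) < eps) -> Cmod p <= r.
Proof.
  intros H. apply le_epsilon. intros eps He. destruct (H eps He) as [q [Hq Hqp]].
  pose proof (Cmod_le_add_sub p q). rewrite Cmod_sub_sym in H0. lra.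
Qed.

Lemma seg_const c p q : seg (fun _ => c) p q = (c * (q - p))%C.
Proof. unfold seg. rewrite (is_Cint_unique _ _ (is_Cint_const c)). ring. Qed.

(** The integral from 0 along segments; Goursat's theorem on the triangle
    [0, z, w] gives its increments. *)
Theorem hol_primitive f (R0 : Rbar) :
  hol f R0 -> exists F : C -> C, F 0%C = 0%C /\ forall z, Rbar_lt (Cmod z) R0 -> cderive F z (f z).
Proof.
  intros Hf. exists (fun z => seg f 0 z). split; [unfold seg; ring|].
  intros z Hz. pose proof (Cmod_ge_0 z) as Pz.
  destruct (Rbar_between _ _ Hz) as [r [Hr HR]].
  assert (Hfr : forall w, Cmod w <= r -> exists l, cderive f w l).
  { intros w Hw. apply Hf. eapply Rbar_le_lt_trans; [|exact HR]. exact Hw. }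
  assert (Hseg : forall p q, Cmod p <= r -> Cmod q <= r -> seg_cont f p q)
    by (apply (convex_seg_cont f (fun w => Cmod w <= r)); auto; apply disc_pt).
  assert (H0 : Cmod 0 <= r) by (rewrite Cmod_0; lra).
  apply cderive_eps. intros eps He.
  destruct (hol_ccont f R0 z Hf Hz eps He) as [d [Hd Hcd]].
  exists (Rmin d (r - Cmod z)). split; [apply Rmin_pos; lra|].
  intros w Hw. apply Rmin_Rgt_l in Hw. destruct Hw as [W1 W2].
  assert (Hwr : Cmod w <= r) by (pose proof (Cmod_le_add_sub w z); lra).
  assert (Hzr : Cmod z <= r) by lra.
  pose proof (goursat f (fun w => Cmod w <= r) (disc_pt r) (disc_closed r) Hfr
    (RtoC 0, z, w) (conj H0 (conj Hzr Hwr))) as G. simpl in G.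
  rewrite (seg_rev f 0 w) in G by auto.
  assert (E : (seg f 0 w - seg f 0 z = seg f z w)%C).
  { transitivity (seg f 0 w - seg f 0 z + (seg f 0 z + seg f z w + - seg f 0 w))%C; [|ring].
    rewrite G. ring. }
  rewrite E, <- (seg_const (f z) z w), <- seg_minus.
  - apply seg_bound.
    + intros t Ht. apply ccont_plus; [apply Hseg; auto|apply ccont_const].
    + intros t Ht. apply Rlt_le, Hcd. eapply Rle_lt_trans; [apply pt_dist; auto|auto].
  - auto.
  - intros t Ht. apply ccont_const.
Qed.

Lemma constant_of_cderive_0 (h : C -> C) (R0 : Rbar) z :
  (forall w, Rbar_lt (Cmod w) R0 -> cderive h w 0) -> Rbar_lt (Cmod z) R0 -> h z = h 0%C.
Proof.
  intros H Hz.
  pose proof (@eq_is_derive C_R_NormedModule (fun t : R => h (0 + t * z)%C) 0 1) as E.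
  replace z with (0 + 1 * z)%C at 1 by ring.
  replace (h 0%C) with (h (0 + 0 * z)%C) by (f_equal; ring).
  symmetry. apply E; [|lra]. intros t Ht.
  replace (@zero C_R_NormedModule) with (0 * z)%C.
  - apply cderive_line. apply H. eapply Rbar_le_lt_trans; [|exact Hz].
    simpl. rewrite Cplus_0_l, Cmod_mult, Cmod_R, Rabs_pos_eq by lra.
    pose proof (Cmod_ge_0 z). nra.
  - change (@eq C (0 * z)%C (RtoC 0)). ring.
Qed.

(** [L] is a primitive of [f' / f] and [f * exp (- L)] has derivative 0. *)
Theorem hol_log f (R0 : Rbar) :
  Rbar_lt 0 R0 -> hol f R0 -> (forall z, Rbar_lt (Cmod z) R0 -> f z <> 0%C) ->
  exists L : C -> C, L 0%C = 0%C /\ hol L R0 /\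
    forall z, Rbar_lt (Cmod z) R0 -> f z = (f 0 * Cexp (L z))%C.
Proof.
  intros HR Hf Hn.
  assert (Hf' : forall z, Rbar_lt (Cmod z) R0 -> cderive f z (C_derive f z)).
  { intros z Hz. apply (C_derive_correct f z 0%C). apply Hf; auto. }
  destruct (hol_primitive (fun z => C_derive f z * / f z)%C R0) as [L [L0 HL]].
  { apply hol_mult; [apply (hol_derive f); auto|apply hol_inv; auto]. }
  exists L. split; auto. split; [intros z Hz; eexists; apply HL; auto|].
  intros z Hz.
  assert (Hc : (f z * Cexp (- L z) = f 0 * Cexp (- L 0))%C).
  { apply (constant_of_cderive_0 (fun z => f z * Cexp (- L z))%C R0); auto.
    intros w Hw.
    apply (cderive_eq _ _ (C_derive f w * Cexp (- L w)
       + f w * (Cexp (- L w) * - (C_derive f w * / f w)))%C).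
    - field. apply Hn; auto.
    - apply (cderive_mult f (fun w => Cexp (- L w))%C); auto.
      apply (cderive_comp Cexp (fun w => - L w)%C); [apply cderive_Cexp|].
      apply cderive_opp; auto. }
  rewrite L0 in Hc. replace (- 0)%C with (RtoC 0) in Hc by ring.
  rewrite Cexp_0, Cexp_opp in Hc.
  replace (f 0%C) with (f z * / Cexp (L z))%C by (rewrite Hc; ring).
  field. apply Cexp_neq_0.
Qed.

(** * Schwarz's lemma and Harnack's inequality *)

(** Away from 0 the quotient is [f z / z]; at 0 its derivative is the second Taylor
    coefficient of [f]. *)
Theorem hol_div_id f (R0 : Rbar) :
  Rbar_lt 0 R0 -> hol f R0 -> f 0%C = 0%C ->
  exists g : C -> C, hol g R0 /\ cderive f 0 (g 0%C) /\ forall z, f z = (z * g z)%C.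
Proof.
  intros HR Hf H0. destruct (taylor f R0 HR Hf) as [c [E0 [E1 HT]]].
  exists (fun z => if Ceq_dec z 0 then c 1%nat else (f z * / z)%C).
  split; [|split].
  - intros z Hz. destruct (Ceq_dec z 0) as [->|N].
    + exists (c 2%nat).
      destruct (Rbar_between 0 R0 HR) as [r [Hr HrR]].
      destruct (hol_bounded f R0 r Hf Hr HrR) as [M [HM0 HM]].
      destruct (HT r M Hr HrR) as [_ HT']; [intros w Hw; apply HM; lra|].
      apply (cderive_of_quadratic _ _ _ (2 * M / (r * r * r)) (r / 2)); [lra|].
      intros h Hh. specialize (HT' h 2%nat ltac:(lra)).
      rewrite !Csum_S, Csum_0, E0, H0 in HT'.
      replace (0 + h)%C with h by ring.
      destruct (Ceq_dec 0 0) as [_|?]; [|contradiction].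
      destruct (Ceq_dec h 0) as [->|Nh].
      * replace (c 1%nat - c 1%nat - c 2%nat * 0)%C with (RtoC 0) by ring. rewrite Cmod_0. lra.
      * pose proof (proj1 (Cmod_gt_0 h) Nh) as Ph.
        replace (f h * / h - c 1%nat - c 2%nat * h)%C
          with ((f h - (0 * h ^ 0 + c 1%nat * h ^ 1 + c 2%nat * h ^ 2)) / h)%C
          by (simpl; field; auto).
        rewrite Cmod_div by auto. apply Rle_div_l; auto.
        eapply Rle_trans; [exact HT'|]. set (m := Cmod h) in *.
        assert (Hmr : m / r < 1 / 2) by (apply Rlt_div_l; lra).
        apply Rle_div_l; [lra|].
        replace (M * (m / r) ^ 3) with (2 * M / (r * r * r) * (m * m) * m * (1/2)) by (field; lra).
        apply Rmult_le_compat_l; [|lra].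
        apply Rmult_le_pos; [|lra]. apply Rmult_le_pos; [|nra].
        apply Rdiv_le_0_compat; [lra|]. repeat apply Rmult_lt_0_compat; auto.
    + destruct (Hf z Hz) as [l Hl]. eexists.
      apply (cderive_ext_loc (fun w => f w * / w)%C _ z _ (Cmod z)); [apply Cmod_gt_0; auto| |].
      * intros w Hw. destruct (Ceq_dec w 0) as [->|]; auto.
        rewrite Cmod_sub_sym in Hw. replace (z - 0)%C with z in Hw by ring. lra.
      * apply cderive_mult; [exact Hl|apply cderive_inv; auto].
  - destruct (Ceq_dec 0 0) as [_|?]; [auto|contradiction].
  - intros z. destruct (Ceq_dec z 0) as [->|N]; [rewrite H0; ring|field; auto].
Qed.

(** The maximum principle for [w z / z] on discs whose radii increase to [R0]. *)
Lemma schwarz (w : C -> C) (R0 : R) z :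
  hol w R0 -> w 0%C = 0%C -> (forall z, Cmod z < R0 -> Cmod (w z) <= 1) ->
  Cmod z < R0 -> Cmod (w z) <= Cmod z / R0.
Proof.
  intros Hw H0 Hb Hz. pose proof (Cmod_ge_0 z) as Pz.
  destruct (hol_div_id w R0) as [g [Hg [_ E]]]; auto; [simpl; lra|].
  assert (Hr : forall r, Cmod z < r < R0 -> Cmod (g z) * r <= 1).
  { intros r Hr. apply Rle_div_r; [lra|].
    apply (max_modulus_disc g R0 r); auto; try lra; [simpl; lra|].
    intros u Hu. specialize (Hb u ltac:(lra)). rewrite (E u), Cmod_mult, Hu in Hb.
    apply Rle_div_r; lra. }
  assert (HR : Cmod (g z) * R0 <= 1).
  { apply Rnot_lt_le. intros Hlt. pose proof (Cmod_ge_0 (g z)) as Pg.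
    assert (Pg' : 0 < Cmod (g z)) by nra.
    assert (H1 : 1 / Cmod (g z) < R0) by (apply Rlt_div_l; lra).
    set (r := Rmax ((Cmod z + R0) / 2) ((1 / Cmod (g z) + R0) / 2)).
    assert (r < R0) by (apply Rmax_lub_lt; lra).
    pose proof (Rmax_l ((Cmod z + R0) / 2) ((1 / Cmod (g z) + R0) / 2)) as M1.
    pose proof (Rmax_r ((Cmod z + R0) / 2) ((1 / Cmod (g z) + R0) / 2)) as M2. fold r in M1, M2.
    specialize (Hr r ltac:(lra)).
    assert (Hrr : r <= 1 / Cmod (g z)) by (apply Rle_div_r; lra). lra. }
  rewrite (E z), Cmod_mult. unfold Rdiv. apply Rmult_le_compat_l; auto.
  assert (HR0 : 0 < R0) by lra. rewrite <- (Rmult_1_l (/ R0)). apply Rle_div_r; auto.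
Qed.

(** The Moebius map [u |-> (u - F 0) / (u + conj (F 0))] sends the right half-plane
    to the unit disc and [F 0] to 0, so that Schwarz's lemma applies to its
    composition with [F]. *)
Lemma schwarz_half_plane (F : C -> C) (R0 : R) z :
  hol F R0 -> (forall z, Cmod z < R0 -> 0 < Re (F z)) -> Cmod z < R0 ->
  Cmod (F z - F 0%C) <= Cmod z / R0 * Cmod (F z + Cconj (F 0%C)).
Proof.
  intros HF HRe Hz. pose proof (Cmod_ge_0 z) as Pz.
  assert (Ha : 0 < Re (F 0%C)) by (apply HRe; rewrite Cmod_0; lra).
  assert (Hsum : forall w, Cmod w < R0 -> (F w + Cconj (F 0%C))%C <> 0%C).
  { intros w Hw E. apply (f_equal Re) in E. rewrite re_plus, re_conj in E.
    specialize (HRe w Hw). simpl in E. lra. }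
  assert (Hle : forall w, Cmod w < R0 -> Cmod (F w - F 0%C) <= Cmod (F w + Cconj (F 0%C))).
  { intros w Hw. specialize (HRe w Hw). unfold Cmod. apply sqrt_le_1_alt.
    destruct (F w) as [x y], (F 0%C) as [a b]. simpl in *. nra. }
  assert (H : Cmod ((F z - F 0%C) * / (F z + Cconj (F 0%C))) <= Cmod z / R0).
  { apply (schwarz (fun z => (F z - F 0%C) * / (F z + Cconj (F 0%C)))%C R0); auto.
    - apply hol_mult; [apply hol_minus; auto; apply hol_const|].
      apply hol_inv; [apply hol_plus; auto; apply hol_const|]. auto.
    - ring.
    - intros w Hw. fold (Cdiv (F w - F 0%C) (F w + Cconj (F 0%C))).
      rewrite Cmod_div by auto. apply Rle_div_l; [apply Cmod_gt_0; auto|].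
      rewrite Rmult_1_l. auto. }
  fold (Cdiv (F z - F 0%C) (F z + Cconj (F 0%C))) in H.
  rewrite Cmod_div in H by auto.
  apply (proj1 (Rle_div_l _ (Cmod z / R0) _ (proj1 (Cmod_gt_0 _) (Hsum z Hz)))) in H. exact H.
Qed.

(** The lower Harnack inequality for [Re F], squared out from the preceding lemma.
    Its linear decay at the boundary is what Hopf's lemma needs. *)
Lemma harnack (F : C -> C) (R0 : R) z :
  hol F R0 -> (forall z, Cmod z < R0 -> 0 < Re (F z)) -> Cmod z < R0 ->
  Re (F 0%C) * (R0 - Cmod z) <= Re (F z) * (R0 + Cmod z).
Proof.
  intros HF HRe Hz. pose proof (Cmod_ge_0 z) as Pz.
  pose proof (schwarz_half_plane F R0 z HF HRe Hz) as H.
  assert (Ha : 0 < Re (F 0%C)) by (apply HRe; rewrite Cmod_0; lra).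
  specialize (HRe z Hz). set (q := Cmod z / R0) in *.
  assert (Hq0 : 0 <= q) by (apply Rdiv_le_0_compat; lra).
  assert (Hq1 : q < 1) by (apply Rlt_div_l; lra).
  assert (H2 : Cmod (F z - F 0%C) ^ 2 <= (q * Cmod (F z + Cconj (F 0%C))) ^ 2).
  { apply pow_incr. split; [apply Cmod_ge_0|auto]. }
  rewrite Rpow_mult_distr, !Cmod2_alt in H2.
  destruct (F z) as [x y], (F 0%C) as [a b]. simpl in *.
  assert (E : Cmod z = q * R0) by (unfold q; field; lra). rewrite E.
  assert (H3 : (a - x) <= q * (x + a)).
  { apply Rnot_lt_le. intros Hlt.
    assert ((q * (x + a)) * (q * (x + a)) < (a - x) * (a - x)).
    { apply Rmult_le_0_lt_compat; auto; apply Rmult_le_pos; lra. }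
    assert ((y + - b) * (y + - b) * (1 - q * q) >= 0).
    { apply Rle_ge, Rmult_le_pos; [apply Rle_0_sqr|nra]. }
    nra. }
  nra.
Qed.

(** Control of the whole function by its real part, on the half-sized disc. *)
Lemma caratheodory (F : C -> C) (R0 : R) z :
  hol F R0 -> (forall z, Cmod z < R0 -> 0 < Re (F z)) -> Cmod z <= R0 / 2 -> 0 < R0 ->
  Cmod (F z - F 0%C) <= 2 * Re (F 0%C).
Proof.
  intros HF HRe Hz HR. pose proof (Cmod_ge_0 z) as Pz.
  pose proof (schwarz_half_plane F R0 z HF HRe ltac:(lra)) as H.
  assert (Ha : 0 < Re (F 0%C)) by (apply HRe; rewrite Cmod_0; lra).
  assert (Hq1 : Cmod z / R0 <= 1 / 2) by (apply Rle_div_l; lra).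
  assert (H2 : Cmod (F z + Cconj (F 0%C)) <= Cmod (F z - F 0%C) + 2 * Re (F 0%C)).
  { replace (F z + Cconj (F 0%C))%C with ((F z - F 0%C) + RtoC (2 * Re (F 0%C)))%C.
    - eapply Rle_trans; [apply Cmod_triangle|]. rewrite Cmod_R, Rabs_pos_eq; lra.
    - destruct (F z), (F 0%C). apply C_ext; simpl; ring. }
  pose proof (Cmod_ge_0 (F z + Cconj (F 0%C))). nra.
Qed.

Lemma ln_le_minus_1 x : 0 < x -> ln x <= x - 1.
Proof.
  intros Hx. pose proof (exp_ineq1_le (ln x)) as H. rewrite exp_ln in H; lra.
Qed.

(** Hopf's boundary lemma for the positive harmonic function [ln |g|]: at distance
    [t R0] from [p] on the radius, Harnack bounds it below by [t / 2] times its value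
    at the centre, and the derivative of [g] at [p] bounds it above by about
    [K t R0]. *)
Lemma touching_disc (g : C -> C) (z p l : C) (R0 K : R) :
  hol (shift g z) R0 -> Cmod (p - z) = R0 -> 0 < R0 ->
  (forall w, Cmod (w - z) < R0 -> 1 < Cmod (g w)) -> Cmod (g p) <= 1 ->
  cderive g p l -> Cmod l <= K -> ln (Cmod (g z)) <= 2 * K * R0.
Proof.
  intros Hg Hp HR0 Hbig Hgp Hl HK.
  set (f := shift g z).
  assert (Hbig' : forall w, Cmod w < R0 -> 1 < Cmod (f w)).
  { intros w Hw. apply Hbig. replace (z + w - z)%C with w by ring. auto. }
  destruct (hol_log f R0) as [L [L0 [HL E]]]; auto.
  { intros w Hw. apply Cmod_gt_0. specialize (Hbig' w Hw). lra. }
  set (u0 := ln (Cmod (f 0%C))).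
  assert (Hf0 : 1 < Cmod (f 0%C)) by (apply Hbig'; rewrite Cmod_0; auto).
  set (F := fun w => (L w + u0)%C).
  assert (HReF : forall w, Cmod w < R0 -> Re (F w) = ln (Cmod (f w))).
  { intros w Hw. rewrite (E w Hw), Cmod_mult, Cmod_Cexp, ln_mult, ln_exp by (lra || apply exp_pos).
    unfold F. rewrite re_plus, re_RtoC. fold u0. ring. }
  assert (HF : hol F R0) by (apply hol_plus; auto; apply hol_const).
  assert (HFpos : forall w, Cmod w < R0 -> 0 < Re (F w)).
  { intros w Hw. rewrite HReF by auto. rewrite <- ln_1. apply ln_increasing; [lra|]. auto. }
  replace (g z) with (f 0%C) by (unfold f, shift; f_equal; ring). fold u0.
  assert (Hu0 : Re (F 0%C) = u0) by (apply HReF; rewrite Cmod_0; auto).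
  apply le_epsilon. intros eps He.
  set (e := eps / (2 * R0)). assert (He0 : 0 < e) by (apply Rdiv_lt_0_compat; lra).
  destruct (proj1 (cderive_eps g p l) Hl e He0) as [d [Hd Hdd]].
  set (t := Rmin (1 / 2) (d / (2 * R0))).
  assert (Ht0 : 0 < t) by (apply Rmin_pos; [lra|apply Rdiv_lt_0_compat; lra]).
  assert (Ht1 : t <= 1 / 2) by apply Rmin_l.
  assert (Ht2 : t * R0 < d).
  { apply Rle_lt_trans with (d / (2 * R0) * R0); [apply Rmult_le_compat_r; [lra|apply Rmin_r]|].
    replace (d / (2 * R0) * R0) with (d / 2) by (field; lra). lra. }
  set (w := ((1 - t)%R * (p - z))%C).
  assert (Hw : Cmod w = (1 - t) * R0).
  { unfold w. rewrite Cmod_mult, Hp, Cmod_R, Rabs_pos_eq; lra. }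
  assert (HwR : Cmod w < R0) by nra.
  assert (Ewp : (z + w - p = - (t * (p - z)))%C) by (unfold w; rewrite RtoC_minus; ring).
  assert (Hwp : Cmod (z + w - p) = t * R0).
  { rewrite Ewp, Cmod_opp, Cmod_mult, Hp, Cmod_R, Rabs_pos_eq; lra. }
  specialize (Hdd (z + w)%C ltac:(lra)). rewrite Hwp in Hdd.
  pose proof (harnack F R0 w HF HFpos HwR) as Hk.
  rewrite Hu0, HReF, Hw in Hk by auto.
  pose proof (ln_le_minus_1 (Cmod (f w))) as Hln. specialize (Hbig' w HwR).
  specialize (Hln ltac:(lra)).
  assert (Hfw : Cmod (f w) <= 1 + (K + e) * (t * R0)).
  { unfold f, shift.
    replace (g (z + w)%C) with (g p + ((g (z + w)%C - g p - l * (z + w - p)) + l * (z + w - p)))%C by ring.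
    eapply Rle_trans; [apply Cmod_triangle|]. eapply Rle_trans; [apply Rplus_le_compat_l, Cmod_triangle|].
    rewrite Cmod_mult, Hwp. assert (0 < t * R0) by nra. nra. }
  assert (HtR : 0 < t * R0) by nra.
  replace (R0 - (1 - t) * R0) with (t * R0) in Hk by ring.
  replace (R0 + (1 - t) * R0) with ((2 - t) * R0) in Hk by ring.
  assert (Hlnpos : 0 <= ln (Cmod (f w))).
  { rewrite <- ln_1. apply ln_le; lra. }
  assert (H1 : u0 * (t * R0) <= (K + e) * (t * R0) * (2 * R0)).
  { eapply Rle_trans; [exact Hk|].
    apply Rmult_le_compat; [auto|nra|lra|nra]. }
  assert (H2 : u0 <= (K + e) * (2 * R0)).
  { apply (Rmult_le_reg_r (t * R0)); auto. lra. }
  replace eps with (e * (2 * R0)) by (unfold e; field; lra). lra.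
Qed.

(** * Cluster points along filters and the growth lemma *)

(** Subsequences are replaced by finer and finer proper filters on the indices. *)
Definition Flim (Phi : (nat -> Prop) -> Prop) (x : nat -> C) (l : C) : Prop :=
  forall eps, 0 < eps -> Phi (fun n => Cmod (x n - l) < eps).

(** The filter generated by [Phi] and the sets of indices at which [x] is close
    to [l]. *)
Definition refine (Phi : (nat -> Prop) -> Prop) (x : nat -> R) (l : R) : (nat -> Prop) -> Prop :=
  fun P => exists eps, 0 < eps /\ Phi (fun n => Rabs (x n - l) < eps -> P n).

(** [l] is the upper limit of [x] along [Phi]: the supremum of the [t] for which
    [x n < t] is not a [Phi]-event. *)
Lemma refine_cluster (Phi : (nat -> Prop) -> Prop) (x : nat -> R) (B : R) :
  ProperFilter Phi -> Phi (fun n => Rabs (x n) <= B) ->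
  exists l, ProperFilter (refine Phi x l).
Proof.
  intros HP HB.
  assert (HFalse : ~ Phi (fun _ => False)) by (intros H; destruct (filter_ex _ H); auto).
  destruct (completeness (fun t => ~ Phi (fun n => x n < t))) as [l [Hl1 Hl2]].
  - exists (B + 1). intros t Ht. apply Rnot_lt_le. intros Hlt. apply Ht.
    revert HB. apply filter_imp. intros n Hn. apply Rabs_le_between in Hn. lra.
  - exists (- B - 1). intros H. apply HFalse.
    generalize (filter_and _ _ HB H). apply filter_imp. intros n [Hn Hn'].
    apply Rabs_le_between in Hn. lra.
  - exists l. constructor.
    + intros P [eps [He H]].
      apply NNPP. intros N.
      assert (H1 : Phi (fun n => eps <= Rabs (x n - l))).
      { revert H. apply filter_imp. intros n Hn. apply Rnot_lt_le. intros Hlt.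
        apply N. exists n. auto. }
      assert (H2 : Phi (fun n => x n < l + eps)).
      { apply NNPP. intros N2. specialize (Hl1 _ N2). lra. }
      assert (H3 : exists t, l - eps < t /\ ~ Phi (fun n => x n < t)).
      { apply NNPP. intros N3. assert (l <= l - eps); [|lra].
        apply Hl2. intros t Ht. apply Rnot_lt_le. intros Hlt. apply N3. exists t; auto. }
      destruct H3 as [t [Ht HN]]. apply HN.
      generalize (filter_and _ _ H1 H2). apply filter_imp. intros n [A1 A2].
      apply Rnot_le_lt. intros A3. apply (Rlt_irrefl eps).
      eapply Rle_lt_trans; [exact A1|]. apply Rabs_lt_between. lra.
    + constructor.
      * exists 1. split; [lra|]. apply filter_forall. auto.
      * intros P Q [e1 [He1 H1]] [e2 [He2 H2]]. exists (Rmin e1 e2).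
        split; [apply Rmin_pos; auto|].
        generalize (filter_and _ _ H1 H2). apply filter_imp. intros n [A1 A2] A.
        apply Rmin_Rgt_l in A. split; [apply A1|apply A2]; apply A.
      * intros P Q HPQ [e [He H]]. exists e. split; auto. revert H.
        apply filter_imp. auto.
Qed.

Lemma refine_finer Phi x l P : Filter Phi -> Phi P -> refine Phi x l P.
Proof. intros HF H. exists 1. split; [lra|]. revert H. apply filter_imp. auto. Qed.

Lemma cluster_filter (Phi : (nat -> Prop) -> Prop) (x : nat -> C) (B : R) :
  ProperFilter Phi -> Phi (fun n => Cmod (x n) <= B) ->
  exists l Psi, ProperFilter Psi /\ (forall P, Phi P -> Psi P) /\ Flim Psi x l.
Proof.
  intros HP HB.
  destruct (refine_cluster Phi (fun n => Re (x n)) B HP) as [a HPa].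
  { revert HB. apply filter_imp. intros n Hn. pose proof (re_le_Cmod (x n)). lra. }
  set (Pa := refine Phi (fun n => Re (x n)) a) in *.
  destruct (refine_cluster Pa (fun n => Im (x n)) B HPa) as [b HPb].
  { apply refine_finer; [apply HP|]. revert HB. apply filter_imp. intros n Hn.
    pose proof (im_le_Cmod (x n)). lra. }
  exists (a, b), (refine Pa (fun n => Im (x n)) b). split; auto. split.
  - intros P H. apply refine_finer; [apply HPa|]. apply refine_finer; [apply HP|auto].
  - intros eps He. exists (eps / 2). split; [lra|]. exists (eps / 2). split; [lra|].
    apply filter_forall. intros n H1 H2.
    eapply Rle_lt_trans; [apply Cmod_le_Re_Im|].
    change (Rabs (Re (x n) - a) + Rabs (Im (x n) - b) < eps). lra.
Qed.

(** A minimising sequence has a cluster point. *)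
Lemma nearest_point (g : C -> C) (z p0 : C) :
  (forall w, ccont g w) -> Cmod (g p0) <= 1 ->
  exists p, Cmod (g p) <= 1 /\ forall w, Cmod (g w) <= 1 -> Cmod (p - z) <= Cmod (w - z).
Proof.
  intros Hg Hp0.
  destruct (completeness (fun y => exists p, Cmod (g p) <= 1 /\ y = - Cmod (p - z)))
    as [m [Hm1 Hm2]].
  - exists 0. intros y [p [_ ->]]. pose proof (Cmod_ge_0 (p - z)). lra.
  - exists (- Cmod (p0 - z)), p0. auto.
  - assert (Hx : forall n : nat, exists p, Cmod (g p) <= 1 /\ Cmod (p - z) <= - m + / (INR n + 1)).
    { intros n. pose proof (pos_INR n). assert (0 < / (INR n + 1)) by (apply Rinv_0_lt_compat; lra).
      apply NNPP. intros N. assert (m <= m - / (INR n + 1)); [|lra].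
      apply Hm2. intros y [p [Hp ->]]. apply Rnot_lt_le. intros Hlt. apply N. exists p.
      split; auto. lra. }
    apply choice in Hx. destruct Hx as [x Hx].
    destruct (cluster_filter eventually x (Cmod z + (- m + 1))) as [p [Psi [HPsi [Hfin Hlim]]]].
    { apply eventually_filter. }
    { exists O. intros n _. destruct (Hx n) as [_ H].
      pose proof (pos_INR n).
      assert (H1 : / (INR n + 1) <= 1) by (rewrite <- Rinv_1; apply Rinv_le_contravar; lra).
      pose proof (Cmod_le_add_sub (x n) z). lra. }
    exists p. split.
    + apply le_epsilon. intros eps He. destruct (Hg p eps He) as [d [Hd Hdd]].
      destruct (filter_ex _ (Hlim d Hd)) as [n Hn]. specialize (Hdd _ Hn).
      destruct (Hx n) as [H _]. pose proof (Cmod_le_add_sub (g p) (g (x n))).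
      rewrite Cmod_sub_sym in Hdd. lra.
    + intros w Hw. apply Rle_trans with (- m).
      * apply le_epsilon. intros eps He.
        assert (He2 : 0 < eps / 2) by lra.
        assert (Hev : Psi (fun n => / (INR n + 1) < eps / 2)).
        { apply Hfin. destruct (nfloor_ex (2 / eps)) as [N [_ HN]]; [apply Rdiv_le_0_compat; lra|].
          exists N. intros n Hn. apply le_INR in Hn.
          replace (eps / 2) with (/ (2 / eps)) by (field; lra).
          assert (0 < 2 / eps) by (apply Rdiv_lt_0_compat; lra).
          apply Rinv_lt_contravar; [apply Rmult_lt_0_compat; lra|lra]. }
        destruct (filter_ex _ (filter_and _ _ (Hlim _ He2) Hev)) as [n [A1 A2]].
        destruct (Hx n) as [_ H]. pose proof (Cmod_sub_tri p (x n) z).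
        rewrite (Cmod_sub_sym p (x n)) in H0. lra.
      * assert (- Cmod (w - z) <= m) by (apply Hm1; exists w; auto). lra.
Qed.

Lemma entire_of_cderive (f f' : C -> C) : (forall z, cderive f z (f' z)) -> entire f.
Proof. intros H z. exists (f' z). apply H. Qed.

Lemma entire_derive (f f' : C -> C) : (forall z, cderive f z (f' z)) -> entire f'.
Proof. intros H z. apply (hol_derive f f' p_infty); [intros w _; apply H|simpl; auto]. Qed.

Lemma entire_hol f R0 : entire f -> hol f R0.
Proof. intros H z _. apply H. Qed.

Lemma entire_shift f z : entire f -> entire (shift f z).
Proof. intros H w. destruct (H (z + w)%C) as [l Hl]. exists l. apply cderive_shift; auto. Qed.

(** [p0] belongs to the set [|g| <= 1], so the nearest point of that set to [z] is
    at distance at most [Cmod (z - p0)] from [z]; this keeps it inside the disc of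
    radius [L] where the derivative is controlled.  The constants are absolute, so
    that the lemma also bounds whole families of functions. *)
Theorem growth_lemma (g : C -> C) (L K : R) (p0 : C) :
  entire g -> Cmod (g p0) <= 1 -> 0 <= K ->
  (forall z l, Cmod (z - p0) <= L -> Cmod (g z) <= 1 -> cderive g z l -> Cmod l <= K) ->
  forall z, Cmod (z - p0) <= L / 2 -> Cmod (g z) <= exp (2 * K * Cmod (z - p0)).
Proof.
  intros Hg H0 HK Hb z Hz. pose proof (Cmod_ge_0 (z - p0)) as Pz.
  destruct (Rle_dec (Cmod (g z)) 1) as [H1|H1].
  - apply Rle_trans with 1; auto. rewrite <- exp_0. apply exp_le. 
    apply Rmult_le_pos; auto. lra.
  - apply Rnot_le_lt in H1.
    destruct (nearest_point g z p0) as [p [Hp Hmin]]; auto.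
    { intros w. destruct (Hg w) as [l Hl]. eapply cderive_ccont; eauto. }
    assert (HR : Cmod (p - z) <= Cmod (z - p0)) by (rewrite (Cmod_sub_sym z); auto).
    assert (Hne : p <> z) by (intros ->; lra).
    assert (HR0 : 0 < Cmod (p - z)) by (apply Cmod_gt_0, Cminus_eq_contra; auto).
    destruct (Hg p) as [l Hl].
    assert (Hln : ln (Cmod (g z)) <= 2 * K * Cmod (p - z)).
    { apply (touching_disc g z p l); auto.
      - apply entire_hol, entire_shift; auto.
      - intros w Hw. apply Rnot_le_lt. intros Hle. specialize (Hmin w Hle). lra.
      - apply (Hb p); auto. pose proof (Cmod_sub_tri p z p0). lra. }
    rewrite <- (exp_ln (Cmod (g z))) by lra. apply exp_le.
    eapply Rle_trans; [exact Hln|]. apply Rmult_le_compat_l; lra.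
Qed.

(** * Montel's theorem *)

Definition finer (Phi Psi : (nat -> Prop) -> Prop) : Prop := forall P, Phi P -> Psi P.

(** The union of an increasing sequence of proper filters, the [k]-th making the
    [k]-th sequence converge, takes the place of a diagonal subsequence. *)
Theorem diagonal_filter (x : nat -> nat -> C) :
  (forall k, exists B, eventually (fun n => Cmod (x n k) <= B)) ->
  exists Psi, ProperFilter Psi /\ finer eventually Psi /\
    forall k, exists l, Flim Psi (fun n => x n k) l.
Proof.
  intros HB.
  set (St := {Phi : (nat -> Prop) -> Prop | ProperFilter Phi /\ finer eventually Phi}).
  assert (Hstep : forall (k : nat) (Phi : St), exists Phi' : St,
    finer (proj1_sig Phi) (proj1_sig Phi') /\
    exists l, Flim (proj1_sig Phi') (fun n => x n k) l).
  { intros k [Phi [HP HF]]. destruct (HB k) as [B Hk].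
    destruct (cluster_filter Phi (fun n => x n k) B HP (HF _ Hk)) as [l [Psi [H1 [H2 H3]]]].
    exists (exist _ Psi (conj H1 (fun P HP0 => H2 P (HF P HP0)))). split; [exact H2|].
    exists l; exact H3. }
  set (step := fun k Phi => proj1_sig (constructive_indefinite_description _ (Hstep k Phi))).
  assert (Hs : forall k Phi, finer (proj1_sig Phi) (proj1_sig (step k Phi)) /\
     exists l, Flim (proj1_sig (step k Phi)) (fun n => x n k) l).
  { intros k Phi. exact (proj2_sig (constructive_indefinite_description _ (Hstep k Phi))). }
  set (Phi0 := exist _ eventually (conj eventually_filter (fun P HP => HP)) : St).
  set (Fn := fix Fn k : St := match k with O => Phi0 | S k => step k (Fn k) end).
  assert (Hmono : forall k j, finer (proj1_sig (Fn k)) (proj1_sig (Fn (k + j)%nat))).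
  { intros k. induction j as [|j IH]; [rewrite Nat.add_0_r; intros P; auto|].
    rewrite Nat.add_succ_r. intros P HP. apply (proj1 (Hs (k + j)%nat (Fn (k + j)%nat))), IH, HP. }
  assert (HPF : forall k, ProperFilter (proj1_sig (Fn k))).
  { intros k. apply (proj2_sig (Fn k)). }
  exists (fun P => exists k, proj1_sig (Fn k) P). split; [|split].
  - constructor.
    + intros P [k Hk]. destruct (HPF k) as [He _]. apply He; auto.
    + constructor.
      * exists O. simpl. exists O; auto.
      * intros P Q [k Hk] [j Hj]. exists (k + j)%nat.
        destruct (HPF (k + j)%nat) as [_ [_ Hand _]]. apply Hand.
        -- apply Hmono; auto.
        -- rewrite Nat.add_comm. apply Hmono; auto.
      * intros P Q HPQ [k Hk]. exists k. destruct (HPF k) as [_ [_ _ Himp]].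
        eapply Himp; eauto.
  - intros P HP. exists O. exact HP.
  - intros k. destruct (Hs k (Fn k)) as [_ [l Hl]]. exists l.
    intros eps He. exists (S k). apply Hl; auto.
Qed.

Definition Ucv (Psi : (nat -> Prop) -> Prop) (G : nat -> C -> C) (g : C -> C) : Prop :=
  forall r eps, 0 < r -> 0 < eps ->
    Psi (fun n => forall z, Cmod z <= r -> Cmod (G n z - g z) <= eps).

Lemma Csum_close (Psi : (nat -> Prop) -> Prop) (c : nat -> nat -> C) (a : nat -> C) r K :
  ProperFilter Psi -> 0 < r -> (forall k, Flim Psi (fun n => c n k) (a k)) ->
  forall eps, 0 < eps -> Psi (fun n => forall z, Cmod z <= r ->
    Cmod (Csum (fun k => c n k * z ^ k)%C K - Csum (fun k => a k * z ^ k)%C K) <= eps).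
Proof.
  intros HP Hr Hlim.
  assert (Hterm : forall k eps, 0 < eps -> Psi (fun n => forall z, Cmod z <= r ->
      Cmod (c n k * z ^ k - a k * z ^ k) <= eps)).
  { intros k eps He. assert (Pr : 0 < r ^ k) by (apply pow_lt; auto).
    assert (He' : 0 < eps / r ^ k) by (apply Rdiv_lt_0_compat; auto).
    generalize (Hlim k _ He'). apply filter_imp. intros n Hn z Hz.
    replace (c n k * z ^ k - a k * z ^ k)%C with ((c n k - a k) * z ^ k)%C by ring.
    rewrite Cmod_mult, Cmod_pow.
    replace eps with (eps / r ^ k * r ^ k) by (field; lra).
    apply Rmult_le_compat; [apply Cmod_ge_0|apply pow_le, Cmod_ge_0|lra|].
    apply pow_incr. split; [apply Cmod_ge_0|auto]. }
  induction K as [|K IH]; intros eps He.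
  - generalize (Hterm O eps He). apply filter_imp. intros n Hn z Hz. rewrite !Csum_0. auto.
  - assert (He2 : 0 < eps / 2) by lra.
    generalize (filter_and _ _ (IH _ He2) (Hterm (S K) _ He2)). apply filter_imp.
    intros n [A1 A2] z Hz. rewrite !Csum_S.
    match goal with |- Cmod (?u + ?v - (?s + ?t)) <= _ =>
      replace (u + v - (s + t))%C with ((u - s) + (v - t))%C by ring end.
    eapply Rle_trans; [apply Cmod_triangle|].
    specialize (A1 z Hz). specialize (A2 z Hz). lra.
Qed.

(** Along a filter on which all Taylor coefficients converge, the [G n] are
    uniformly close, on each disc, to a polynomial that does not depend on [n].  So
    cluster values chosen point by point form a uniform limit. *)
Theorem montel (G : nat -> C -> C) (B : R -> R) :
  (forall n, entire (G n)) ->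
  (forall r, eventually (fun n => forall z, Cmod z <= r -> Cmod (G n z) <= B r)) ->
  exists Psi g, ProperFilter Psi /\ finer eventually Psi /\ entire g /\ Ucv Psi G g.
Proof.
  intros HG HB.
  assert (Hc : exists c : nat -> nat -> C, forall n, taylor_at_0 (G n) p_infty (c n)).
  { apply (choice (fun n c => taylor_at_0 (G n) p_infty c)). intros n.
    apply taylor; [simpl; auto|]. apply entire_hol; auto. }
  destruct Hc as [c Hc].
  destruct (diagonal_filter c) as [Psi [HP [Hfin Hlim]]].
  { intros k. exists (B 1 / 1 ^ k). generalize (HB 1). apply filter_imp. intros n Hn.
    destruct (Hc n) as (_ & _ & H). apply (H 1 (B 1)); [lra|simpl; auto|].
    intros w Hw. apply Hn. lra. }
  apply choice in Hlim. destruct Hlim as [a Ha].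
  assert (HT : forall r eps, 0 < r -> 0 < eps -> exists T : C -> C,
     Psi (fun n => forall z, Cmod z <= r -> Cmod (G n z - T z) <= eps)).
  { intros r eps Hr He. set (M := B (2 * r)).
    destruct (exists_pow2_lt M (eps / 2)) as [K HK]; [lra|].
    exists (fun z => Csum (fun k => a k * z ^ k)%C K).
    assert (He2 : 0 < eps / 2) by lra.
    generalize (filter_and _ _ (Hfin _ (HB (2 * r))) (Csum_close Psi c a r K HP Hr Ha _ He2)).
    apply filter_imp. intros n [A1 A2] z Hz.
    destruct (Hc n) as (_ & _ & H).
    destruct (H (2 * r) M) as [_ H']; [lra|simpl; auto|intros w Hw; apply A1; lra|].
    specialize (H' z K ltac:(lra)). specialize (A2 z Hz).
    assert (HM : 0 <= M).
    { eapply Rle_trans; [apply (Cmod_ge_0 (G n 0%C))|]. apply A1. rewrite Cmod_0; lra. }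
    pose proof (Cmod_ge_0 z) as Pz.
    assert (Hq0 : 0 <= Cmod z / (2 * r)) by (apply Rdiv_le_0_compat; lra).
    assert (Hq1 : Cmod z / (2 * r) <= 1 / 2) by (apply Rle_div_l; lra).
    assert (H1 : M * (Cmod z / (2 * r)) ^ S K / (1 - Cmod z / (2 * r)) <= M / 2 ^ K).
    { apply Rle_div_l; [lra|].
      apply Rle_trans with (M * (1 / 2) ^ S K).
      - apply Rmult_le_compat_l; auto. apply pow_incr; lra.
      - replace (M * (1 / 2) ^ S K) with (M / 2 ^ K * (1 / 2)).
        + apply Rmult_le_compat_l; [apply Rdiv_le_0_compat; auto; apply pow_lt; lra|lra].
        + simpl. unfold Rdiv. rewrite Rmult_1_l, pow_inv. ring. }
    eapply Rle_trans; [apply (Cmod_sub_tri _ (Csum (fun k => c n k * z ^ k)%C K))|]. lra. }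
  assert (Hg : exists g : C -> C, forall z, exists Pz, ProperFilter Pz /\ finer Psi Pz /\
     Flim Pz (fun n => G n z) (g z)).
  { apply (choice (fun z l => exists Pz, ProperFilter Pz /\ finer Psi Pz /\
     Flim Pz (fun n => G n z) l)). intros z.
    destruct (cluster_filter Psi (fun n => G n z) (B (Cmod z)) HP) as [l [Pz [H1 [H2 H3]]]].
    - apply Hfin. generalize (HB (Cmod z)). apply filter_imp. intros n Hn. apply Hn. lra.
    - exists l, Pz. auto. }
  destruct Hg as [g Hg].
  assert (HU : Ucv Psi G g).
  { intros r eps Hr He. destruct (HT r (eps / 2) Hr) as [T HTn]; [lra|].
    assert (HgT : forall z, Cmod z <= r -> Cmod (T z - g z) <= eps / 2).
    { intros z Hz. apply le_epsilon. intros e He'.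
      destruct (Hg z) as [Pz [H1 [H2 H3]]].
      destruct (filter_ex _ (filter_and _ _ (H2 _ HTn) (H3 e He'))) as [n [A1 A2]].
      specialize (A1 z Hz). rewrite Cmod_sub_sym in A1.
      pose proof (Cmod_sub_tri (T z) (G n z) (g z)). lra. }
    revert HTn. apply filter_imp. intros n Hn z Hz.
    specialize (Hn z Hz). specialize (HgT z Hz).
    pose proof (Cmod_sub_tri (G n z) (T z) (g z)). lra. }
  exists Psi, g. split; [auto|split; [auto|split; [|auto]]].
  intros z. apply (hol_of_approx g p_infty); [|simpl; auto].
  intros r eps Hr _ He. destruct (filter_ex _ (HU r eps Hr He)) as [n Hn].
  exists (G n). split; [apply entire_hol; auto|]. intros w Hw. apply Hn. lra.
Qed.

(** Cauchy's estimate with radius 1 for [G n - g]. *)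
Lemma Ucv_derive Psi G g G' g' :
  ProperFilter Psi -> Ucv Psi G g ->
  (forall n z, cderive (G n) z (G' n z)) -> (forall z, cderive g z (g' z)) -> Ucv Psi G' g'.
Proof.
  intros HP HU HG Hg r eps Hr He.
  assert (Hr1 : 0 < r + 1) by lra.
  generalize (HU (r + 1) eps Hr1 He). apply filter_imp. intros n Hn z Hz.
  replace eps with (eps / 1) by field.
  apply (cauchy_estimate (fun w => G n w - g w)%C z _ 1 eps p_infty); [|lra|simpl; auto| |].
  - apply entire_hol, entire_shift. intros w. eexists. apply cderive_minus; eauto.
  - intros w Hw. unfold shift. apply Hn. pose proof (Cmod_triangle z w). lra.
  - apply cderive_minus; auto.
Qed.

(** * Zeros of limits *)

Lemma Csum_all_0 (a : nat -> C) n : (forall k, (k <= n)%nat -> a k = 0%C) -> Csum a n = 0%C.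
Proof.
  induction n as [|n IH]; intros H; [rewrite Csum_0; auto|].
  rewrite Csum_S, IH, H by (try (intros; apply H); lia). ring.
Qed.

(** [m] is the index of the first nonzero Taylor coefficient, whose term dominates
    the remainder near 0.  If all coefficients vanish, the remainder estimate makes
    [f] vanish on every disc. *)
Lemma lower_bound_at_zero f : entire f -> (exists z, f z <> 0%C) ->
  exists (m : nat) (c d : R), 0 < c /\ 0 < d /\ forall w, Cmod w < d -> c * Cmod w ^ m <= Cmod (f w).
Proof.
  intros Hf [z0 Hz0].
  assert (HfR : hol f p_infty) by (apply entire_hol; auto).
  destruct (taylor f p_infty) as [c [_ [_ HT]]]; [simpl; auto|auto|].
  assert (Hex : exists k, c k <> 0%C).
  { apply NNPP. intros N.
    assert (Hall : forall k, c k = 0%C).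
    { intros k. apply NNPP. intros Nk. apply N. exists k; auto. }
    apply Hz0. apply Cmod_eq_0.
    apply Rle_antisym; [|apply Cmod_ge_0]. apply le_epsilon. intros eps He.
    pose proof (Cmod_ge_0 z0) as Pz. set (r := 2 * Cmod z0 + 1).
    destruct (hol_bounded f p_infty r HfR) as [M [HM0 HM]]; [unfold r; lra|simpl; auto|].
    destruct (HT r M) as [_ HT']; [unfold r; lra|simpl; auto|intros w Hw; apply HM; lra|].
    destruct (exists_pow2_lt (2 * M) eps He) as [n Hn].
    specialize (HT' z0 n ltac:(unfold r; lra)).
    rewrite (Csum_all_0 _ n) in HT' by (intros; rewrite Hall; ring).
    replace (f z0 - 0)%C with (f z0) in HT' by ring.
    assert (Hq0 : 0 <= Cmod z0 / r) by (apply Rdiv_le_0_compat; unfold r; lra).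
    assert (Hq1 : Cmod z0 / r <= 1 / 2) by (apply Rle_div_l; unfold r; lra).
    assert (H1 : M * (Cmod z0 / r) ^ S n / (1 - Cmod z0 / r) <= 2 * M / 2 ^ n).
    { apply Rle_div_l; [lra|].
      apply Rle_trans with (M * (1 / 2) ^ S n).
      - apply Rmult_le_compat_l; auto. apply pow_incr; lra.
      - replace (M * (1 / 2) ^ S n) with (2 * M / 2 ^ n * (1 / 4)).
        + apply Rmult_le_compat_l; [apply Rdiv_le_0_compat; [lra|apply pow_lt; lra]|lra].
        + replace (1 / 2) with (/ 2) by field. rewrite pow_inv. simpl. field. apply pow_nonzero; lra. }
    lra. }
  assert (Hleast : exists m, c m <> 0%C /\ forall k, (k < m)%nat -> c k = 0%C).
  { destruct Hex as [k Hk]. revert Hk. induction k as [k IH] using lt_wf_ind. intros Hk.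
    destruct (classic (exists j, (j < k)%nat /\ c j <> 0%C)) as [[j [Hj Hcj]]|N].
    - apply (IH j); auto.
    - exists k. split; auto. intros j Hj. apply NNPP. intros Nj. apply N. exists j; auto. }
  destruct Hleast as [m [Hm Hlow]].
  destruct (hol_bounded f p_infty 1 HfR) as [M [HM0 HM]]; [lra|simpl; auto|].
  destruct (HT 1 M) as [_ HT']; [lra|simpl; auto|intros w Hw; apply HM; lra|].
  pose proof (proj1 (Cmod_gt_0 _) Hm) as Pc. set (u := Cmod (c m)) in *.
  assert (Hd : 0 < u / (4 * M + 1)) by (apply Rdiv_lt_0_compat; lra).
  exists m, (u / 2), (Rmin (1 / 2) (u / (4 * M + 1))).
  split; [lra|]. split; [apply Rmin_pos; lra|].
  intros w Hw. apply Rmin_Rgt_l in Hw. destruct Hw as [W1 W2].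
  apply Rgt_lt in W2. apply Rlt_div_r in W2; [|lra].
  specialize (HT' w m ltac:(lra)).
  assert (Es : Csum (fun k => c k * w ^ k)%C m = (c m * w ^ m)%C).
  { destruct m as [|m]; [rewrite Csum_0; auto|].
    rewrite Csum_S, Csum_all_0; [ring|]. intros k Hk. rewrite Hlow by lia. ring. }
  rewrite Es in HT'. pose proof (Cmod_ge_0 w) as Pw.
  replace (Cmod w / 1) with (Cmod w) in HT' by field.
  pose proof (Cmod_le_add_sub (c m * w ^ m) (f w)) as B. rewrite (Cmod_sub_sym _ (f w)) in B.
  rewrite Cmod_mult, Cmod_pow in B. fold u in B.
  assert (Pm : 0 <= Cmod w ^ m) by (apply pow_le; auto).
  assert (H1 : M * Cmod w ^ S m / (1 - Cmod w) <= 2 * M * Cmod w * Cmod w ^ m).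
  { apply Rle_div_l; [lra|]. simpl.
    replace (M * (Cmod w * Cmod w ^ m)) with (2 * M * Cmod w * Cmod w ^ m * (1 / 2)) by field.
    apply Rmult_le_compat_l; [|lra]. repeat apply Rmult_le_pos; auto; lra. }
  assert (2 * M * Cmod w * Cmod w ^ m <= u / 2 * Cmod w ^ m).
  { apply Rmult_le_compat_r; auto. lra. }
  lra.
Qed.

(** Otherwise the maximum principle applies to [1 / f]. *)
Lemma zero_in_disc f r mu :
  entire f -> 0 < r -> 0 < mu -> (forall w, Cmod w = r -> mu <= Cmod (f w)) ->
  Cmod (f 0%C) < mu -> exists w, Cmod w < 2 * r /\ f w = 0%C.
Proof.
  intros Hf Hr Hmu Hc H0. apply NNPP. intros N.
  assert (Hn : forall w, Cmod w < 2 * r -> f w <> 0%C).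
  { intros w Hw E. apply N. exists w; auto. }
  assert (Hb : Cmod (/ f 0%C) <= / mu).
  { apply (max_modulus_disc (fun w => / f w)%C (2 * r) r); auto.
    - apply hol_inv; auto. apply entire_hol; auto.
    - simpl; lra.
    - intros w Hw. rewrite Cmod_inv by (apply Hn; lra).
      apply Rinv_le_contravar; auto.
    - rewrite Cmod_0; lra. }
  assert (N0 : f 0%C <> 0%C) by (apply Hn; rewrite Cmod_0; lra).
  rewrite Cmod_inv in Hb by auto.
  pose proof (proj1 (Cmod_gt_0 _) N0) as P0.
  assert (/ mu < / Cmod (f 0%C)) by (apply Rinv_lt_contravar; auto; apply Rmult_lt_0_compat; auto).
  lra.
Qed.

(** On a small circle about [z0] the limit is bounded away from 0, while at the
    centre [H n] is close to 0. *)
Theorem hurwitz (Psi : (nat -> Prop) -> Prop) (H : nat -> C -> C) (h : C -> C) z0 :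
  ProperFilter Psi -> (forall n, entire (H n)) -> entire h -> Ucv Psi H h ->
  (exists z, h z <> 0%C) -> h z0 = 0%C ->
  forall eps, 0 < eps -> Psi (fun n => exists w, Cmod (w - z0) < eps /\ H n w = 0%C).
Proof.
  intros HP HH Hh HU [z1 Hz1] H0 eps He.
  destruct (lower_bound_at_zero (shift h z0)) as [m [c [d [Hc [Hd Hlow]]]]].
  { apply entire_shift; auto. }
  { exists (z1 - z0)%C. unfold shift. replace (z0 + (z1 - z0))%C with z1 by ring. auto. }
  set (r := Rmin d eps / 2).
  assert (Hr : 0 < r) by (unfold r; pose proof (Rmin_pos d eps Hd He); lra).
  assert (Hrd : r < d) by (unfold r in *; pose proof (Rmin_l d eps); lra).
  assert (Hre : 2 * r <= eps) by (unfold r in *; pose proof (Rmin_r d eps); lra).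
  set (mu := c * r ^ m).
  assert (Hmu : 0 < mu) by (apply Rmult_lt_0_compat; auto; apply pow_lt; auto).
  pose proof (Cmod_ge_0 z0) as Pz.
  assert (Hrr : 0 < Cmod z0 + r) by lra. assert (Hm4 : 0 < mu / 4) by lra.
  generalize (HU _ _ Hrr Hm4). apply filter_imp. intros n Hn.
  destruct (zero_in_disc (shift (H n) z0) r (mu / 2)) as [w [Hw Ew]]; try lra.
  - apply entire_shift; auto.
  - intros w Hw. unfold shift. specialize (Hlow w ltac:(lra)). rewrite Hw in Hlow. fold mu in Hlow.
    assert (Hzw : Cmod (z0 + w) <= Cmod z0 + r) by (pose proof (Cmod_triangle z0 w); lra).
    specialize (Hn _ Hzw). unfold shift in Hlow.
    pose proof (Cmod_le_add_sub (h (z0 + w)%C) (H n (z0 + w)%C)) as B.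
    rewrite (Cmod_sub_sym (h _)) in B. lra.
  - unfold shift. replace (z0 + 0)%C with z0 by ring. specialize (Hn z0 ltac:(lra)).
    pose proof (Cmod_le_add_sub (H n z0) (h z0)) as B. rewrite H0, Cmod_0 in B.
    rewrite H0 in Hn. lra.
  - exists (z0 + w)%C. split; [|exact Ew]. replace (z0 + w - z0)%C with w by ring. lra.
Qed.

(** * Functions of exponential type *)

Lemma Cexp_surjective (w : C) : w <> 0%C -> exists z, Cexp z = w.
Proof.
  intros Hw. destruct (circ_polar w) as [t [_ E]].
  exists (pt (ln (Cmod w)) (ln (Cmod w) + 2 * PI * Ci)%C t).
  rewrite Cexp_circ, exp_ln; [symmetry; exact E|apply Cmod_gt_0; auto].
Qed.

(** The remainder after the linear term is at most [O(r) (Cmod z / r) ^ 2]; let [r]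
    grow. *)
Lemma linear_of_linear_growth (L : C -> C) (A B : R) :
  entire L -> L 0%C = 0%C -> (forall z, Cmod (L z) <= A + B * Cmod z) ->
  exists alpha, forall z, L z = (alpha * z)%C.
Proof.
  intros HL L0 Hb.
  destruct (taylor L p_infty) as [c [E0 [_ HT]]]; [simpl; auto|apply entire_hol; auto|].
  exists (c 1%nat). intros z. apply Cmod_sub_eq_0.
  apply Rle_antisym; [|apply Cmod_ge_0]. apply le_epsilon. intros eps He. rewrite Rplus_0_l.
  pose proof (Cmod_ge_0 z) as Pz. set (m := Cmod z) in *.
  set (Q := 2 * (Rabs A + Rabs B) * (m * m)).
  pose proof (Rabs_pos A). pose proof (Rabs_pos B).
  assert (HQ : 0 <= Q) by (unfold Q; apply Rmult_le_pos; nra).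
  set (r := 2 * m + 1 + Q / eps).
  assert (HQe : 0 <= Q / eps) by (apply Rdiv_le_0_compat; auto).
  assert (Hr : 1 <= r) by (unfold r; lra).
  destruct (HT r (A + B * r)) as [_ HT']; [lra|simpl; auto|intros w Hw; rewrite <- Hw; auto|].
  specialize (HT' z 1%nat). fold m in HT'. specialize (HT' ltac:(unfold r; lra)).
  rewrite Csum_S, Csum_0, E0, L0 in HT'.
  replace (L z - (0 * z ^ 0 + c 1%nat * z ^ 1))%C with (L z - c 1%nat * z)%C in HT'
    by (simpl; ring).
  eapply Rle_trans; [exact HT'|].
  assert (Hq : m / r <= 1 / 2) by (apply Rle_div_l; unfold r; lra).
  assert (Hq0 : 0 <= m / r) by (apply Rdiv_le_0_compat; lra).
  apply Rle_div_l; [lra|].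
  assert (HA : A + B * r <= (Rabs A + Rabs B) * r).
  { pose proof (Rle_abs A). pose proof (Rle_abs B). nra. }
  assert (H1 : (A + B * r) * (m / r) ^ 2 <= (Rabs A + Rabs B) * r * (m / r) ^ 2).
  { apply Rmult_le_compat_r; auto. apply pow_le; auto. }
  replace ((Rabs A + Rabs B) * r * (m / r) ^ 2) with (Q / r * (1 / 2)) in H1
    by (unfold Q; field; lra).
  eapply Rle_trans; [exact H1|].
  assert (H2 : Q / r <= eps).
  { apply Rle_div_l; [lra|]. apply Rle_trans with (eps * (Q / eps)).
    - right; field; lra.
    - apply Rmult_le_compat_l; unfold r; lra. }
  assert (0 <= Q / r) by (apply Rdiv_le_0_compat; lra).
  nra.
Qed.

(** The logarithm of [h] has real part at most linear, hence is itself of at most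
    linear growth, hence linear. *)
Theorem zero_free_exponential_type (h : C -> C) (A B : R) :
  entire h -> (forall z, h z <> 0%C) -> 0 <= B ->
  (forall z, Cmod (h z) <= exp (A + B * Cmod z)) ->
  exists alpha, forall z, h z = (h 0 * Cexp (alpha * z))%C.
Proof.
  intros Hh Hn HB Hb.
  destruct (hol_log h p_infty) as [L [L0 [HL E]]]; [simpl; auto|apply entire_hol; auto|auto|].
  set (k := ln (Cmod (h 0%C))). set (A' := Rabs (A - k) + 1).
  assert (HA' : 0 < A') by (unfold A'; pose proof (Rabs_pos (A - k)); lra).
  assert (HRe : forall z, Re (L z) < A' + B * Cmod z).
  { intros z. specialize (Hb z). rewrite (E z), Cmod_mult, Cmod_Cexp in Hb by (simpl; auto).
    replace (Cmod (h 0%C)) with (exp k) in Hb by (apply exp_ln, Cmod_gt_0; auto).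
    rewrite <- exp_plus in Hb.
    assert (k + Re (L z) <= A + B * Cmod z).
    { apply Rnot_lt_le. intros Hlt. apply exp_increasing in Hlt. lra. }
    pose proof (Rle_abs (A - k)). unfold A'. lra. }
  destruct (linear_of_linear_growth L (2 * (A' + 2 * B)) (4 * B)) as [al Hal]; auto.
  - intros z. apply HL. simpl; auto.
  - intros z. pose proof (Cmod_ge_0 z) as Pz. set (r := 2 * Cmod z + 2).
    (* the real part of [F] is positive on the disc of radius [r] *)
    set (F := fun w => (RtoC (A' + B * r) - L w)%C).
    assert (HF : Cmod (F z - F 0%C) <= 2 * Re (F 0%C)).
    { apply (caratheodory F r); [| |unfold r; lra|unfold r; lra].
      - apply hol_minus; [apply hol_const|]. apply (hol_le _ _ p_infty); simpl; auto.
      - intros w Hw. unfold F. unfold Cminus. rewrite re_plus, re_opp, re_RtoC.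
        specialize (HRe w). nra. }
    unfold F in HF. rewrite L0 in HF.
    replace (RtoC (A' + B * r) - L z - (RtoC (A' + B * r) - 0))%C with (- L z)%C in HF by ring.
    rewrite Cmod_opp in HF. replace (RtoC (A' + B * r) - 0)%C with (RtoC (A' + B * r)) in HF by ring.
    rewrite re_RtoC in HF. unfold r in HF. lra.
  - exists al. intros z. rewrite <- Hal. apply E. simpl; auto.
Qed.

Lemma constant_of_entire_cderive_0 (h : C -> C) :
  (forall w, cderive h w 0) -> forall z, h z = h 0%C.
Proof. intros H z. apply (constant_of_cderive_0 h p_infty); simpl; auto. Qed.

(** Picard's theorem for functions of exponential type without critical points:
    they are affine or an exponential plus a constant [gam], the only value that can
    be omitted. *)
Theorem picard_exponential_type (g g' : C -> C) (A B : R) (a b : C) :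
  (forall z, cderive g z (g' z)) -> (forall z, g' z <> 0%C) -> 0 <= B ->
  (forall z, Cmod (g z) <= exp (A + B * Cmod z)) ->
  a <> b -> exists z, g z = a \/ g z = b.
Proof.
  intros Hg Hg' HB Hb Hab.
  assert (Hgh : entire g) by (apply (entire_of_cderive g g'); auto).
  assert (Hgh' : entire g')
  by (apply (entire_derive g g'); auto).
  destruct (zero_free_exponential_type g' (A + B) B) as [al Hal]; auto.
  { intros z. replace (exp (A + B + B * Cmod z)) with (exp (A + B + B * Cmod z) / 1) by field.
    apply (cauchy_estimate g z (g' z) 1 _ p_infty); [|lra|simpl; auto| |auto].
    - apply entire_hol, entire_shift; auto.
    - intros w Hw. unfold shift. eapply Rle_trans; [apply Hb|]. apply exp_le.
      pose proof (Cmod_triangle z w). nra. }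
  set (k := g' 0%C) in *. assert (Hk : k <> 0%C) by apply Hg'.
  destruct (Ceq_dec al 0) as [->|Nal].
  - exists ((a - g 0%C) / k)%C. left.
    assert (H := constant_of_entire_cderive_0 (fun z => g z - k * z)%C).
    specialize (H ltac:(intros w; apply (cderive_eq _ _ (g' w - (0 * w + k * 1)))%C;
      [rewrite (Hal w); replace (0 * w)%C with (RtoC 0) by ring; rewrite Cexp_0; ring|
       apply cderive_minus; auto;
       apply (cderive_mult (fun _ => k) (fun w => w)); [apply cderive_const|apply cderive_id]])).
    specialize (H ((a - g 0%C) / k)%C). simpl in H.
    replace (g ((a - g 0%C) / k)%C) with
      ((g ((a - g 0%C) / k)%C - k * ((a - g 0%C) / k)) + (a - g 0%C))%C by (field; auto).
    rewrite H. ring.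
  - assert (H := constant_of_entire_cderive_0 (fun z => g z - k / al * Cexp (al * z))%C).
    assert (Hd : forall w, cderive (fun z => g z - k / al * Cexp (al * z))%C w 0).
    { intros w.
      apply (cderive_eq _ _ (g' w - (0 * Cexp (al * w) + k / al * (Cexp (al * w) * (0 * w + al * 1))))%C).
      - rewrite (Hal w). field; auto.
      - apply cderive_minus; auto.
        apply (cderive_mult (fun _ => k / al)%C (fun w => Cexp (al * w))); [apply cderive_const|].
        apply (cderive_comp Cexp (fun w => al * w)%C); [apply cderive_Cexp|].
        apply (cderive_mult (fun _ => al) (fun w => w)); [apply cderive_const|apply cderive_id]. }
    specialize (H Hd). set (gam := (g 0 - k / al * Cexp (al * 0))%C) in *.
    assert (Hsol : forall v, v <> gam -> exists z, g z = v).
    { intros v Hv. destruct (Cexp_surjective ((v - gam) * al / k)%C) as [u Hu].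
      { apply Cmult_neq_0; [apply Cmult_neq_0; auto; apply Cminus_eq_contra; auto|].
        intros E. apply Hk. replace k with (k * (k * / k))%C by (field; auto). rewrite E. ring. }
      exists (u / al)%C. specialize (H (u / al)%C). cbv beta in H.
      replace (al * (u / al))%C with u in H by (field; auto).
      rewrite Hu in H. 
      replace (g (u / al)%C) with ((g (u / al)%C - k / al * ((v - gam) * al / k)) + (v - gam))%C
        by (field; auto).
      rewrite H. ring. }
    destruct (Ceq_dec a gam) as [Ea|Na].
    + destruct (Hsol b) as [z Hz]; [congruence|]. exists z; auto.
    + destruct (Hsol a Na) as [z Hz]. exists z; auto.
Qed.

Theorem liouville (h : C -> C) (M : R) :
  entire h -> (forall z, Cmod (h z) <= M) -> forall z, h z = h 0%C.
Proof.
  intros Hh Hb. apply constant_of_entire_cderive_0. intros w.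
  destruct (Hh w) as [l Hl]. replace (RtoC 0) with l; auto.
  apply Cmod_eq_0. apply Rle_antisym; [|apply Cmod_ge_0].
  apply le_epsilon. intros eps He. rewrite Rplus_0_l.
  assert (HM : 0 <= M) by (eapply Rle_trans; [apply Cmod_ge_0|apply (Hb w)]).
  assert (HMe : 0 <= M / eps) by (apply Rdiv_le_0_compat; auto).
  eapply Rle_trans.
  - apply (cauchy_estimate h w l (M / eps + 1) M p_infty); [|lra|simpl; auto| |auto].
    + apply entire_hol, entire_shift; auto.
    + intros u _. apply Hb.
  - apply Rle_div_l; [lra|]. replace M with (eps * (M / eps)) at 1 by (field; lra).
    apply Rmult_le_compat_l; lra.
Qed.

(** * Rescaling *)

Lemma entire_cderive f z : entire f -> cderive f z (C_derive f z).
Proof. intros H. apply (C_derive_correct f z 0%C). apply H. Qed.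

Lemma entire_C_derive f : entire f -> entire (C_derive f).
Proof. intros H. apply (entire_derive f). intros z. apply entire_cderive; auto. Qed.

(** Within the part of the unit disc about [w] where [|f| <= 1], choose [z0] so that
    [(1 - Cmod (z0 - w)) |f' z0|] exceeds half of its supremum.  On the disc about [z0]
    with radius half the weight [1 - Cmod (z0 - w)] the weight drops at most by half,
    so [|f'|] is at most four times [|f' z0|] where [|f| <= 1].  The new unit of length
    is [1 / |f' z0|]. *)
Lemma rescaling_point (f f' : C -> C) (w : C) (N : R) :
  entire f' -> 0 < N -> Cmod (f w) <= 1 -> N < Cmod (f' w) ->
  exists (z0 : C) (rho : R), 0 < rho /\ rho * N <= 2 /\ Cmod (f z0) <= 1 /\
    rho * Cmod (f' z0) = 1 /\
    forall z, Cmod z <= N / 4 -> Cmod (f (z0 + rho * z)%C) <= 1 ->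
      rho * Cmod (f' (z0 + rho * z)%C) <= 4.
Proof.
  intros Hf' HN Hw HNw.
  set (E := fun z => Cmod (z - w) <= 1 /\ Cmod (f z) <= 1).
  set (Phi := fun z => (1 - Cmod (z - w)) * Cmod (f' z)).
  assert (HEw : E w).
  { split; auto. replace (w - w)%C with (RtoC 0) by ring. rewrite Cmod_0; lra. }
  assert (HPw : Phi w = Cmod (f' w)).
  { unfold Phi. replace (w - w)%C with (RtoC 0) by ring. rewrite Cmod_0; ring. }
  destruct (hol_bounded (shift f' w) p_infty 1) as [M [HM0 HM]].
  { apply entire_hol, entire_shift; auto. } { lra. } { simpl; auto. }
  destruct (completeness (fun y => exists z, E z /\ y = Phi z)) as [S [HS1 HS2]].
  { exists M. intros y [z [[Hz1 Hz2] ->]]. unfold Phi.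
    specialize (HM (z - w)%C Hz1). unfold shift in HM.
    replace (w + (z - w))%C with z in HM by ring.
    pose proof (Cmod_ge_0 (z - w)). pose proof (Cmod_ge_0 (f' z)). nra. }
  { exists (Phi w), w. auto. }
  assert (HSN : N < S).
  { eapply Rlt_le_trans; [exact HNw|]. rewrite <- HPw. apply HS1. exists w; auto. }
  assert (Hz0 : exists z0, E z0 /\ S / 2 < Phi z0).
  { apply NNPP. intros Hno. assert (S <= S / 2); [|lra].
    apply HS2. intros y [z [Hz ->]]. apply Rnot_lt_le. intros Hlt. apply Hno. exists z; auto. }
  destruct Hz0 as [z0 [[Hz1 Hz2] Hz0]].
  set (d := 1 - Cmod (z0 - w)) in *. set (m := Cmod (f' z0)) in *.
  assert (HPz : Phi z0 = d * m) by reflexivity. rewrite HPz in Hz0.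
  pose proof (Cmod_ge_0 (z0 - w)) as P0. pose proof (Cmod_ge_0 (f' z0)) as P1. fold m in P1.
  assert (Hd1 : d <= 1) by (unfold d; lra). assert (Hd0 : 0 <= d) by (unfold d; lra).
  assert (Hm : 0 < m) by nra. assert (Hd : 0 < d) by nra.
  exists z0, (/ m). assert (Hrho : 0 < / m) by (apply Rinv_0_lt_compat; auto).
  assert (HNm : N <= 2 * m) by (assert (0 <= (1 - d) * m) by (apply Rmult_le_pos; lra); lra).
  split; auto. split; [|split; [auto|split; [change (/ m * m = 1); field; lra|]]].
  { apply (Rmult_le_reg_l m); auto. replace (m * (/ m * N)) with N by (field; lra). lra. }
  intros z Hz Hfz. set (u := (z0 + RtoC (/ m) * z)%C) in *.
  assert (Hu : Cmod (u - z0) <= d / 2).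
  { replace (u - z0)%C with (RtoC (/ m) * z)%C by (unfold u; ring).
    rewrite Cmod_mult, Cmod_R, Rabs_pos_eq by lra.
    apply (Rmult_le_reg_l m); auto. replace (m * (/ m * Cmod z)) with (Cmod z) by (field; lra).
    nra. }
  pose proof (Cmod_sub_tri u z0 w) as Ht.
  assert (Hdu : d / 2 <= 1 - Cmod (u - w)) by (unfold d in *; lra).
  assert (HuS : (1 - Cmod (u - w)) * Cmod (f' u) <= S).
  { apply HS1. exists u. split; [split; [lra|auto]|reflexivity]. }
  pose proof (Cmod_ge_0 (f' u)) as P2.
  assert (H1 : d / 2 * Cmod (f' u) <= 2 * (d * m)) by nra.
  assert (H2 : Cmod (f' u) <= 4 * m) by nra.
  apply (Rmult_le_reg_l m); auto.
  replace (m * (/ m * Cmod (f' u))) with (Cmod (f' u)) by (field; lra). lra.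
Qed.

(** The value of a limit at a point [z0] can be read off from the values of the
    [G n] at points [w] that depend on [n] and approach [z0]. *)
Lemma Ucv_moving_point Psi (G : nat -> C -> C) g z0 v (P : nat -> C -> Prop) (e : nat -> R) :
  ProperFilter Psi -> Ucv Psi G g -> ccont g z0 ->
  (forall eps, 0 < eps -> Psi (fun n => exists w, Cmod (w - z0) < eps /\ P n w)) ->
  (forall eps, 0 < eps -> Psi (fun n => e n < eps)) ->
  (forall n w, P n w -> Cmod (G n w - v) <= e n) ->
  g z0 = v.
Proof.
  intros HP HU Hg HPn He HGv. apply Cmod_sub_eq_0.
  apply Rle_antisym; [|apply Cmod_ge_0]. apply le_epsilon. intros eps Heps. rewrite Rplus_0_l.
  assert (H3 : 0 < eps / 3) by lra.
  destruct (Hg _ H3) as [d [Hd Hdd]].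
  assert (Hd1 : 0 < Rmin d 1) by (apply Rmin_pos; lra).
  pose proof (Cmod_ge_0 z0) as Pz.
  assert (Hr : 0 < Cmod z0 + 1) by lra.
  destruct (filter_ex _ (filter_and _ _ (HPn _ Hd1) (filter_and _ _ (He _ H3) (HU _ _ Hr H3))))
    as [n [[w [Hw HPw]] [A1 A2]]].
  apply Rmin_Rgt_l in Hw. destruct Hw as [W1 W2].
  specialize (HGv n w HPw). specialize (Hdd w W1).
  specialize (A2 w). assert (Hwr : Cmod w <= Cmod z0 + 1).
  { pose proof (Cmod_le_add_sub w z0). lra. }
  specialize (A2 Hwr).
  rewrite (Cmod_sub_sym (g w)) in Hdd. rewrite (Cmod_sub_sym (G n w)) in A2.
  pose proof (Cmod_sub_tri (g z0) (g w) v). pose proof (Cmod_sub_tri (g w) (G n w) v). lra.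
Qed.

Lemma entire_minus_const (g : C -> C) c : entire g -> entire (fun z => g z - c)%C.
Proof.
  intros H z. destruct (H z) as [l Hl]. eexists. apply cderive_minus; [exact Hl|apply cderive_const].
Qed.

(** A sequence of rescalings of [f] with scales tending to 0 has a limit [g] that is
    not constant, of exponential type, and without critical points, but omits both
    shared values. *)
Theorem derivative_bounded_where_small (f : C -> C) (a b : C) :
  entire f -> a <> b ->
  share_allowing_ramification f a -> share_allowing_ramification f b ->
  exists K, 0 <= K /\ forall z, Cmod (f z) <= 1 -> Cmod (C_derive f z) <= K.
Proof.
  intros Hf Hab Ha Hb. apply NNPP. intros Hno.
  set (f' := C_derive f) in *.
  assert (Hf' : entire f') by (apply entire_C_derive; auto).
  assert (Hw : forall n : nat, exists w, Cmod (f w) <= 1 /\ INR n + 1 < Cmod (f' w)).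
  { intros n. apply NNPP. intros N. apply Hno. exists (INR n + 1).
    split; [pose proof (pos_INR n); lra|]. intros z Hz.
    apply Rnot_lt_le. intros Hlt. apply N. exists z; auto. }
  assert (Hsel : forall n : nat, exists p : C * R, let N := INR n + 1 in
     0 < snd p /\ snd p * N <= 2 /\ Cmod (f (fst p)) <= 1 /\ snd p * Cmod (f' (fst p)) = 1 /\
     forall z, Cmod z <= N / 4 -> Cmod (f (fst p + snd p * z)%C) <= 1 ->
      snd p * Cmod (f' (fst p + snd p * z)%C) <= 4).
  { intros n. destruct (Hw n) as [w [Hw1 Hw2]]. pose proof (pos_INR n).
    destruct (rescaling_point f f' w (INR n + 1) Hf') as [z0 [rho Hz]]; auto; [lra|].
    exists (z0, rho). exact Hz. }
  apply choice in Hsel. destruct Hsel as [p Hp].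
  set (z0 := fun n => fst (p n)). set (rho := fun n => snd (p n)).
  set (G := fun n z => f (z0 n + rho n * z)%C).
  set (G' := fun n z => (rho n * f' (z0 n + rho n * z))%C).
  assert (HGd : forall n z, cderive (G n) z (G' n z)).
  { intros n z.
    apply (cderive_eq _ _ (f' (z0 n + rho n * z) * (0 + (0 * z + rho n * 1)))%C);
      [unfold G'; ring|].
    apply (cderive_comp f (fun z => z0 n + rho n * z)%C).
    - apply entire_cderive; auto.
    - apply cderive_plus; [apply cderive_const|].
      apply (cderive_mult (fun _ => RtoC (rho n)) (fun z => z)); [apply cderive_const|apply cderive_id]. }
  assert (HGe : forall n, entire (G n)) by (intros n; apply (entire_of_cderive _ (G' n)); auto).
  assert (HGe' : forall n, entire (G' n))
  by (intros n; apply (entire_derive (G n)); auto).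
  assert (Hrho : forall n, 0 < rho n) by (intros n; apply (Hp n)).
  assert (HG'm : forall n z, Cmod (G' n z) = rho n * Cmod (f' (z0 n + rho n * z)%C)).
  { intros n z. unfold G'. rewrite Cmod_mult, Cmod_R, Rabs_pos_eq; auto. left; auto. }
  (* 8 is twice the bound 4 on the derivative of [G n] *)
  assert (Hgrow : forall n z, Cmod z <= (INR n + 1) / 8 -> Cmod (G n z) <= exp (8 * Cmod z)).
  { intros n z Hz. destruct (Hp n) as (_ & _ & H1 & _ & H2). fold (z0 n) (rho n) in *.
    pose proof (growth_lemma (G n) ((INR n + 1) / 4) 4 0%C (HGe n)) as Hg.
    assert (E : (z - 0)%C = z) by ring.
    replace (8 * Cmod z) with (2 * 4 * Cmod (z - 0)) by (rewrite E; ring).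
    apply Hg; [|lra| |rewrite E; lra].
    - unfold G. replace (z0 n + rho n * 0)%C with (z0 n) by ring. auto.
    - intros u l Hu HGu Hl. rewrite (cderive_unique _ _ _ _ Hl (HGd n u)), HG'm.
      apply H2; auto. replace (u - 0)%C with u in Hu by ring. auto. }
  destruct (montel G (fun r => exp (8 * r)) HGe) as [Psi [g [HP [Hfin [Hg HU]]]]].
  { intros r. destruct (nfloor_ex (Rmax 0 (8 * r))) as [N [_ HN]]; [apply Rmax_l|].
    exists N. intros n Hn z Hz. apply le_INR in Hn. pose proof (Rmax_r 0 (8 * r)).
    eapply Rle_trans; [apply Hgrow; lra|]. apply exp_le; lra. }
  assert (Hg' : exists g', forall z, cderive g z (g' z)) by (apply (choice (cderive g)); auto).
  destruct Hg' as [g' Hg'].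
  pose proof (Ucv_derive Psi G g G' g' HP HU HGd Hg') as HU'.
  assert (Hge' : entire g')
  by (apply (entire_derive g g'); auto).
  assert (Hcg : forall z, ccont g z) by (intros z; eapply cderive_ccont; eauto).
  assert (Hcg' : forall z, ccont g' z).
  { intros z. destruct (Hge' z) as [l Hl]. eapply cderive_ccont; eauto. }
  assert (Hrho0 : forall k eps, 0 <= k -> 0 < eps -> Psi (fun n => rho n * k < eps)).
  { intros k eps Hk He. apply Hfin.
    destruct (nfloor_ex (2 * k / eps)) as [N [_ HN]]; [apply Rdiv_le_0_compat; lra|].
    exists N. intros n Hn. apply le_INR in Hn. destruct (Hp n) as (H1 & H2 & _).
    fold (rho n) in *. pose proof (pos_INR n).
    assert (H3 : 2 * k < (INR n + 1) * eps) by (apply Rlt_div_l; lra).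
    apply (Rmult_lt_reg_r (INR n + 1)); [lra|]. nra. }
  assert (Hg'0 : Cmod (g' 0%C) = 1).
  { apply cond_eq. intros eps He.
    assert (He2 : 0 < eps / 2) by lra.
    destruct (filter_ex _ (HU' 1 _ Rlt_0_1 He2)) as [n Hn]. specialize (Hn 0%C).
    rewrite Cmod_0 in Hn. specialize (Hn ltac:(lra)).
    assert (E : Cmod (G' n 0%C) = 1).
    { rewrite HG'm. replace (z0 n + rho n * 0)%C with (z0 n) by ring. apply (Hp n). }
    pose proof (Cmod_le_add_sub (G' n 0%C) (g' 0%C)) as B1.
    pose proof (Cmod_le_add_sub (g' 0%C) (G' n 0%C)) as B2.
    rewrite (Cmod_sub_sym (g' 0%C)) in B2. apply Rabs_def1; lra. }
  assert (Hg'ne : exists z, g' z <> 0%C).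
  { exists 0%C. apply Cmod_gt_0. lra. }
  (* hence a critical point of [g] would be both an [a]-point and a [b]-point *)
  assert (Hcrit : forall c zc, share_allowing_ramification f c -> g' zc = 0%C -> g zc = c).
  { intros c zc Hc Hz.
    set (H := fun n z => (G' n z - rho n * c)%C).
    assert (HUH : Ucv Psi H g').
    { intros r eps Hr He. assert (He2 : 0 < eps / 2) by lra.
      generalize (filter_and _ _ (HU' r _ Hr He2) (Hrho0 (Cmod c) _ (Cmod_ge_0 c) He2)).
      apply filter_imp. intros n [A1 A2] z Hzr. specialize (A1 z Hzr). unfold H.
      replace (G' n z - rho n * c - g' z)%C with ((G' n z - g' z) - rho n * c)%C by ring.
      eapply Rle_trans; [apply Cmod_minus_le|].
      rewrite Cmod_mult, Cmod_R, Rabs_pos_eq by (left; auto). lra. }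
    assert (HHe : forall n, entire (H n)) by (intros n; apply entire_minus_const; auto).
    pose proof (hurwitz Psi H g' zc HP HHe Hge' HUH Hg'ne Hz) as Hw'.
    apply (Ucv_moving_point Psi G g zc c (fun n w => H n w = 0%C) (fun _ => 0)); auto.
    - intros eps He. apply filter_forall. auto.
    - intros n w Hnw. unfold G.
      assert (E : f' (z0 n + rho n * w)%C = c).
      { unfold H, G' in Hnw.
        assert (Nr : RtoC (rho n) <> 0%C).
        { apply Cmod_gt_0. rewrite Cmod_R, Rabs_pos_eq; auto. left; auto. }
        transitivity (/ rho n * (rho n * f' (z0 n + rho n * w) - rho n * c) + c)%C.
        - field; auto.
        - rewrite Hnw. ring. }
      apply (proj2 (Hc _)) in E. rewrite E. replace (c - c)%C with (RtoC 0) by ring.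
      rewrite Cmod_0. lra. }
  assert (Hnocrit : forall z, g' z <> 0%C).
  { intros z Hz. apply Hab. rewrite <- (Hcrit a z Ha Hz). apply Hcrit; auto. }
  (* [g] omits a shared value, since it could be taken only at a critical point *)
  assert (Homit : forall c z, share_allowing_ramification f c -> g z <> c).
  { intros c zc Hc Hz. apply (Hnocrit zc).
    set (H := fun n z => (G n z - c)%C).
    assert (HUH : Ucv Psi H (fun z => g z - c)%C).
    { intros r eps Hr He. generalize (HU r eps Hr He). apply filter_imp.
      intros n Hn z Hzr. unfold H.
      replace (G n z - c - (g z - c))%C with (G n z - g z)%C by ring. auto. }
    assert (HHe : forall n, entire (H n)) by (intros n; apply entire_minus_const; auto).
    assert (Hne : exists z, (g z - c)%C <> 0%C).
    { apply NNPP. intros N. apply (Hnocrit 0%C).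
      apply (cderive_unique g 0%C); auto.
      apply (cderive_ext (fun _ => c)); [|apply cderive_const].
      intros w. symmetry. apply Ceq_minus. apply NNPP. intros N'. apply N. exists w; auto. }
    assert (Hz0 : (g zc - c)%C = 0%C) by (rewrite Hz; ring).
    pose proof (hurwitz Psi H _ zc HP HHe (entire_minus_const _ c Hg) HUH Hne Hz0) as Hw'.
    apply (Ucv_moving_point Psi G' g' zc 0%C (fun n w => H n w = 0%C) (fun n => rho n * Cmod c)); auto.
    - intros eps He. apply Hrho0; auto. apply Cmod_ge_0.
    - intros n w Hnw. apply Ceq_minus in Hnw. unfold G in Hnw.
      replace (G' n w - 0)%C with (G' n w) by ring. rewrite HG'm.
      apply Rmult_le_compat_l; [left; auto|].
      destruct (proj1 (Hc _) Hnw) as [E|E]; fold f' in E; rewrite E; [lra|].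
      rewrite Cmod_0. apply Cmod_ge_0. }
  destruct (picard_exponential_type g g' 0 8 a b Hg' Hnocrit) as [z [Hz|Hz]]; auto.
  - lra.
  - intros z. apply le_epsilon. intros eps He.
    pose proof (Cmod_ge_0 z) as Pz. assert (Hr : 0 < Cmod z + 1) by lra.
    assert (Hev : eventually (fun n => 8 * Cmod z <= INR n + 1)).
    { destruct (nfloor_ex (8 * Cmod z)) as [N [_ HN]]; [lra|]. exists N. intros n Hn.
      apply le_INR in Hn. lra. }
    destruct (filter_ex _ (filter_and _ _ (Hfin _ Hev) (HU _ _ Hr He))) as [n [A1 A2]].
    specialize (A2 z ltac:(lra)). specialize (Hgrow n z ltac:(lra)).
    pose proof (Cmod_le_add_sub (g z) (G n z)) as B. rewrite Cmod_sub_sym in B.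
    rewrite Rplus_0_l. lra.
  - apply (Homit a z); auto.
  - apply (Homit b z); auto.
Qed.

(** * Order at most one *)

(** Otherwise [1 / f] is bounded and Liouville's theorem applies. *)
Lemma exists_small_value f : entire f -> nonconstant f -> exists z, Cmod (f z) <= 1.
Proof.
  intros Hf Hn. apply NNPP. intros N.
  assert (Hb : forall z, 1 < Cmod (f z)).
  { intros z. apply Rnot_le_lt. intros H. apply N. exists z; auto. }
  assert (Hne : forall z, f z <> 0%C).
  { intros z. apply Cmod_gt_0. specialize (Hb z). lra. }
  assert (Hc : forall z, (/ f z = / f 0)%C).
  { apply (liouville (fun z => / f z)%C 1).
    - intros z. apply (hol_inv f p_infty); [apply entire_hol; auto|intros w _; auto|simpl; auto].
    - intros z. rewrite Cmod_inv by auto. rewrite <- Rinv_1.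
      apply Rinv_le_contravar; [lra|]. left; auto. }
  apply Hn. exists (f 0%C). intros z. specialize (Hc z).
  replace (f z) with (/ / f z)%C by (field; auto). rewrite Hc. field; auto.
Qed.

Lemma max_modulus_le f r M : 0 <= r ->
  (forall z, Cmod z = r -> Cmod (f z) <= M) -> max_modulus f r <= M.
Proof.
  intros Hr H. unfold max_modulus.
  set (E := fun y => exists z : C, Cmod z = r /\ y = Cmod (f z)).
  destruct (Lub_Rbar_correct E) as [H1 H2].
  assert (HM : Rbar_le (Lub_Rbar E) M).
  { apply H2. intros y [z [Hz ->]]. simpl. auto. }
  assert (H0 : Rbar_le (Cmod (f (circ r 0))) (Lub_Rbar E)).
  { apply H1. exists (circ r 0). split; auto. apply Cmod_circ; auto. }
  destruct (Lub_Rbar E); simpl in *; tauto || auto.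
Qed.

Lemma ln_nonpos x : x <= 0 -> ln x = 0.
Proof. intros H. unfold ln. destruct (Rlt_dec 0 x) as [Hx|Hx]; [exfalso; lra|reflexivity]. Qed.

(** For large [r] both logarithms are taken of positive numbers or have the value 0,
    and the bound [ln M <= 2 k r] gives [ln (ln M) / ln r <= 1 + ln (2 k) / ln r]. *)
Lemma growth_order_le_1 f (p : C) (K : R) :
  (forall z, Cmod (f z) <= exp (K * Cmod (z - p))) -> Rbar_le (growth_order f) 1.
Proof.
  intros H. unfold growth_order, LimSup_p_infty, Rbar_glb.
  destruct (Rbar_ex_glb _) as [l HHl]. simpl. destruct HHl as [Hl _].
  assert (Hle : forall eps, 0 < eps -> Rbar_le l (1 + eps)).
  { intros eps He.
    set (k := Rabs K + 1). pose proof (Rabs_pos K) as PK.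
    assert (HKk : K <= k) by (unfold k; pose proof (Rle_abs K); lra).
    pose proof (Cmod_ge_0 p) as Pp. 
    set (r0 := Rmax (Cmod p + 1) (exp (Rabs (ln (2 * k)) / eps + 1))).
    eapply Rbar_le_trans; [apply Hl; exists r0; reflexivity|].
    match goal with |- Rbar_le (Lub_Rbar ?E) _ => destruct (Lub_Rbar_correct E) as [_ Hlub] end.
    apply Hlub. intros y [r [Hr ->]]. simpl.
    assert (Hr1 : Cmod p + 1 < r) by (eapply Rle_lt_trans; [apply Rmax_l|exact Hr]).
    assert (Hr2 : exp (Rabs (ln (2 * k)) / eps + 1) < r)
      by (eapply Rle_lt_trans; [apply Rmax_r|exact Hr]).
    assert (Hlnr : Rabs (ln (2 * k)) / eps + 1 < ln r).
    { rewrite <- (ln_exp (Rabs (ln (2 * k)) / eps + 1)). apply ln_increasing; auto. apply exp_pos. }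
    assert (Hq : 0 <= Rabs (ln (2 * k)) / eps) by (apply Rdiv_le_0_compat; auto; apply Rabs_pos).
    assert (Hlnr0 : 0 < ln r) by lra.
    assert (HM : max_modulus f r <= exp (k * (2 * r))).
    { apply max_modulus_le; [lra|]. intros z Hz. eapply Rle_trans; [apply H|].
      apply exp_le. pose proof (Cmod_minus_le z p). pose proof (Cmod_ge_0 (z - p)).
      apply Rle_trans with (k * Cmod (z - p)); [apply Rmult_le_compat_r; auto|].
      apply Rmult_le_compat_l; unfold k; lra. }
    assert (Hln : ln (max_modulus f r) <= k * (2 * r)).
    { destruct (Rlt_dec 0 (max_modulus f r)) as [Hp|Hp].
      - rewrite <- (ln_exp (k * (2 * r))). apply ln_le; auto.
      - rewrite ln_nonpos by lra. unfold k. nra. }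
    assert (Hlnln : ln (ln (max_modulus f r)) <= Rabs (ln (2 * k)) + ln r).
    { destruct (Rlt_dec 0 (ln (max_modulus f r))) as [Hp|Hp].
      - eapply Rle_trans; [apply ln_le; eauto|].
        replace (k * (2 * r)) with (2 * k * r) by ring.
        rewrite ln_mult by (unfold k; lra). pose proof (Rle_abs (ln (2 * k))). lra.
      - rewrite ln_nonpos by lra. pose proof (Rabs_pos (ln (2 * k))). lra. }
    apply Rle_div_l; auto. eapply Rle_trans; [exact Hlnln|].
    assert (Rabs (ln (2 * k)) <= eps * ln r); [|lra].
    replace (Rabs (ln (2 * k))) with (eps * (Rabs (ln (2 * k)) / eps)) by (field; lra).
    apply Rmult_le_compat_l; lra. }
  destruct l as [l| |]; simpl in *; auto.
  - apply le_epsilon. intros eps He. apply Hle; auto.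
  - apply (Hle 1). lra.
Qed.

Theorem sharing_order_le_1 (f : C -> C) (a b : C) :
  entire f -> nonconstant f -> a <> b ->
  share_allowing_ramification f a -> share_allowing_ramification f b ->
  Rbar_le (growth_order f) 1.
Proof.
  intros Hf Hn Hab Ha Hb.
  assert (Hfe : entire f) by exact Hf.
  destruct (derivative_bounded_where_small f a b Hf Hab Ha Hb) as [K [HK0 HK]].
  destruct (exists_small_value f Hfe Hn) as [p Hp].
  apply (growth_order_le_1 f p (2 * K)). intros z.
  apply (growth_lemma f (2 * Cmod (z - p)) K p); auto; [|lra].
  intros w l _ Hw Hl. rewrite (cderive_unique _ _ _ _ Hl (entire_cderive f w Hf)). auto.
Qed.

(** * Polynomials *)

Module PolynomialCase.
Import all_boot all_order all_algebra ring zify Rstruct.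
Import mathcomp.real_closed.complex.
Import GRing.Theory Num.Theory.
Local Open Scope ring_scope.

Lemma size_deriv_num (F : numDomainType) (p : {poly F}) : size p^`() = (size p).-1.
Proof.
case: (ltnP 1 (size p)) => [p_gt1|]; last first.
  by move=> p_le1; rewrite (size1_polyC p_le1) derivC size_poly0 size_polyC; case: eqP.
case Ep: (size p) p_gt1 => [|[|n]] // _; rewrite /deriv size_poly_eq Ep //.
rewrite mulrn_eq0 /=.
by have := lead_coef_eq0 p; rewrite lead_coefE Ep /= => ->; rewrite -size_poly_eq0 Ep.
Qed.

(** A root of [q] of multiplicity [m] is a root of [q'] of multiplicity [m - 1] and
    of [r] of multiplicity at least 1.  The proof removes one linear factor of [q]
    at a time. *)
Lemma dvdp_deriv_mul (F : closedFieldType) (q r : {poly F}) :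
  q != 0 -> (forall z, root q z -> root r z) -> q %| q^`() * r.
Proof.
have [s ->] := closed_field_poly_normal q.
set c := lead_coef _ => nz.
have c0 : c != 0 by apply: contraNneq nz => ->; rewrite scale0r.
rewrite dvdpZl // derivZ -scalerAl dvdpZr // => H.
have {}H : forall z, z \in s -> root r z.
  by move=> z zs; apply: H; rewrite rootZ // root_prod_XsubC.
elim: s H {nz} => [|x s IH] H; first by rewrite big_nil dvd1p.
rewrite big_cons; set p := \prod_(z <- s) _ in IH *.
have {IH}Hp : p %| p^`() * r by apply: IH => z zs; apply: H; rewrite inE zs orbT.
have Hr : 'X - x%:P %| r by rewrite dvdp_XsubCl; apply: H; rewrite inE eqxx.
rewrite derivM derivXsubC mul1r [X in _ %| X]mulrDl; apply: dvdp_add.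
  by rewrite mulrC dvdp_mul.
by rewrite -mulrA dvdp_mul.
Qed.

(** Write [d = p'], [p = q d + r] with [q] linear of slope [al].  Then [d' q] equals
    [(1 - al) d - r'], and modulo [d - t] the polynomial [d' (p - t)], which [d - t]
    divides by [dvdp_deriv_mul], reduces to [A t] of degree at most [2 n - 4],
    where [n] is the degree of [p].  So [A t = T (d - t)] with [T] of degree at most
    [n - 3].  For [t = a] and [t = b] the difference [A a - A b] has degree exactly
    [n - 2], because of its term [(b - a) d'].  Comparing with
    [Ta (d - a) - Tb (d - b)] first forces [Ta = Tb], as [d] has degree [n - 1], and
    then the degree is at most [n - 3]. *)
Lemma no_sharing_ge3 (F : numClosedFieldType) (p : {poly F}) (a b : F) :
  (3 < size p)%N -> a != b ->
  (forall z, p^`().[z] = a -> p.[z] = a) ->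
  (forall z, p^`().[z] = b -> p.[z] = b) -> False.
Proof.
move=> p3 ab Ha Hb.
set d := p^`().
have sd : size d = (size p).-1 by apply: size_deriv_num.
have sdd : size d^`() = (size p).-2 by rewrite size_deriv_num sd.
have d0 : d != 0 by rewrite -size_poly_gt0 sd; case: (size p) p3 => [|[|]].
pose q : {poly F} := p %/ d; pose r : {poly F} := p %% d.
have Ep : p = q * d + r by apply: divp_eq.
have sq : (size q <= 2)%N.
  by rewrite size_divp // sd; case: (size p) p3 => [|[|n]] //= _; rewrite subSn ?subnn // ?subSnn.
have sr : (size r < size d)%N by rewrite ltn_modp.
pose al : F := q`_1.
have Eq : q^`() = al%:P.
  have s1 : (size q^`() <= 1)%N.
    by rewrite size_deriv_num; case: (size q) sq => [|[|[|]]].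
  by rewrite (size1_polyC s1) coef_deriv mulr1n.
have Ed : d^`() * q = (1 - al)%:P * d - r^`().
  have : d = q^`() * d + q * d^`() + r^`() by rewrite /d {1}Ep derivD derivM.
  rewrite Eq => E; rewrite rmorphB rmorph1 mulrBl mul1r {2}E; ring.
pose A (t : F) : {poly F} := ((1 - al) * t ^+ 2)%:P - t%:P * r^`() + d^`() * (r - t%:P).
have EA t : d^`() * (p - t%:P) = A t + (d - t%:P) * ((1 - al)%:P * (d + t%:P) - r^`()).
  rewrite /A {1}Ep.
  have -> : d^`() * (q * d + r - t%:P) = d^`() * q * d + d^`() * (r - t%:P) by ring.
  rewrite Ed polyCM polyC_exp; ring.
have sdt t : size (d - t%:P) = (size p).-1.
  rewrite size_polyDl ?sd // size_polyN (leq_ltn_trans (size_polyC_leq1 _)) //.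
  by case: (size p) p3 => [|[|[|]]].
have dt0 t : d - t%:P != 0.
  by rewrite -size_poly_gt0 sdt; case: (size p) p3 => [|[|]].
have Adiv t : (forall z, d.[z] = t -> p.[z] = t) -> d - t%:P %| A t.
  move=> Ht.
  have D : d - t%:P %| (d - t%:P)^`() * (p - t%:P).
    apply: dvdp_deriv_mul => // z /rootP; rewrite !hornerE => /eqP.
    by rewrite subr_eq0 => /eqP/Ht E; apply/rootP; rewrite !hornerE E subrr.
  by rewrite derivB derivC subr0 EA dvdp_addl // dvdp_mulr in D.
move EN: (size p) p3 sd sdd sdt => N p3 sd sdd sdt.
have sr' : (size r^`() <= N - 3)%N.
  rewrite size_deriv_num; move: sr; rewrite sd.
  by move: (size r) => k; clear -p3; lia.
have sC (c : F) : (size (c%:P : {poly F}) <= N - 3)%N.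
  by rewrite (leq_trans (size_polyC_leq1 _)) // subn_gt0.
have sM (c : F) (u : {poly F}) : (size (c%:P * u)%R <= size u)%N.
  by rewrite mul_polyC size_scale_leq.
have sA t : (size (A t) <= N + N - 5)%N.
  have N5 : (N - 3 <= N + N - 5)%N by lia.
  have Hrt : (size (r - t%:P)%R <= N - 2)%N.
    rewrite (leq_trans (size_polyD _ _)) // geq_max size_polyN; apply/andP; split.
      by move: sr; rewrite sd; lia.
    by rewrite (leq_trans (sC t)) //; lia.
  rewrite (leq_trans (size_polyD _ _)) // geq_max; apply/andP; split.
    rewrite (leq_trans (size_polyD _ _)) // geq_max size_polyN; apply/andP; split.
      by rewrite (leq_trans (sC _)).
    by rewrite (leq_trans (sM _ _)) // (leq_trans sr').
  rewrite (leq_trans (size_polyMleq _ _)) // sdd. 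
  by move: (size _) Hrt => k; clear -p3; lia.
have sT t T : A t = T * (d - t%:P) -> (size T <= N - 3)%N.
  move=> ET; have [->|T0] := eqVneq T 0; first by rewrite size_poly0.
  have := sA t; rewrite ET size_mul // sdt.
  by have := size_poly_gt0 T; rewrite T0; move: (size T) => k; clear -p3; lia.
have [Ta ETa] := dvdpP _ _ (Adiv a Ha).
have [Tb ETb] := dvdpP _ _ (Adiv b Hb).
have {}sTa := sT _ _ ETa; have {}sTb := sT _ _ ETb.
have sD (u v : {poly F}) k : (size u <= k)%N -> (size v <= k)%N -> (size (u + v)%R <= k)%N.
  by move=> su sv; rewrite (leq_trans (size_polyD _ _)) // geq_max su.
pose small := ((1 - al) * (a ^+ 2 - b ^+ 2))%:P - (a - b)%:P * r^`().
have Hsmall : (size small <= N - 3)%N.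
  by apply: (sD) => //; rewrite size_polyN (leq_trans (sM _ _)).
have E1 : (Ta - Tb) * d = small - (a - b)%:P * d^`() + a%:P * Ta - b%:P * Tb.
  have E0 : (Ta - Tb) * d = A a - A b + a%:P * Ta - b%:P * Tb by rewrite ETa ETb; ring.
  by rewrite E0 /A /small !polyCM !polyCB !polyC_exp; ring.
have Tab : Ta = Tb.
  apply/eqP; rewrite -subr_eq0; apply/negPn/negP => nz.
  have : (size ((Ta - Tb) * d)%R <= N - 2)%N.
    rewrite E1; apply: (sD); first apply: (sD); first apply: (sD).
    - by move: (size small) Hsmall => k; clear -p3; lia.
    - by rewrite size_polyN (leq_trans (sM _ _)) // sdd; lia.
    - by rewrite (leq_trans (sM _ _)) //; move: (size Ta) sTa => k; clear -p3; lia.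
    - by rewrite size_polyN (leq_trans (sM _ _)) //; move: (size Tb) sTb => k; clear -p3; lia.
  rewrite size_mul // sd; have := size_poly_gt0 (Ta - Tb); rewrite nz.
  by move: (size (Ta - Tb)%R) => k; clear -p3; lia.
have : (size ((a - b)%:P * d^`())%R <= N - 3)%N.
  have -> : (a - b)%:P * d^`() = small + (a - b)%:P * Ta.
    by move: E1; rewrite Tab subrr mul0r => /eqP; rewrite eq_sym => /eqP E1; rewrite -[LHS]addr0 -E1 polyCB; ring.
  by apply: (sD) => //; rewrite (leq_trans (sM _ _)) // Tab.
by rewrite mul_polyC size_scale ?subr_eq0 // sdd; lia.
Qed.

(** In degree 2 the reflection at the critical point preserves [p] and changes the
    sign of [p']: the point where [p' = a], and so [p = a], is sent to a point where
    [p = a] and [p' = - a].  In degree 1 the constant [p'] would be both [a] and [b]. *)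
Lemma no_sharing_le3 (F : numClosedFieldType) (p : {poly F}) (a b : F) :
  (size p <= 3)%N -> a != 0 -> b != 0 -> a != b ->
  (exists z, p.[z] != p.[0]) ->
  (forall z, p^`().[z] = a -> p.[z] = a) ->
  (forall z, p.[z] = a -> p^`().[z] = a \/ p^`().[z] = 0) ->
  (forall z, p.[z] = b -> p^`().[z] = b \/ p^`().[z] = 0) -> False.
Proof.
move=> p3 a0 b0 ab [w Hw] Ha' Ha Hb.
set c0 := p`_0; set c1 := p`_1; set c2 := p`_2.
have Ep z : p.[z] = c0 + c1 * z + c2 * z ^+ 2.
  rewrite (horner_coef_wide z p3) !big_ord_recl big_ord0 /= /bump /=.
  by rewrite expr0 mulr1 expr1 addr0 addrA.
have Ed z : p^`().[z] = c1 + 2%:R * c2 * z.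
  have p2 : (size p^`() <= 2)%N by rewrite size_deriv_num; case: (size p) p3 => [|[|[|[|]]]].
  rewrite (horner_coef_wide z p2) !big_ord_recl big_ord0 /= /bump /= !coef_deriv.
  by rewrite expr0 mulr1 expr1 addr0 mulr1n mulr_natl.
have two0 : 2%:R != 0 :> F by rewrite pnatr_eq0.
have [c20|c2n] := eqVneq c2 0; last first.
  pose z := (a - c1) / (2%:R * c2).
  have d0 : 2%:R * c2 != 0 by rewrite mulf_neq0.
  have Ez : p^`().[z] = a by rewrite Ed /z; field; rewrite c2n.
  have Epz := Ha' _ Ez.
  pose z' := - c1 / c2 - z.
  have Epz' : p.[z'] = a by rewrite -[RHS]Epz !Ep /z'; field.
  have Edz' : p^`().[z'] = - a by rewrite -Ez !Ed /z'; field.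
  have [] := Ha _ Epz'; rewrite Edz' => /eqP.
    by rewrite eq_sym -subr_eq0 opprK -mulr2n mulrn_eq0 /= (negPf a0).
  by rewrite oppr_eq0 (negPf a0).
have [c10|c1n] := eqVneq c1 0.
  by move: Hw; rewrite !Ep c10 c20 !mul0r !addr0 eqxx.
have val t : (forall z, p.[z] = t -> p^`().[z] = t \/ p^`().[z] = 0) -> c1 = t.
  move=> Ht; have Epz : p.[(t - c0) / c1] = t by rewrite Ep c20; field.
  have [] := Ht _ Epz; rewrite Ed c20 mulr0 mul0r addr0 // => E.
  by move: c1n; rewrite E eqxx.
by move: ab; rewrite -(val _ Ha) -(val _ Hb) eqxx.
Qed.

Lemma no_sharing_poly (F : numClosedFieldType) (p : {poly F}) (a b : F) :
  a != 0 -> b != 0 -> a != b ->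
  (exists z, p.[z] != p.[0]) ->
  (forall z, p^`().[z] = a -> p.[z] = a) ->
  (forall z, p^`().[z] = b -> p.[z] = b) ->
  (forall z, p.[z] = a -> p^`().[z] = a \/ p^`().[z] = 0) ->
  (forall z, p.[z] = b -> p^`().[z] = b \/ p^`().[z] = 0) -> False.
Proof.
move=> a0 b0 ab nc Ha' Hb' Ha Hb.
case: (leqP (size p) 3) => [p3|p3]; first exact: (no_sharing_le3 _ p a b).
exact: (no_sharing_ge3 _ p a b).
Qed.

(** Both types of complex numbers are pairs of reals with the same operations. *)
Definition iota (z : C) : complex R := Complex z.1 z.2.
Definition pi (z : complex R) : C := (complex.Re z, complex.Im z).

Lemma piK z : iota (pi z) = z. Proof. by case: z. Qed.
Lemma iotaK z : pi (iota z) = z. Proof. by case: z. Qed.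
Lemma iotaM x y : iota (Cmult x y) = iota x * iota y.
Proof. by case: x y => [? ?] [? ?]. Qed.
Lemma iota0 : iota (RtoC 0%R) = 0. Proof. by []. Qed.
Lemma piD x y : pi (x + y) = Cplus (pi x) (pi y).
Proof. by case: x y => [? ?] [? ?]. Qed.
Lemma piM x y : pi (x * y) = Cmult (pi x) (pi y).
Proof. by case: x y => [? ?] [? ?]. Qed.

Definition peval (p : {poly complex R}) (z : C) : C := pi p.[iota z].

Lemma cderive_peval p z : cderive (peval p) z (peval p^`() z).
Proof.
elim/poly_ind: p z => [|p c IH] z.
  apply: (cderive_eq _ _ (RtoC 0%R)); first by rewrite /peval derivC horner0.
  apply: (cderive_ext (fun=> RtoC 0%R)); last exact: cderive_const.
  by move=> w; rewrite /peval horner0.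
apply: (cderive_ext (fun w => Cplus (Cmult (peval p w) w) (pi c))).
  by move=> w; rewrite /peval !hornerE piD piM iotaK.
apply: (cderive_eq _ _ (Cplus (Cplus (Cmult (peval p^`() z) z) (Cmult (peval p z) (RtoC 1%R))) (RtoC 0%R))).
  rewrite /peval derivD derivC addr0 derivM derivX mulr1 !hornerE piD piM iotaK.
  by rewrite Cplus_0_r Cmult_1_r.
apply: cderive_plus; last exact: cderive_const.
apply: (cderive_mult (peval p) id); first exact: IH.
exact: cderive_id.
Qed.

Lemma polynomial_peval f : is_polynomial f -> exists p, forall z, f z = peval p z.
Proof.
case=> n [a Hf].
have [p Hp] : exists p, forall z, Csum (fun k => Cmult (a k) (Cpow z k)) n = peval p z.
  have Epow z k : iota (Cpow z k) = iota z ^+ k.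
    by elim: k => [|k IH]; rewrite ?expr0 // Cpow_S iotaM IH exprS.
  elim: n {Hf} => [|n [p IH]].
    exists (iota (a 0%N))%:P => z; rewrite Csum_0 /peval hornerC iotaK.
    exact: Cmult_1_r.
  exists (p + (iota (a n.+1)) *: 'X^(n.+1)) => z.
  rewrite Csum_S IH /peval !hornerE piD; congr Cplus.
  by rewrite -[LHS]iotaK iotaM Epow.
by exists p => z; rewrite Hf -Hp.
Qed.

Theorem sharing_not_polynomial (f : C -> C) (a b : C) :
  nonconstant f -> a <> RtoC 0%R -> b <> RtoC 0%R -> a <> b ->
  share_allowing_ramification f a -> share_allowing_ramification f b ->
  transcendental f.
Proof.
move=> nc a0 b0 ab Ha Hb /polynomial_peval [p Hp].
have Ed z : C_derive f z = peval p^`() z.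
  apply: is_C_derive_unique; apply: (cderive_ext (peval p)); first by [].
  exact: cderive_peval.
have iota_inj x y : iota x = iota y -> x = y by move=> E; rewrite -(iotaK x) E iotaK.
have Ev z c : p.[z] = iota c <-> f (pi z) = c.
  by rewrite Hp /peval piK; split=> [->|<-]; rewrite ?iotaK ?piK.
have Edv z c : p^`().[z] = iota c <-> C_derive f (pi z) = c.
  by rewrite Ed /peval piK; split=> [->|<-]; rewrite ?iotaK ?piK.
have up c : share_allowing_ramification f c -> forall z, p^`().[z] = iota c -> p.[z] = iota c.
  by move=> Hc z /Edv E; apply/Ev; apply: (proj2 (Hc _)).
have down c : share_allowing_ramification f c ->
    forall z, p.[z] = iota c -> p^`().[z] = iota c \/ p^`().[z] = 0.
  move=> Hc z /Ev E; have [E'|E'] := proj1 (Hc _) E; [left|right]; first exact/Edv.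
  by rewrite -iota0; apply/Edv.
apply: (no_sharing_poly _ p (iota a) (iota b)); try exact: up; try exact: down.
- by apply/eqP; rewrite -iota0 => /iota_inj.
- by apply/eqP; rewrite -iota0 => /iota_inj.
- by apply/eqP => /iota_inj.
apply: Classical_Prop.NNPP => H; apply: nc; exists (f (RtoC 0%R)) => z.
rewrite !Hp /peval; congr pi; apply/eqP/negPn/negP => N; apply: H.
by exists (iota z).
Qed.

End PolynomialCase.

Theorem corollary2p4 (f : C -> C)
  (f_entire : entire f) (f_nonconstant : nonconstant f)
  (f_shares : exists a b : C,
     a <> 0%C /\ b <> 0%C /\ a <> b /\
     share_allowing_ramification f a /\ share_allowing_ramification f b) :
  transcendental f /\ Rbar_le (growth_order f) (Finite 1%R).
Proof.
  destruct f_shares as (a & b & Ha & Hb & Hab & Sa & Sb). split.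
  - apply (PolynomialCase.sharing_not_polynomial f a b); auto.
  - apply (sharing_order_le_1 f a b); auto.
Qed.
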